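(* For $k\in\{12,16,18,20,22,26\}$ let $\Delta_k(z)=\Delta(z)E_{k-12}(z)$. Let $L(s,\Delta_k)$ and $\Lambda(\Delta_k,s)$ be its (analytically normalised) $L$-function and completed $L$-function, and let $m(\Delta_k)=\operatorname{ord}_{s=1/2}L(s,\Delta_k)$. Then: (1) for every $k\in\{12,16,18,20,22,26\}$, $\Lambda(\Delta_k,s)$ satisfies the super-positivity property, i.e. $\Lambda^{(m)}\!\left(\Delta_k,\tfrac12\right)\ge0$ for all integers $m\ge0$ (derivatives taken in $s$); (2) if $k\in\{12,16,20\}$, then $m(\Delta_k)=0$; (3) if $k\in\{18,22,26\}$, then $m(\Delta_k)=1$.
   Context: Here $q=e^{2\pi iz}$ and $\Delta(z)=q\prod_{n\ge1}(1-q^n)^{24}$. For an integer $j\ge 2$, $E_{2j}(z)=1-\frac{4j}{B_{2j}}\sum_{n\ge1}\sigma_{2j-1}(n)q^n$ is the Eisenstein series of weight $2j$ for $\mathrm{SL}_2(\mathbb Z)$ ($B_{2j}$ the Bernoulli number, $\sigma_r(n)=\sum_{d\mid n}d^r$), and by convention $E_0=1$. Write $\Delta_k(z)=\sum_{n\ge1}\tau_k(n)q^n$, a Hecke cusp form of weight $k$ for $\mathrm{SL}_2(\mathbb Z)$. $L(s,\Delta_k)=\sum_{n\ge1}\tau_k(n)n^{-\frac{k-1}{2}}n^{-s}$ for $\mathrm{Re}(s)>1$, which extends to an entire function, and $$\Lambda(\Delta_k,s)=(2\pi)^{-s-\frac{k-1}{2}}\,\Gamma\!\left(s+\tfrac{k-1}{2}\right)L(s,\Delta_k),$$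 which is entire and satisfies $\Lambda(\Delta_k,s)=(-1)^{k/2}\Lambda(\Delta_k,1-s)$. *)

(* Defs.v *)
From Stdlib Require Import Reals List Arith.
From Coquelicot Require Import Coquelicot.
Import ListNotations.
Open Scope R_scope.
Open Scope C_scope.

(** ** Complex analysis *)

Definition Cexp (z : C) : C := (exp (Re z) * cos (Im z), exp (Re z) * sin (Im z))%R.

(** [t ^ s] for a positive real [t]. *)
Definition Rcpow (t : R) (s : C) : C := Cexp (s * ln t).

(** Componentwise, like Coquelicot's [C_lim]; junk when the sequence diverges. *)
Definition C_lim_seq (u : nat -> C) : C :=
  (real (Lim_seq (fun n => Re (u n))), real (Lim_seq (fun n => Im (u n)))).

Definition C_series (a : nat -> C) : C := C_lim_seq (sum_n a).

Fixpoint C_prod (u : nat -> C) (n : nat) : C :=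
  match n with
  | O => 1
  | S m => C_prod u m * u m
  end.

Definition holomorphic_at (f : C -> C) (s : C) : Prop :=
  ex_derive (K := C_AbsRing) (V := C_NormedModule) f s.

Definition entire (f : C -> C) : Prop := forall s, holomorphic_at f s.

Definition C_derive_n (f : C -> C) (m : nat) : C -> C := Nat.iter m C_derive f.

(** [f] has order of vanishing exactly [m] at [s0]. *)
Definition is_ord (f : C -> C) (s0 : C) (m : nat) : Prop :=
  exists g : C -> C,
    g s0 <> 0 /\
    locally s0 (fun s => holomorphic_at g s /\ f s = (s - s0) ^ m * g s).

Definition nonneg_real (z : C) : Prop := Im z = 0%R /\ (0 <= Re z)%R.

(** Euler's integral, for [0 < Re s]. *)
Definition Euler_Gamma (s : C) : C :=
  RInt_gen (V := C_R_CompleteNormedModule)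
    (fun t : R => Rcpow t (s - 1) * exp (- t))
    (at_right 0) (Rbar_locally p_infty).

(** Continued by [Gamma s = Gamma (s + N) / (s (s + 1) ... (s + N - 1))], where
    [N] is the least natural number with [0 < Re s + N]; junk at the poles. *)
Definition Gamma (s : C) : C :=
  let N := Z.to_nat (up (- Re s)) in
  Euler_Gamma (s + INR N) / C_prod (fun i => s + INR i) N.

Definition Gamma_pole (s : C) : Prop := exists n : nat, s = - INR n.

(** ** Level one modular forms *)

(** [B_0, ..., B_n], by [sum_(i <= m) binomial (m + 1) i * B_i = 0] for
    [1 <= m]. *)
Fixpoint bernoulli_upto (n : nat) : list R :=
  match n with
  | O => [1%R]
  | S m =>
      let l := bernoulli_upto m in
      l ++ [(- sum_f_R0 (fun i => Binomial.C (m + 2) i * nth i l 0) m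
              / INR (m + 2))%R]
  end.

Definition bernoulli (n : nat) : R := nth n (bernoulli_upto n) 0%R.

Definition divisor_sum (r n : nat) : nat :=
  list_sum (map (fun d => Nat.pow d r)
             (filter (fun d => Nat.eqb (Nat.modulo n d) 0) (seq 1 n))).

Definition q (z : C) : C := Cexp (2 * PI * Ci * z).

Definition discriminant (z : C) : C :=
  q z * C_lim_seq (C_prod (fun n => (1 - q z ^ S n) ^ 24)).

(** The Eisenstein series of weight [2 j]. *)
Definition Eisenstein (j : nat) (z : C) : C :=
  match j with
  | O => 1
  | _ => 1 - (INR (4 * j) / bernoulli (2 * j))%R
               * C_series (fun n => INR (divisor_sum (2 * j - 1) (S n)) * q z ^ S n)
  end.

(** Here [k - 12] is even, and [Eisenstein] is indexed by half the weight. *)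
Definition Delta_form (k : nat) (z : C) : C :=
  discriminant z * Eisenstein (Nat.div2 (k - 12)) z.

(** The value [a 0] is not used. *)
Definition is_q_expansion (f : C -> C) (a : nat -> C) : Prop :=
  forall z : C, (0 < Im z)%R ->
    is_series (K := C_AbsRing) (V := C_NormedModule)
      (fun n => a (S n) * q z ^ S n) (f z).

(** ** L-functions *)

(** [L] is the analytic continuation of the Dirichlet series, normalised by
    [n ^ (- (k - 1) / 2)], of the cusp form of weight [k] with Fourier
    coefficients [a]. *)
Definition is_L_function (k : nat) (a : nat -> C) (L : C -> C) : Prop :=
  entire L /\
  forall s : C, (1 < Re s)%R ->
    is_series (K := C_AbsRing) (V := C_NormedModule)
      (fun n => a (S n) * Rcpow (INR (S n)) (- ((INR k - 1) / 2))%R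
                  * Rcpow (INR (S n)) (- s))
      (L s).

(** The formula is imposed off the poles of the Gamma factor only; at those
    points the value is the one given by continuity. *)
Definition is_completed_L_function (k : nat) (L Lam : C -> C) : Prop :=
  entire Lam /\
  forall s : C, ~ Gamma_pole (s + ((INR k - 1) / 2)%R) ->
    Lam s = Rcpow (2 * PI) (- s - ((INR k - 1) / 2)%R)
              * Gamma (s + ((INR k - 1) / 2)%R) * L s.

Definition super_positive (Lam : C -> C) : Prop :=
  forall m : nat, nonneg_real (C_derive_n Lam m (1 / 2)).

(* Main.v *)
(* On the imaginary axis [Delta_k] is real and [Delta_k (i / y) = (-1) ^ (k / 2) y ^ k Delta_k (i y)],
   so the completed L-function at [s] is the two-sided Laplace transform at [s - 1 / 2] of
   [p u = Delta_k (i e ^ u) e ^ (k u / 2)], which is even or odd and positive for [u > 0]: for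
   [k / 2] odd, [E_(k - 12)] vanishes at [i], and its q-series decreases in [y].  The derivatives at
   [1 / 2] are the moments of [p], zero or nonnegative by parity, and the moments of order 0 and 1
   decide the order of vanishing.  The Mellin formula is only needed for large real [s], where
   everything converges absolutely; it propagates along the real line by uniqueness of power
   series, once entire functions are known to have Taylor expansions (Goursat, Cauchy).

   For the modularity, differentiating the partial fractions of [1 / sinh ^ 2] gives Lipschitz's
   formula, which turns Eisenstein series into lattice sums; [y -> 1 / y] exchanges the two
   summations.  In weight two the exchange costs [pi / (2 y)], and this integrates to the
   transformation law of the discriminant. *)
Require Import Defs.
From Stdlib Require Import Reals List.
From Stdlib Require Import Arith Factorial Lra Lia Psatz ClassicalDescription.
From Coquelicot Require Import Coquelicot.
Import ListNotations.
Open Scope R_scope.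


(** Every transformation law is an identity between real series in [y > 0], comparing [y] with [/ y]
    only. The obstacle there is weight two: its lattice sum is not absolutely convergent, yet the
    discriminant depends on it. That sum is split into a telescoping part, summed explicitly in both
    orders, and an absolutely convergent rest. The constant term 1 of an Eisenstein series enters
    its law through zeta (2 j), while the definition uses Bernoulli numbers. Both are evaluated in
    the weights that occur, the zeta values by inverting the power series of sinh^2. The
    coefficients [tau] are complex, so their imaginary parts form a second series, whose sum
    vanishes on the axis; its Mellin transform shows that [L] is real for large real [s].
    Continuation takes a single disc centred at 6. Statements about [L] alone cannot pass through
    [Lam]: there [L] is multiplied by a Gamma integral convergent for [s > - (k - 1) / 2], a
    half-line containing 1/2. *)

(** * Real series: domination, interchange, termwise differentiation *)

Lemma ex_series_dom (a b : nat -> R) :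
  (forall n, Rabs (a n) <= b n) -> ex_series b -> ex_series a.
Proof.
  intros H Hb. apply (ex_series_le (V := R_CompleteNormedModule) a b); auto.
Qed.

Lemma ex_series_Rscal (c : R) (a : nat -> R) : ex_series a -> ex_series (fun n => c * a n).
Proof. exact (ex_series_scal_l (K := R_AbsRing) (V := R_NormedModule) c a). Qed.

Lemma is_series_Rscal (c : R) (a : nat -> R) (l : R) :
  is_series a l -> is_series (fun n => c * a n) (c * l).
Proof. exact (is_series_scal_l (K := R_AbsRing) (V := R_NormedModule) c a l). Qed.

Ltac smooth := apply (ex_derive_continuous (V := R_NormedModule)); auto_derive; auto.

Lemma ratio_bounds (x r : R) : 0 <= x < r -> 0 <= x / r < 1.
Proof.
  intros H. split; [apply Rmult_le_pos; [lra|left; apply Rinv_0_lt_compat; lra]|].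
  apply Rmult_lt_reg_r with r; [lra|]. unfold Rdiv. rewrite Rmult_assoc, Rinv_l; lra.
Qed.

Lemma ex_series_geom (q : R) : 0 <= q < 1 -> ex_series (fun n => q ^ n).
Proof. intros H. eexists. apply is_series_geom. rewrite Rabs_pos_eq; lra. Qed.

Lemma sqr_pow_m1 (j : nat) : (-1) ^ j * (-1) ^ j = 1.
Proof. rewrite <- Rpow_mult_distr. replace (-1 * -1) with 1 by ring. apply pow1. Qed.

Lemma Series_dom (a b : nat -> R) :
  (forall n, Rabs (a n) <= b n) -> ex_series b -> Rabs (Series a) <= Series b.
Proof.
  intros H Hb.
  assert (Ha : ex_series (fun n => Rabs (a n))).
  { apply (ex_series_dom _ b); auto. intros n. rewrite Rabs_Rabsolu. auto. }
  eapply Rle_trans. apply Series_Rabs; auto.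
  apply Series_le; auto. intros n; split; auto using Rabs_pos.
Qed.

Lemma Series_split (a : nat -> R) (N : nat) :
  ex_series a -> Series a = sum_n a N + Series (fun k => a (S N + k)%nat).
Proof.
  intros H. rewrite (Series_incr_n a (S N)); auto; try lia.
  simpl Init.Nat.pred. now rewrite sum_n_Reals.
Qed.

Lemma Series_tail (b : nat -> R) :
  ex_series b -> is_lim_seq (fun N => Series (fun k => b (S N + k)%nat)) 0.
Proof.
  intros H.
  apply is_lim_seq_ext with (fun N => Series b - sum_n b N).
  { intros N. rewrite (Series_split b N H). ring. }
  replace (Finite 0) with (Rbar_minus (Series b) (Series b)) by (simpl; f_equal; ring).
  apply is_lim_seq_minus'.
  - apply is_lim_seq_const.
  - apply (Series_correct b H).
Qed.

Lemma is_lim_seq_of_bound (x r : nat -> R) (l K : R) :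
  (forall n, Rabs (x n - l) <= K * r n) -> is_lim_seq r 0 -> is_lim_seq x l.
Proof.
  intros H Hr.
  assert (H0 : is_lim_seq (fun n => K * r n) 0).
  { replace (Finite 0) with (Rbar_mult K 0) by (simpl; f_equal; ring).
    now apply is_lim_seq_scal_l. }
  apply is_lim_seq_le_le with (fun n => l - K * r n) (fun n => l + K * r n).
  - intros n. specialize (H n). apply Rabs_le_between' in H. lra.
  - replace (Finite l) with (Finite (l - 0)) by (f_equal; ring).
    apply is_lim_seq_minus'; auto. apply is_lim_seq_const.
  - replace (Finite l) with (Finite (l + 0)) by (f_equal; ring).
    apply is_lim_seq_plus'; auto. apply is_lim_seq_const.
Qed.

Lemma Series_sum_n (a : nat -> nat -> R) (N : nat) :
  (forall n, ex_series (fun m => a m n)) ->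
  is_series (fun m => sum_n (a m) N) (sum_n (fun n => Series (fun m => a m n)) N).
Proof.
  intros H. induction N as [|N IH].
  - rewrite sum_O. apply is_series_ext with (fun m => a m 0%nat).
    { intros m. now rewrite sum_O. }
    apply Series_correct, H.
  - rewrite sum_Sn.
    apply is_series_ext with (fun m => plus (sum_n (a m) N) (a m (S N))).
    { intros m. now rewrite sum_Sn. }
    apply @is_series_plus; auto. apply Series_correct, H.
Qed.

Lemma ex_series_nonneg_scal (u v : nat -> R) (a : nat -> nat -> R) (m : nat) :
  (forall m n, Rabs (a m n) <= u m * v n) -> ex_series v -> ex_series (a m).
Proof.
  intros H Hv. apply (ex_series_dom _ (fun n => u m * v n)); auto.
  now apply @ex_series_scal_l.
Qed.

Section Swap.
Variables (a : nat -> nat -> R) (u v : nat -> R).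
Hypothesis Ha : forall m n, Rabs (a m n) <= u m * v n.
Hypothesis Hu : ex_series u.
Hypothesis Hv : ex_series v.

Lemma ex_series_row (m : nat) : ex_series (a m).
Proof. now apply (ex_series_nonneg_scal u v). Qed.

Lemma ex_series_col (n : nat) : ex_series (fun m => a m n).
Proof.
  apply (ex_series_nonneg_scal v u (fun n m => a m n)); auto.
  intros i j; rewrite Rmult_comm; auto.
Qed.

Lemma ex_series_rows : ex_series (fun m => Series (a m)).
Proof.
  apply (ex_series_dom _ (fun m => Series v * u m)).
  - intros m. rewrite Rmult_comm, <- Series_scal_l.
    apply Series_dom; auto. now apply @ex_series_scal_l.
  - now apply @ex_series_scal_l.
Qed.

(** The first [N] columns, summed row by row, miss in row [m] a tail bounded by [u m] times the tail
    of [v]; the error is thus at most [Series u] times that tail. Every absolutely convergent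
    interchange below is given such a product majorant. *)
Lemma is_series_swap :
  is_series (fun n => Series (fun m => a m n)) (Series (fun m => Series (a m))).
Proof.
  apply (is_lim_seq_of_bound _ (fun N => Series (fun k => v (S N + k)%nat)) _ (Series u)).
  2: now apply Series_tail.
  intros N.
  assert (Hs := Series_sum_n a N ex_series_col).
  apply Rle_trans with (Rabs (Series (fun m => sum_n (a m) N) - Series (fun m => Series (a m)))).
  { right. f_equal. f_equal. symmetry. exact (is_series_unique _ _ Hs). }
  rewrite <- Series_minus; [|eexists; exact Hs|apply ex_series_rows].
  assert (Hvt : ex_series (fun k => v (S N + k)%nat)) by now apply @ex_series_incr_n.
  rewrite (Rmult_comm (Series u)), <- Series_scal_l.
  apply Series_dom.
  - intros m. rewrite (Series_split (a m) N (ex_series_row m)).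
    match goal with |- Rabs ?x <= _ =>
      replace x with (- Series (fun k => a m (S N + k)%nat)) by ring end.
    rewrite Rabs_Ropp, (Rmult_comm _ (u m)), <- Series_scal_l.
    apply Series_dom; auto. now apply @ex_series_scal_l.
  - now apply @ex_series_scal_l.
Qed.

End Swap.

Lemma Series_swap (a : nat -> nat -> R) (u v : nat -> R) :
  (forall m n, Rabs (a m n) <= u m * v n) -> ex_series u -> ex_series v ->
  Series (fun m => Series (a m)) = Series (fun n => Series (fun m => a m n)).
Proof.
  intros Ha Hu Hv. symmetry. apply is_series_unique.
  now apply (is_series_swap a u v).
Qed.

(* Difference quotients are dominated by [M] through the mean value theorem, so
   the head of the series decides. *)
Lemma is_derive_Series (f f' : nat -> R -> R) (M : nat -> R) (c x : R) :
  c < x ->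
  (forall n y, c < y -> is_derive (f n) y (f' n y)) ->
  (forall n y, c < y -> Rabs (f' n y) <= M n) ->
  ex_series M ->
  (forall y, c < y -> ex_series (fun n => f n y)) ->
  is_derive (fun y => Series (fun n => f n y)) x (Series (fun n => f' n x)).
Proof.
  intros Hx Hd HM HeM Hf.
  assert (Hf' : forall y, c < y -> ex_series (fun n => f' n y)).
  { intros y Hy. apply (ex_series_dom _ M); auto. }
  apply is_derive_Reals. intros eps Heps.
  assert (Ht := Series_tail M HeM). apply is_lim_seq_spec in Ht.
  assert (He4 : 0 < eps / 4) by lra.
  destruct (Ht (mkposreal _ He4)) as [N HN]. specialize (HN N (le_n _)). simpl in HN.
  rewrite Rminus_0_r in HN. apply Rabs_def2 in HN. destruct HN as [HN _].
  assert (Hh : is_derive (fun y => sum_n (fun n => f n y) N) x (sum_n (fun n => f' n x) N)).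
  { apply (is_derive_sum_n (fun n => f n) N x (fun n => f' n x)). intros k _. now apply Hd. }
  apply is_derive_Reals in Hh.
  destruct (Hh (eps / 4) He4) as [d Hdd].
  assert (Hd0 : 0 < Rmin d (x - c)) by (apply Rmin_pos; [apply cond_pos|lra]).
  exists (mkposreal _ Hd0). intros h Hh0 Hhd. simpl in Hhd.
  assert (Hhd1 : Rabs h < d) by (eapply Rlt_le_trans; [apply Hhd|apply Rmin_l]).
  assert (Hhd2 : Rabs h < x - c) by (eapply Rlt_le_trans; [apply Hhd|apply Rmin_r]).
  apply Rabs_def2 in Hhd2.
  assert (Hxh : c < x + h) by lra.
  specialize (Hdd h Hh0 Hhd1).
  rewrite (Series_split _ N (Hf _ Hxh)), (Series_split _ N (Hf _ Hx)), (Series_split _ N (Hf' _ Hx)).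
  assert (HMt : ex_series (fun k => M (S N + k)%nat)) by now apply @ex_series_incr_n.
  assert (T1 : Rabs (Series (fun k => f' (S N + k)%nat x)) < eps / 4).
  { eapply Rle_lt_trans; [apply Series_dom; [|exact HMt]|exact HN]. intros n; now apply HM. }
  assert (T2 : Rabs ((Series (fun k => f (S N + k)%nat (x + h)) - Series (fun k => f (S N + k)%nat x)) / h)
               < eps / 4).
  { rewrite <- Series_minus.
    2: exact (proj1 (ex_series_incr_n (fun n => f n (x + h)) (S N)) (Hf _ Hxh)).
    2: exact (proj1 (ex_series_incr_n (fun n => f n x) (S N)) (Hf _ Hx)).
    unfold Rdiv. rewrite Rmult_comm, <- Series_scal_l.
    eapply Rle_lt_trans; [apply Series_dom; [|exact HMt]|exact HN].
    intros n. set (k := (S N + n)%nat).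
    destruct (MVT_gen (f k) x (x + h) (f' k)) as [y [Hy Hy2]].
    - intros y Hy. apply Hd. unfold Rmin in Hy. destruct (Rle_dec x (x + h)); lra.
    - intros y Hy. apply continuity_pt_filterlim.
      apply (ex_derive_continuous (f k)). exists (f' k y). apply Hd.
      unfold Rmin in Hy. destruct (Rle_dec x (x + h)); lra.
    - rewrite Hy2. replace (/ h * (f' k y * (x + h - x))) with (f' k y) by (field; auto).
      apply HM. unfold Rmin in Hy. destruct (Rle_dec x (x + h)); lra. }
  match goal with |- Rabs ?X < _ => replace X with
   (((sum_n (fun n => f n (x + h)) N - sum_n (fun n => f n x) N) / h - sum_n (fun n => f' n x) N)
    + (Series (fun k => f (S N + k)%nat (x + h)) - Series (fun k => f (S N + k)%nat x)) / h
    - Series (fun k => f' (S N + k)%nat x)) by (field; auto) end.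
  apply Rabs_def2 in T1. apply Rabs_def2 in T2. apply Rabs_def2 in Hdd.
  apply Rabs_def1; lra.
Qed.

Lemma Series_nonneg (a : nat -> R) : ex_series a -> (forall n, 0 <= a n) -> 0 <= Series a.
Proof.
  intros H Hp. replace 0 with (Series (fun _ : nat => 0)).
  - apply Series_le; auto. intros n; split; [lra|auto].
  - apply is_series_unique. change (is_lim_seq (sum_n (fun _ => 0)) 0).
    apply is_lim_seq_ext with (fun _ => 0).
    + intros n. rewrite sum_n_const. ring.
    + apply is_lim_seq_const.
Qed.

Lemma Series_head (a : nat -> R) : ex_series a -> Series a = a 0%nat + Series (fun n => a (S n)).
Proof.
  intros H. rewrite (Series_split a 0 H), sum_O. reflexivity.
Qed.

Lemma Series_pos (a : nat -> R) :
  ex_series a -> (forall n, 0 <= a n) -> 0 < a 0%nat -> 0 < Series a.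
Proof.
  intros H Hp H0. rewrite (Series_head a H).
  assert (0 <= Series (fun n => a (S n))); [|lra].
  apply Series_nonneg; auto. now apply -> (ex_series_incr_1 a).
Qed.

Lemma is_lim_seq_telescope (u : nat -> R) (l : R) :
  is_lim_seq u l -> is_series (fun n => u n - u (S n)) (u 0%nat - l).
Proof.
  intros H. change (is_lim_seq (sum_n (fun n => u n - u (S n))) (u 0%nat - l)).
  apply is_lim_seq_ext with (fun n => u 0%nat - u (S n)).
  - intros n. induction n as [|n IH].
    + now rewrite sum_O.
    + rewrite sum_Sn, <- IH. unfold plus; simpl. ring.
  - apply is_lim_seq_minus'; [apply is_lim_seq_const|].
    now apply -> (is_lim_seq_incr_1 u).
Qed.

Lemma is_lim_seq_inv_INR_S : is_lim_seq (fun n => / INR (S n)) 0.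
Proof.
  apply (is_lim_seq_inv (fun n => INR (S n)) p_infty).
  - apply -> (is_lim_seq_incr_1 INR). apply is_lim_seq_INR.
  - discriminate.
Qed.

Lemma ex_series_inv_sqr : ex_series (fun n => / INR (S n) ^ 2).
Proof.
  apply (ex_series_dom _ (fun n => 2 * (/ INR (S n) - / INR (S (S n))))).
  - intros n. assert (0 < INR (S n)) by (apply lt_0_INR; lia).
    rewrite (S_INR (S n)). set (x := INR (S n)) in *.
    assert (1 <= x) by (unfold x; rewrite S_INR; pose proof (pos_INR n); lra).
    rewrite Rabs_pos_eq by (left; apply Rinv_0_lt_compat; nra).
    replace (2 * (/ x - / (x + 1))) with (2 / (x * (x + 1))) by (field; lra).
    apply Rmult_le_reg_r with (x ^ 2 * (x + 1)); [nra|].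
    replace (/ x ^ 2 * (x ^ 2 * (x + 1))) with (x + 1) by (field; lra).
    replace (2 / (x * (x + 1)) * (x ^ 2 * (x + 1))) with (2 * x) by (field; lra). lra.
  - apply (ex_series_scal_l (K := R_AbsRing) 2 (fun n => / INR (S n) - / INR (S (S n)))). eexists.
    apply (is_lim_seq_telescope (fun n => / INR (S n)) 0 is_lim_seq_inv_INR_S).
Qed.

(** * Partial fractions of [1 / sinh ^ 2] *)

(* The real part of [1 / sin (u + i v) ^ 2]. *)
Definition csc2 (u v : R) : R :=
  2 * (1 - cos (2 * u) * cosh (2 * v)) / (cosh (2 * v) - cos (2 * u)) ^ 2.

(* The real part of [1 / (u + i v) ^ 2]. *)
Definition re_inv2 (u v : R) : R := (u ^ 2 - v ^ 2) / (u ^ 2 + v ^ 2) ^ 2.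

Lemma cosh_double (v : R) : cosh (2 * v) = 2 * cosh v ^ 2 - 1.
Proof.
  unfold cosh. replace (2 * v) with (v + v) by ring.
  replace (- (v + v)) with (- v + - v) by ring. rewrite !exp_plus.
  assert (H : exp v * exp (- v) = 1) by (rewrite <- exp_plus, Rplus_opp_r; apply exp_0).
  nra.
Qed.

Lemma cosh_sinh_sqr (v : R) : cosh (2 * v) - 1 = 2 * sinh v ^ 2.
Proof.
  rewrite cosh_double. unfold cosh, sinh.
  assert (H : exp v * exp (- v) = 1) by (rewrite <- exp_plus, Rplus_opp_r; apply exp_0).
  nra.
Qed.

Lemma cosh_ge_1 (v : R) : 1 <= cosh v.
Proof.
  unfold cosh. assert (H1 := exp_pos v). assert (H2 : exp v * exp (- v) = 1)
    by (rewrite <- exp_plus, Rplus_opp_r; apply exp_0).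
  assert (H3 := exp_pos (- v)).
  assert (0 <= (exp v - exp (- v)) ^ 2) by apply pow2_ge_0.
  apply Rnot_lt_le. intros H4. nra.
Qed.

Lemma sinh_ge (v : R) : 0 <= v -> v <= sinh v.
Proof.
  intros Hv. destruct (Req_dec v 0) as [->|Hn]; [rewrite sinh_0; lra|].
  assert (H := exp_ineq1 v Hn).
  destruct (MVT_gen sinh 0 v cosh) as [c [_ Hc]].
  - intros x _. apply is_derive_Reals, derivable_pt_lim_sinh.
  - intros x _. apply derivable_continuous_pt. exists (cosh x). apply derivable_pt_lim_sinh.
  - rewrite sinh_0, !Rminus_0_r in Hc. rewrite Hc.
    assert (Hc1 := cosh_ge_1 c). nra.
Qed.

Lemma cosh_gt_1 (v : R) : 0 < v -> 1 < cosh v.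
Proof.
  intros Hv. replace v with (2 * (v / 2)) by field.
  assert (H := cosh_sinh_sqr (v / 2)). assert (H2 := sinh_ge (v / 2)). nra.
Qed.

(** From [sin w = 2 sin (w / 2) sin (w / 2 + PI / 2)] and [sin ^ 2 + cos ^ 2 = 1], one gets csc^2 w
    as a quarter of the sum of csc^2 at the two half arguments. Iteration of this relation produces
    the partial fractions. *)
Lemma csc2_double (u v : R) : 0 < v ->
  csc2 u v = / 4 * (csc2 (u / 2) (v / 2) + csc2 (u / 2 + PI / 2) (v / 2)).
Proof.
  intros Hv. unfold csc2.
  rewrite cosh_double, cos_2a_cos.
  replace (2 * (u / 2)) with u by field. replace (2 * (v / 2)) with v by field.
  replace (2 * (u / 2 + PI / 2)) with (u + PI) by field. rewrite neg_cos.
  assert (Hh := cosh_gt_1 v Hv). destruct (COS_bound u) as [C1 C2].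
  set (c := cos u) in *. set (h := cosh v) in *.
  field. repeat split; nra.
Qed.

Fixpoint psum (f : nat -> R) (n : nat) : R :=
  match n with O => 0 | S m => psum f m + f m end.

Lemma psum_add (f : nat -> R) (n m : nat) :
  psum f (n + m) = psum f n + psum (fun k => f (n + k)%nat) m.
Proof.
  induction m as [|m IH]; [rewrite Nat.add_0_r; simpl; ring|].
  rewrite Nat.add_succ_r; simpl. rewrite IH. ring.
Qed.

Lemma psum_ext (f g : nat -> R) (n : nat) :
  (forall k, (k < n)%nat -> f k = g k) -> psum f n = psum g n.
Proof.
  intros H. induction n as [|n IH]; [reflexivity|]. simpl.
  rewrite IH by (intros; apply H; lia). rewrite H by lia. reflexivity.
Qed.

Lemma psum_plus (f g : nat -> R) (n : nat) :
  psum (fun k => f k + g k) n = psum f n + psum g n.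
Proof. induction n as [|n IH]; simpl; [ring|rewrite IH; ring]. Qed.

Lemma psum_scal (c : R) (f : nat -> R) (n : nat) :
  psum (fun k => c * f k) n = c * psum f n.
Proof. induction n as [|n IH]; simpl; [ring|rewrite IH; ring]. Qed.

Lemma psum_S_l (f : nat -> R) (n : nat) :
  psum f (S n) = f 0%nat + psum (fun k => f (S k)) n.
Proof. replace (S n) with (1 + n)%nat by lia. rewrite psum_add. simpl. ring. Qed.

Lemma psum_rev (f : nat -> R) (n : nat) :
  psum (fun k => f (n - k)%nat) n = psum (fun k => f (S k)) n.
Proof.
  induction n as [|n IH]; [reflexivity|].
  rewrite psum_S_l. rewrite (psum_ext _ (fun k => f (n - k)%nat)) by (intros; f_equal; lia).
  rewrite IH. simpl. ring.
Qed.

Lemma psum_dist (f g : nat -> R) (K : R) (n : nat) :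
  (forall k, (k < n)%nat -> Rabs (f k - g k) <= K) ->
  Rabs (psum f n - psum g n) <= INR n * K.
Proof.
  intros H. induction n as [|n IH].
  - simpl. rewrite Rminus_0_r, Rabs_R0. lra.
  - rewrite S_INR. simpl psum.
    replace (psum f n + f n - (psum g n + g n)) with ((psum f n - psum g n) + (f n - g n)) by ring.
    eapply Rle_trans; [apply Rabs_triang|].
    assert (H1 := IH ltac:(intros; apply H; lia)). assert (H2 := H n ltac:(lia)). lra.
Qed.

Lemma psum_sum_n (f : nat -> R) (n : nat) : psum f (S n) = sum_n f n.
Proof.
  induction n as [|n IH]; [rewrite sum_O; simpl; ring|].
  rewrite sum_Sn, <- IH. reflexivity.
Qed.

Lemma INR_pow2 (N : nat) : INR (2 ^ N) = 2 ^ N.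
Proof. rewrite pow_INR. reflexivity. Qed.

Lemma csc2_iter (v : R) (N : nat) : 0 < v ->
  csc2 0 v = (/ 4) ^ N * psum (fun k => csc2 (INR k * PI / 2 ^ N) (v / 2 ^ N)) (2 ^ N).
Proof.
  intros Hv. induction N as [|N IH].
  - simpl. replace (0 * PI / 1) with 0 by field. replace (v / 1) with v by field. ring.
  (* Term [k] of level [N] gives the terms [k] and [2 ^ N + k] of level [S N], whose arguments
     differ by [PI / 2]. *)
  - rewrite IH. replace (2 ^ S N)%nat with (2 ^ N + 2 ^ N)%nat by (simpl; lia).
    assert (H2 : 0 < 2 ^ N) by (apply pow_lt; lra).
    rewrite psum_add, <- psum_plus.
    replace ((/ 4) ^ S N) with ((/ 4) ^ N * / 4) by (simpl; ring). rewrite Rmult_assoc.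
    f_equal. rewrite <- psum_scal. apply psum_ext. intros k _.
    rewrite csc2_double by (apply Rdiv_lt_0_compat; lra).
    f_equal. rewrite plus_INR, INR_pow2. rewrite <- !tech_pow_Rmult.
    apply (f_equal2 Rplus); apply (f_equal2 csc2); field; lra.
Qed.

(** Meant for [a = 2 sin^2 u], [b = 2 sinh^2 v], [al = 2 u^2], [be = 2 v^2], where the two quotients
    are half of [csc2] and of [re_inv2]. Both grow like the inverse of [r = al + be] near the
    origin, but numerators and denominators agree up to [r ^ 2], so the difference stays bounded.
    The constant is 54 + 270 + 1, from the bounds [B1], [B2] and [B3]. *)
Lemma inv2_perturbation (a b al be : R) :
  0 <= al <= 8 -> 0 < be <= 2 ->
  al / 6 <= a <= al -> al - a <= al ^ 2 / 6 ->
  be <= b -> b - be <= 3 / 2 * be ^ 2 ->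
  Rabs ((a - b + a * b) / (a + b) ^ 2 - (al - be) / (al + be) ^ 2) <= 325.
Proof.
  intros Hal Hbe [Ha1 Ha2] Ha3 Hb1 Hb2.
  set (A := a + b). set (r := al + be).
  assert (Hr : 0 < r) by (unfold r; lra).
  assert (HA1 : r <= 6 * A) by (unfold A, r; lra).
  assert (HA2 : A <= 4 * r) by (unfold A, r; nra).
  assert (HA : 0 < A) by lra.
  assert (H1 : Rabs ((a - b) - (al - be)) <= 3 / 2 * r ^ 2)
    by (apply Rabs_le; unfold r; nra).
  assert (H2 : Rabs (r - A) <= 3 / 2 * r ^ 2) by (apply Rabs_le; unfold r, A; nra).
  assert (H3 : Rabs (al - be) <= r) by (apply Rabs_le; unfold r; lra).
  replace ((a - b + a * b) / A ^ 2 - (al - be) / r ^ 2) with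
    (((a - b) - (al - be)) / A ^ 2 + (al - be) * (r - A) * (r + A) / (r ^ 2 * A ^ 2)
     + a * b / A ^ 2) by (field; lra).
  assert (HAA : r ^ 2 <= 36 * A ^ 2) by nra.
  assert (B1 : Rabs (((a - b) - (al - be)) / A ^ 2) <= 54).
  { unfold Rdiv. rewrite Rabs_mult, (Rabs_pos_eq (/ A ^ 2))
      by (left; apply Rinv_0_lt_compat; nra).
    apply Rmult_le_reg_r with (A ^ 2); [nra|].
    rewrite Rmult_assoc, Rinv_l by nra. nra. }
  assert (B2 : Rabs ((al - be) * (r - A) * (r + A) / (r ^ 2 * A ^ 2)) <= 270).
  { unfold Rdiv. rewrite Rabs_mult, (Rabs_pos_eq (/ _))
      by (left; apply Rinv_0_lt_compat; assert (0 < r ^ 2) by nra; nra).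
    rewrite !Rabs_mult, (Rabs_pos_eq (r + A)) by lra.
    assert (Hp : 0 < r ^ 2 * A ^ 2) by (assert (0 < r ^ 2) by nra; nra).
    apply Rmult_le_reg_r with (r ^ 2 * A ^ 2); [exact Hp|].
    rewrite Rmult_assoc, Rinv_l by lra. rewrite Rmult_1_r.
    assert (P1 : Rabs (al - be) * Rabs (r - A) <= r * (3 / 2 * r ^ 2))
      by (apply Rmult_le_compat; auto using Rabs_pos).
    assert (0 <= Rabs (al - be) * Rabs (r - A))
      by (apply Rmult_le_pos; apply Rabs_pos).
    apply Rle_trans with (r * (3 / 2 * r ^ 2) * (5 * r)).
    - apply Rmult_le_compat; lra.
    - replace (r * (3 / 2 * r ^ 2) * (5 * r)) with (r ^ 2 * (15 / 2 * r ^ 2)) by field.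
      replace (270 * (r ^ 2 * A ^ 2)) with (r ^ 2 * (15 / 2 * (36 * A ^ 2))) by field.
      apply Rmult_le_compat_l; nra. }
  assert (B3 : Rabs (a * b / A ^ 2) <= 1).
  { assert (0 <= a * b) by nra.
    rewrite Rabs_pos_eq by (apply Rmult_le_pos; [lra|left; apply Rinv_0_lt_compat; nra]).
    apply Rmult_le_reg_r with (A ^ 2); [nra|].
    unfold Rdiv. rewrite Rmult_assoc, Rinv_l by nra. unfold A; nra. }
  eapply Rle_trans; [apply Rabs_triang|].
  eapply Rle_trans; [apply Rplus_le_compat_r, Rabs_triang|]. lra.
Qed.

(** The slope 5/12 is enough for the ratio 1/6 in [inv2_perturbation], as (5/12)^2 > 1/6. For
    [u > 1] it follows from [sin 1 >= 5/6] and [u <= 2]. *)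
Lemma sin_ge_linear (u : R) : 0 <= u <= PI / 2 -> 5 / 12 * u <= sin u /\ u - u ^ 3 / 6 <= sin u <= u.
Proof.
  intros Hu. assert (HPI := PI_4).
  assert (HL : forall x, 0 <= x <= 2 -> x - x ^ 3 / 6 <= sin x).
  { intros x Hx. destruct (pre_sin_bound x 0) as [H _]; try lra.
    unfold sin_approx, sin_term in H. simpl in H. lra. }
  assert (HU : sin u <= u).
  { destruct (Req_dec u 0) as [->|]; [rewrite sin_0; lra|]. left. apply sin_lt_x. lra. }
  assert (Hu2 := HL u ltac:(lra)).
  split; [|split; auto].
  destruct (Rle_dec u 1) as [Hu1|Hu1]; [nra|].
  assert (H1 := HL 1 ltac:(lra)).
  assert (sin 1 <= sin u); [|lra].
  apply sin_incr_1; lra.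
Qed.

(** A chain of monotonicity arguments: [x cosh x - sinh x] has derivative [x sinh x], so
    [sinh x <= x cosh x]; with [cosh x <= 2] on the unit interval this makes [1 + x ^ 2 - cosh x]
    nondecreasing. *)
Lemma sinh_le_cubic (v : R) : 0 <= v <= 1 -> sinh v <= v * (1 + v ^ 2).
Proof.
  intros Hv.
  assert (Hmon : forall (g g' : R -> R), (forall x, is_derive g x (g' x)) ->
     g 0 = 0 -> (forall x, 0 <= x <= 1 -> 0 <= g' x) -> forall x, 0 <= x <= 1 -> 0 <= g x).
  { intros g g' Hd H0 Hp x Hx.
    destruct (MVT_gen g 0 x g') as [c [Hc E]].
    - intros; apply Hd.
    - intros y _. apply continuity_pt_filterlim. apply (ex_derive_continuous g). eexists; apply Hd.
    - rewrite Rmin_left, Rmax_right in Hc by lra. rewrite H0, !Rminus_0_r in E. rewrite E.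
      apply Rmult_le_pos; [apply Hp; lra|lra]. }
  assert (Hsh : forall x, is_derive sinh x (cosh x))
    by (intros; apply is_derive_Reals, derivable_pt_lim_sinh).
  assert (Hch : forall x, is_derive cosh x (sinh x))
    by (intros; apply is_derive_Reals, derivable_pt_lim_cosh).
  assert (S0 : forall x, 0 <= x -> 0 <= sinh x) by (intros x Hx; assert (H := sinh_ge x Hx); lra).
  assert (S1 : forall x, 0 <= x <= 1 -> sinh x <= x * cosh x).
  { intros x Hx. apply Rminus_le_0.
    apply (Hmon (fun x => x * cosh x - sinh x) (fun x => x * sinh x)); auto.
    - intros y. replace (y * sinh y) with ((1 * cosh y + y * sinh y) - cosh y) by ring.
      apply @is_derive_minus; auto.
      apply (is_derive_mult (fun x => x) cosh); auto using is_derive_id.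
      intros; apply Rmult_comm.
    - rewrite sinh_0. ring.
    - intros y Hy. apply Rmult_le_pos; [lra|apply S0; lra]. }
  assert (C2 : forall x, 0 <= x <= 1 -> cosh x <= 2).
  { intros x Hx. unfold cosh. assert (H := exp_le_3).
    assert (exp x <= exp 1) by (destruct (proj2 Hx) as [h| ->]; [left; apply exp_increasing; lra|lra]).
    assert (exp (- x) <= exp 0) by (destruct (proj1 Hx) as [h|<-]; [left; apply exp_increasing; lra|rewrite Ropp_0; lra]).
    rewrite exp_0 in *. lra. }
  assert (C3 : forall x, 0 <= x <= 1 -> cosh x <= 1 + x ^ 2).
  { intros x Hx. apply Rminus_le_0.
    apply (Hmon (fun x => 1 + x ^ 2 - cosh x) (fun x => 2 * x - sinh x)); auto.
    - intros y. apply @is_derive_minus; auto. auto_derive; auto; ring.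
    - rewrite cosh_0. ring.
    - intros y Hy. assert (H := S1 y Hy). assert (H2 := C2 y Hy). nra. }
  assert (H1 := S1 v Hv). assert (H2 := C3 v Hv). nra.
Qed.

Lemma csc2_half_bound (u v : R) : 0 <= u <= PI / 2 -> 0 < v <= 1 ->
  Rabs (csc2 u v - re_inv2 u v) <= 650.
Proof.
  intros Hu Hv. destruct (sin_ge_linear u Hu) as [Hs1 [Hs2 Hs3]].
  assert (HPI := PI_4).
  assert (Hh1 := sinh_ge v ltac:(lra)). assert (Hh2 := sinh_le_cubic v ltac:(lra)).
  assert (Eh := cosh_sinh_sqr v).
  assert (Ec : cos (2 * u) = 1 - 2 * sin u ^ 2) by (rewrite cos_2a_sin; ring).
  set (s := sin u) in *. set (t := sinh v) in *.
  assert (H := inv2_perturbation (2 * s ^ 2) (2 * t ^ 2) (2 * u ^ 2) (2 * v ^ 2)).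
  replace (csc2 u v - re_inv2 u v) with
   (2 * ((2 * s ^ 2 - 2 * t ^ 2 + 2 * s ^ 2 * (2 * t ^ 2)) / (2 * s ^ 2 + 2 * t ^ 2) ^ 2
     - (2 * u ^ 2 - 2 * v ^ 2) / (2 * u ^ 2 + 2 * v ^ 2) ^ 2)).
  - rewrite Rabs_mult, (Rabs_pos_eq 2) by lra.
    enough (Rabs ((2 * s ^ 2 - 2 * t ^ 2 + 2 * s ^ 2 * (2 * t ^ 2)) / (2 * s ^ 2 + 2 * t ^ 2) ^ 2
     - (2 * u ^ 2 - 2 * v ^ 2) / (2 * u ^ 2 + 2 * v ^ 2) ^ 2) <= 325) by lra.
    assert (0 <= s) by lra.
    apply H; try nra.
    assert (0 <= v ^ 3) by (apply pow_le; lra).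
      replace (2 * t ^ 2 - 2 * v ^ 2) with (2 * ((t - v) * (t + v))) by ring.
      assert (t <= 2 * v) by nra.
      assert (t - v <= v ^ 3) by (replace (v ^ 3) with (v * (1 + v ^ 2) - v) by ring; lra).
      assert ((t - v) * (t + v) <= v ^ 3 * (3 * v)) by (apply Rmult_le_compat; lra).
      replace (3 / 2 * (2 * v ^ 2) ^ 2) with (2 * (v ^ 3 * (3 * v))) by field. lra.
  - unfold csc2, re_inv2. rewrite Ec. replace (cosh (2 * v)) with (1 + 2 * t ^ 2) by lra.
    field. split; nra.
Qed.

Lemma re_inv2_bound (u v : R) : 1 <= u -> Rabs (re_inv2 u v) <= / u ^ 2.
Proof.
  intros Hu. unfold re_inv2, Rdiv.
  assert (0 < u ^ 2) by nra. assert (0 <= v ^ 2) by nra.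
  assert (Hd : 0 < (u ^ 2 + v ^ 2) ^ 2) by nra.
  rewrite Rabs_mult, (Rabs_pos_eq (/ _)) by (left; now apply Rinv_0_lt_compat).
  apply Rmult_le_reg_r with (u ^ 2 * (u ^ 2 + v ^ 2) ^ 2); [nra|].
  replace (/ u ^ 2 * (u ^ 2 * (u ^ 2 + v ^ 2) ^ 2)) with ((u ^ 2 + v ^ 2) ^ 2) by (field; lra).
  replace (Rabs (u ^ 2 - v ^ 2) * / (u ^ 2 + v ^ 2) ^ 2 * (u ^ 2 * (u ^ 2 + v ^ 2) ^ 2))
    with (Rabs (u ^ 2 - v ^ 2) * u ^ 2) by (field; nra).
  assert (Rabs (u ^ 2 - v ^ 2) <= u ^ 2 + v ^ 2) by (apply Rabs_le; lra).
  nra.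
Qed.

(** Both ends of the interval are poles of csc^2, hence the two subtracted terms. On each half the
    far pole is at distance at least 1 and contributes at most 1, whence 651 = 650 + 1; the symmetry
    [u -> PI - u] exchanges the halves. *)
Lemma csc2_bound (u v : R) : 0 <= u <= PI -> 0 < v <= 1 ->
  Rabs (csc2 u v - (re_inv2 u v + re_inv2 (PI - u) v)) <= 651.
Proof.
  assert (HPI := PI2_3_2).
  assert (HB : forall u, 1 <= u -> Rabs (re_inv2 u v) <= 1).
  { intros w Hw. eapply Rle_trans; [now apply re_inv2_bound|].
    rewrite <- Rinv_1. apply Rinv_le_contravar; nra. }
  assert (HH : forall u, 0 <= u <= PI / 2 -> 0 < v <= 1 ->
    Rabs (csc2 u v - (re_inv2 u v + re_inv2 (PI - u) v)) <= 651).
  { intros w Hw Hv. assert (H1 := csc2_half_bound w v Hw Hv). assert (H2 := HB (PI - w) ltac:(lra)).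
    apply Rabs_le_between in H1. apply Rabs_le_between in H2. apply Rabs_le. lra. }
  intros Hu Hv. destruct (Rle_dec u (PI / 2)); [apply HH; lra|].
  replace (csc2 u v) with (csc2 (PI - u) v).
  - assert (H := HH (PI - u) ltac:(lra) Hv). replace (PI - (PI - u)) with u in H by ring.
    rewrite (Rplus_comm (re_inv2 u v)). exact H.
  - unfold csc2. replace (2 * (PI - u)) with (- (2 * u) + 2 * INR 1 * PI) by (simpl; ring).
    now rewrite cos_period, cos_neg.
Qed.

Lemma re_inv2_scale (u v s : R) : 0 < s -> 0 < v -> re_inv2 (u / s) (v / s) = s ^ 2 * re_inv2 u v.
Proof. intros Hs Hv. unfold re_inv2. field. split; nra. Qed.

Lemma ex_series_re_inv2 (x : R) : ex_series (fun m => re_inv2 (INR (S m)) x).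
Proof.
  apply (ex_series_dom _ (fun n => / INR (S n) ^ 2)); [|apply ex_series_inv_sqr].
  intros n. apply re_inv2_bound. rewrite S_INR. pose proof (pos_INR n). lra.
Qed.

(** In [csc2_iter], replacing each of the [2 ^ N] terms by its two pole parts costs a bounded error
    per term, which the factor [(/ 4) ^ N] turns into a multiple of [(/ 2) ^ N]. The pole parts
    rescale to terms of the lattice sum. *)
Lemma csc2_series (x : R) : 0 < x ->
  PI ^ 2 * csc2 0 (PI * x) = - / x ^ 2 + 2 * Series (fun m => re_inv2 (INR (S m)) x).
Proof.
  intros Hx. assert (HPI := PI_RGT_0).
  (* The [k]-th term is close to the lattice points [k] and [k - 2 ^ N]. The latter is folded to
     [2 ^ N - k] by evenness, so the indices run over 0 to M - 1 and over 1 to M. *)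
  set (X := fun M => psum (fun k => re_inv2 (INR k) x) M + psum (fun k => re_inv2 (INR (S k)) x) M).
  assert (HS : is_lim_seq (fun n => psum (fun k => re_inv2 (INR (S k)) x) n)
                 (Series (fun m => re_inv2 (INR (S m)) x))).
  { apply is_lim_seq_incr_1.
    apply is_lim_seq_ext with (sum_n (fun k => re_inv2 (INR (S k)) x)).
    - intros n. now rewrite psum_sum_n.
    - apply (Series_correct _ (ex_series_re_inv2 x)). }
  assert (HX : is_lim_seq X (- / x ^ 2 + 2 * Series (fun m => re_inv2 (INR (S m)) x))).
  { replace (- / x ^ 2 + 2 * Series (fun m => re_inv2 (INR (S m)) x))
     with ((- / x ^ 2 + Series (fun m => re_inv2 (INR (S m)) x)) + Series (fun m => re_inv2 (INR (S m)) x))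
      by ring.
    apply is_lim_seq_plus'; auto.
    apply is_lim_seq_incr_1.
    apply is_lim_seq_ext with (fun n => - / x ^ 2 + psum (fun k => re_inv2 (INR (S k)) x) n).
    - intros n. rewrite psum_S_l. f_equal. unfold re_inv2. simpl (INR 0). field. lra.
    - apply is_lim_seq_plus'; auto. apply is_lim_seq_const. }
  assert (HX2 : is_lim_seq (fun N => X (2 ^ N)%nat) (- / x ^ 2 + 2 * Series (fun m => re_inv2 (INR (S m)) x))).
  { apply (is_lim_seq_subseq X _ (fun N => (2 ^ N)%nat)); auto.
    apply eventually_subseq. intros n. simpl. assert (2 ^ n <> 0)%nat by (apply Nat.pow_nonzero; lia). lia. }
  assert (HY : is_lim_seq (fun N => X (2 ^ N)%nat) (PI ^ 2 * csc2 0 (PI * x))).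
  (* From level [S n0] on, [2 ^ N >= PI * x], and the height [PI * x / 2 ^ N] is at most 1 as
     [csc2_bound] requires. *)
  { destruct (nfloor_ex (PI * x)) as [n0 Hn0]; [nra|].
    apply is_lim_seq_incr_n with (S n0).
    apply (is_lim_seq_of_bound _ (fun N => (/ 2) ^ (N + S n0)) _ (PI ^ 2 * 651)).
    2:{ apply (is_lim_seq_incr_n (fun N => (/ 2) ^ N)). apply is_lim_seq_geom. rewrite Rabs_pos_eq; lra. }
    intros N'. set (N := (N' + S n0)%nat).
    assert (H2N : 0 < 2 ^ N) by (apply pow_lt; lra).
    assert (Hv : 0 < PI * x / 2 ^ N <= 1).
    { split; [apply Rdiv_lt_0_compat; nra|]. apply Rmult_le_reg_r with (2 ^ N); auto.
      unfold Rdiv; rewrite Rmult_assoc, Rinv_l by lra.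
      assert (INR n0 + 1 <= 2 ^ N); [|lra].
      rewrite <- S_INR. apply Rle_trans with (INR (2 ^ N)).
      - apply le_INR. unfold N. pose proof (Nat.pow_gt_lin_r 2 (N' + S n0)). lia.
      - rewrite INR_pow2. lra. }
    rewrite (csc2_iter (PI * x) N) by nra.
    set (f := fun k => csc2 (INR k * PI / 2 ^ N) (PI * x / 2 ^ N)).
    set (g := fun k => re_inv2 (INR k * PI / 2 ^ N) (PI * x / 2 ^ N)
                     + re_inv2 (PI - INR k * PI / 2 ^ N) (PI * x / 2 ^ N)).
    assert (EX : X (2 ^ N)%nat = PI ^ 2 * ((/ 4) ^ N * psum g (2 ^ N))).
    { unfold X, g. rewrite <- (psum_rev (fun k => re_inv2 (INR k) x)), <- psum_plus, <- !psum_scal.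
      apply psum_ext. intros k Hk.
      replace (PI - INR k * PI / 2 ^ N) with (INR (2 ^ N - k) / (2 ^ N / PI)).
      2:{ rewrite minus_INR by lia. rewrite INR_pow2. field. lra. }
      replace (INR k * PI / 2 ^ N) with (INR k / (2 ^ N / PI)) by (field; lra).
      replace (PI * x / 2 ^ N) with (x / (2 ^ N / PI)) by (field; lra).
      rewrite !re_inv2_scale; auto. 2, 3: apply Rdiv_lt_0_compat; lra.
      replace ((/ 4) ^ N) with (/ (2 ^ N) ^ 2).
      2:{ rewrite <- pow_mult, Nat.mul_comm, pow_mult, pow_inv. do 2 f_equal. ring. }
      field. lra. }
    rewrite EX. rewrite <- Rmult_minus_distr_l, <- Rmult_minus_distr_l.
    rewrite !Rabs_mult, (Rabs_pos_eq (PI ^ 2)), (Rabs_pos_eq ((/ 4) ^ N)) by (try apply pow_le; lra).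
    rewrite Rmult_assoc. apply Rmult_le_compat_l; [nra|].
    rewrite Rabs_minus_sym.
    replace (651 * (/ 2) ^ N) with ((/ 4) ^ N * (INR (2 ^ N) * 651)).
    - apply Rmult_le_compat_l; [apply pow_le; lra|]. apply psum_dist. intros k Hk. apply csc2_bound; auto.
      assert (Hk2 : INR k <= 2 ^ N).
      { apply Rle_trans with (INR (2 ^ N)); [apply le_INR; lia|]. rewrite INR_pow2. lra. }
      pose proof (pos_INR k). split.
      + apply Rmult_le_pos; [nra|left; now apply Rinv_0_lt_compat].
      + apply Rmult_le_reg_r with (2 ^ N); auto. unfold Rdiv; rewrite Rmult_assoc, Rinv_l by lra. nra.
    - rewrite INR_pow2. replace (/ 4) with (/ 2 * / 2) by field.
      rewrite Rpow_mult_distr, !pow_inv. field. lra. }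
  assert (E := is_lim_seq_unique _ _ HX2). rewrite (is_lim_seq_unique _ _ HY) in E.
  now injection E.
Qed.

(** This is [csc2_series] with the sign from [sin (i v) = i sinh v]. The left side is (PI / sinh (PI
    x))^2, written as a rational function of [exp (- 2 PI x)] to match the sum of n q^n. *)
Lemma inv_sinh2_partial_fractions (x : R) : 0 < x ->
  4 * PI ^ 2 * (exp (- (2 * PI * x)) / (1 - exp (- (2 * PI * x))) ^ 2) =
  / x ^ 2 + 2 * Series (fun m => (x ^ 2 - INR (S m) ^ 2) / (x ^ 2 + INR (S m) ^ 2) ^ 2).
Proof.
  intros Hx. assert (HPI := PI_RGT_0).
  assert (H := csc2_series x Hx).
  rewrite (Series_ext _ (fun m => (-1) * re_inv2 (INR (S m)) x)).
  2:{ intros m. unfold re_inv2. rewrite (Rplus_comm (x ^ 2)). unfold Rdiv. ring. }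
  rewrite Series_scal_l.
  enough (csc2 0 (PI * x) = - 4 * (exp (- (2 * PI * x)) / (1 - exp (- (2 * PI * x))) ^ 2)) by nra.
  unfold csc2. rewrite Rmult_0_r, cos_0. unfold cosh.
  replace (2 * (PI * x)) with (2 * PI * x) by ring.
  rewrite (exp_Ropp (2 * PI * x)).
  assert (1 < exp (2 * PI * x)).
  { rewrite <- exp_0. apply exp_increasing. nra. }
  set (e := exp (2 * PI * x)) in *. field. repeat split; nra.
Qed.

(** * The Lipschitz formula *)

Lemma INR_S_ge_1 (n : nat) : 1 <= INR (S n).
Proof. rewrite S_INR. pose proof (pos_INR n). lra. Qed.

Lemma pow_exp_bound (r : nat) (c : R) : 0 < c ->
  exists K, 0 < K /\ forall x, 0 <= x -> x ^ r * exp (- (c * x)) <= K.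
Proof.
  revert c. induction r as [|r IH]; intros c Hc.
  - exists 1. split; [lra|]. intros x Hx. rewrite pow_O, Rmult_1_l, <- exp_0.
    destruct (Req_dec (c * x) 0) as [->|]; [rewrite Ropp_0; lra|left; apply exp_increasing; nra].
  - destruct (IH (c / 2)) as [K [HK H]]; [lra|]. exists (2 / c * K).
    split; [apply Rmult_lt_0_compat; auto; apply Rdiv_lt_0_compat; lra|].
    intros x Hx. replace (- (c * x)) with (- (c / 2 * x) + - (c / 2 * x)) by field.
    rewrite exp_plus. simpl pow.
    replace (x * x ^ r * (exp (- (c / 2 * x)) * exp (- (c / 2 * x)))) with
      ((x * exp (- (c / 2 * x))) * (x ^ r * exp (- (c / 2 * x)))) by ring.
    apply Rmult_le_compat; auto.
    + apply Rmult_le_pos; [lra|left; apply exp_pos].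
    + apply Rmult_le_pos; [now apply pow_le|left; apply exp_pos].
    + rewrite exp_Ropp. assert (0 < exp (c / 2 * x)) by apply exp_pos.
      apply Rmult_le_reg_r with (exp (c / 2 * x)); auto.
      rewrite Rmult_assoc, Rinv_l, Rmult_1_r by lra.
      apply Rle_trans with (2 / c * (c / 2 * x)); [right; field; lra|].
      apply Rmult_le_compat_l; [left; apply Rdiv_lt_0_compat; lra|].
      destruct (Req_dec (c / 2 * x) 0) as [->|Hn]; [rewrite exp_0; lra|].
      pose proof (exp_ineq1 _ Hn). lra.
Qed.

Lemma ex_series_pow_exp (r : nat) (c : R) : 0 < c ->
  ex_series (fun n => INR (S n) ^ r * exp (- (c * INR (S n)))).
Proof.
  intros Hc. destruct (pow_exp_bound (r + 2) c Hc) as [K [HK H]].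
  apply (ex_series_dom _ (fun n => K * / INR (S n) ^ 2)).
  - intros n. pose proof (INR_S_ge_1 n). set (x := INR (S n)) in *.
    rewrite Rabs_pos_eq by (apply Rmult_le_pos; [apply pow_le; lra|left; apply exp_pos]).
    apply Rmult_le_reg_r with (x ^ 2); [nra|].
    rewrite (Rmult_assoc K), Rinv_l, Rmult_1_r by nra.
    specialize (H x ltac:(lra)). rewrite pow_add in H. lra.
  - apply (ex_series_Rscal K _ ex_series_inv_sqr).
Qed.

Definition lipschitz_sum (r : nat) (x : R) : R :=
  Series (fun n => INR (S n) ^ r * exp (- (2 * PI * x * INR (S n)))).

Lemma ex_lipschitz_sum (r : nat) (x : R) : 0 < x ->
  ex_series (fun n => INR (S n) ^ r * exp (- (2 * PI * x * INR (S n)))).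
Proof.
  intros Hx. apply ex_series_pow_exp. pose proof PI_RGT_0. nra.
Qed.

Lemma is_derive_lipschitz_sum (r : nat) (x : R) : 0 < x ->
  is_derive (lipschitz_sum r) x (- (2 * PI) * lipschitz_sum (S r) x).
Proof.
  intros Hx. pose proof PI_RGT_0. unfold lipschitz_sum at 2. rewrite <- Series_scal_l.
  apply (is_derive_Series (fun n x => INR (S n) ^ r * exp (- (2 * PI * x * INR (S n))))
    (fun n x => - (2 * PI) * (INR (S n) ^ S r * exp (- (2 * PI * x * INR (S n)))))
    (fun n => 2 * PI * (INR (S n) ^ S r * exp (- (2 * PI * (x / 2) * INR (S n))))) (x / 2)).
  - lra.
  - intros n y Hy. set (t := INR (S n)). auto_derive; auto. simpl pow. ring.
  - intros n y Hy. rewrite Rabs_mult, Rabs_Ropp, (Rabs_pos_eq (2 * PI)) by lra.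
    pose proof (INR_S_ge_1 n).
    rewrite Rabs_pos_eq by (apply Rmult_le_pos; [apply pow_le; lra|left; apply exp_pos]).
    apply Rmult_le_compat_l; [lra|]. apply Rmult_le_compat_l; [apply pow_le; lra|].
    left. apply exp_increasing. assert (0 < 2 * PI * INR (S n)) by nra. nra.
  - apply (ex_series_Rscal (2 * PI) _ (ex_lipschitz_sum (S r) (x / 2) ltac:(lra))).
  - intros y Hy. apply ex_lipschitz_sum. lra.
Qed.

Lemma lipschitz_sum_0 (x : R) : 0 < x ->
  lipschitz_sum 0 x = exp (- (2 * PI * x)) / (1 - exp (- (2 * PI * x))).
Proof.
  intros Hx. pose proof PI_RGT_0. unfold lipschitz_sum.
  set (z := exp (- (2 * PI * x))).
  assert (Hz : 0 < z < 1).
  { split; [apply exp_pos|]. unfold z. rewrite <- exp_0. apply exp_increasing. nra. }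
  rewrite (Series_ext _ (fun n => z * z ^ n)).
  - rewrite Series_scal_l, Series_geom by (rewrite Rabs_pos_eq; lra). reflexivity.
  - intros n. rewrite pow_O, Rmult_1_l. change (z * z ^ n) with (z ^ S n).
    unfold z. rewrite <- (Rpower_pow (S n)) by apply exp_pos. unfold Rpower. rewrite ln_exp.
    f_equal. ring.
Qed.

Lemma lipschitz_sum_1 (x : R) : 0 < x ->
  lipschitz_sum 1 x = exp (- (2 * PI * x)) / (1 - exp (- (2 * PI * x))) ^ 2.
Proof.
  intros Hx. pose proof PI_RGT_0.
  assert (H1 := is_derive_lipschitz_sum 0 x Hx).
  assert (Hz : exp (- (2 * PI * x)) < 1) by (rewrite <- exp_0; apply exp_increasing; nra).
  assert (H2 : is_derive (lipschitz_sum 0) x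
     (- (2 * PI) * (exp (- (2 * PI * x)) / (1 - exp (- (2 * PI * x))) ^ 2))).
  { apply (is_derive_ext_loc (fun x => exp (- (2 * PI * x)) / (1 - exp (- (2 * PI * x))))).
    - exists (mkposreal x Hx). intros y Hy. symmetry. apply lipschitz_sum_0.
      apply Rabs_def2 in Hy. simpl in Hy. unfold minus, plus, opp in Hy; simpl in Hy. lra.
    - auto_derive; [lra|]. field. lra. }
  assert (E := is_derive_unique _ _ _ H1). rewrite (is_derive_unique _ _ _ H2) in E. nra.
Qed.

Definition inv_pow (k : nat) (x t : R) : C := ((/ (x, t)) ^ k)%C.

Lemma is_derive_inv_pow (k : nat) (x t : R) : 0 < x ->
  is_derive (fun x => Re (inv_pow k x t)) x (- INR k * Re (inv_pow (S k) x t)) /\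
  is_derive (fun x => Im (inv_pow k x t)) x (- INR k * Im (inv_pow (S k) x t)).
Proof.
  intros Hx.
  assert (Hd : x * (x * 1) + t * (t * 1) <> 0) by nra.
  assert (R1 : is_derive (fun x => Re (/ (x, t))%C) x (- Re (/ (x, t) * / (x, t))%C)).
  { unfold Re, Im, Cinv, Cmult; simpl. auto_derive; auto. field. nra. }
  assert (I1 : is_derive (fun x => Im (/ (x, t))%C) x (- Im (/ (x, t) * / (x, t))%C)).
  { unfold Re, Im, Cinv, Cmult; simpl. auto_derive; auto. field. nra. }
  induction k as [|k [IHR IHI]].
  - unfold inv_pow. simpl INR. rewrite Ropp_0, !Rmult_0_l. split.
    + exact (is_derive_const (V := R_NormedModule) 1 x).
    + exact (is_derive_const (V := R_NormedModule) 0 x).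
  - set (w := fun x => (/ (x, t))%C) in *.
    assert (E : forall k, - INR (S k) = - INR k - 1) by (intros; rewrite S_INR; ring).
    assert (ER : forall x, Re (inv_pow (S k) x t) = Re (w x) * Re (inv_pow k x t) - Im (w x) * Im (inv_pow k x t))
      by reflexivity.
    assert (EI : forall x, Im (inv_pow (S k) x t) = Re (w x) * Im (inv_pow k x t) + Im (w x) * Re (inv_pow k x t))
      by reflexivity.
    assert (Hm : forall f g : R -> R, forall f' g', is_derive f x f' -> is_derive g x g' ->
       is_derive (fun x => f x * g x) x (f' * g x + f x * g')).
    { intros f g f' g' Hf Hg. apply (is_derive_mult f g x f' g'); auto. intros; apply Rmult_comm. }
    split.
    + apply (is_derive_ext (fun x => Re (w x) * Re (inv_pow k x t) - Im (w x) * Im (inv_pow k x t)));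
        [intros; symmetry; apply ER|].
      evar_last; [apply @is_derive_minus; apply Hm; eassumption|].
      rewrite E. unfold minus, plus, opp; simpl. unfold inv_pow; simpl. fold (w x).
      unfold Re, Im, Cmult; simpl. ring.
    + apply (is_derive_ext (fun x => Re (w x) * Im (inv_pow k x t) + Im (w x) * Re (inv_pow k x t)));
        [intros; symmetry; apply EI|].
      evar_last; [apply @is_derive_plus; apply Hm; eassumption|].
      rewrite E. unfold minus, plus, opp; simpl. unfold inv_pow; simpl. fold (w x).
      unfold Re, Im, Cmult; simpl. ring.
Qed.

Lemma Cmod_sqr (z : C) : Cmod z ^ 2 = fst z ^ 2 + snd z ^ 2.
Proof. unfold Cmod. rewrite pow2_sqrt; nra. Qed.

Lemma Re_le_Cmod (z : C) : Rabs (Re z) <= Cmod z.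
Proof. eapply Rle_trans; [apply Rmax_l|apply Rmax_Cmod]. Qed.

Lemma Im_le_Cmod (z : C) : Rabs (Im z) <= Cmod z.
Proof. eapply Rle_trans; [apply Rmax_r|apply Rmax_Cmod]. Qed.

Lemma inv_pow_bound (k : nat) (x t : R) : 0 < t ->
  Rabs (Re (inv_pow k x t)) <= / t ^ k.
Proof.
  intros Ht. eapply Rle_trans; [apply Re_le_Cmod|].
  assert (Hm : t <= Cmod (x, t)).
  { eapply Rle_trans; [|apply (Im_le_Cmod (x, t))]. apply Rle_abs. }
  unfold inv_pow. rewrite Cmod_pow, Cmod_inv by (apply Cmod_gt_0; lra). rewrite <- pow_inv.
  apply pow_incr. split; [left; apply Rinv_0_lt_compat; lra|].
  apply Rinv_le_contravar; auto.
Qed.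

(** [x ^ 2 + t ^ 2 >= x t] splits the decay into a product, the form needed for an interchange. Each
    factor keeps half of the exponent, so the majorant is summable for [j >= 2] and fails in weight
    two. *)
Lemma inv_pow_even_bound (j : nat) (x t : R) : 0 < x -> 0 < t ->
  Rabs (Re (inv_pow (2 * j) x t)) <= / x ^ j * / t ^ j.
Proof.
  intros Hx Ht. eapply Rle_trans; [apply Re_le_Cmod|].
  assert (Hz : (x, t) <> (0 : C)) by (intros H; injection H; lra).
  unfold inv_pow. rewrite Cmod_pow, Cmod_inv by auto.
  rewrite pow_mult, pow_inv, Cmod_sqr; simpl fst; simpl snd.
  rewrite <- !pow_inv, <- Rpow_mult_distr.
  apply pow_incr. split; [left; apply Rinv_0_lt_compat; nra|].
  rewrite <- Rinv_mult. apply Rinv_le_contravar; nra.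
Qed.

Lemma ex_series_inv_pow_S (k : nat) : ex_series (fun m => / INR (S m) ^ S (S k)).
Proof.
  apply (ex_series_dom _ (fun n => / INR (S n) ^ 2)); [|apply ex_series_inv_sqr].
  intros n. pose proof (INR_S_ge_1 n).
  rewrite Rabs_pos_eq by (left; apply Rinv_0_lt_compat, pow_lt; lra).
  apply Rinv_le_contravar; [apply pow_lt; lra|]. apply Rle_pow; auto. lia.
Qed.

Lemma ex_series_inv_pow (k : nat) (x : R) :
  ex_series (fun m => Re (inv_pow (S (S k)) x (INR (S m)))).
Proof.
  apply (ex_series_dom _ (fun m => / INR (S m) ^ S (S k))); [|apply ex_series_inv_pow_S].
  intros m. apply inv_pow_bound. pose proof (INR_S_ge_1 m). lra.
Qed.

(* The sum of [(x + i m) ^ (- k)] over all integers [m]. *)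
Definition bilateral (k : nat) (x : R) : R :=
  / x ^ k + 2 * Series (fun m => Re (inv_pow k x (INR (S m)))).

Lemma is_derive_bilateral (k : nat) (x : R) : 0 < x ->
  is_derive (bilateral (S (S k))) x (- INR (S (S k)) * bilateral (S (S (S k))) x).
Proof.
  intros Hx. unfold bilateral.
  assert (H : is_derive (fun x => Series (fun m => Re (inv_pow (S (S k)) x (INR (S m))))) x
    (Series (fun m => - INR (S (S k)) * Re (inv_pow (S (S (S k))) x (INR (S m)))))).
  { apply (is_derive_Series (fun m x => Re (inv_pow (S (S k)) x (INR (S m))))
      (fun m x => - INR (S (S k)) * Re (inv_pow (S (S (S k))) x (INR (S m))))
      (fun m => INR (S (S k)) * / INR (S m) ^ S (S (S k))) 0); auto.
    - intros n y Hy. now apply is_derive_inv_pow.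
    - intros n y Hy. rewrite Rabs_mult, Rabs_Ropp, Rabs_pos_eq by apply pos_INR.
      apply Rmult_le_compat_l; [apply pos_INR|]. apply inv_pow_bound. pose proof (INR_S_ge_1 n). lra.
    - apply (ex_series_Rscal _ _ (ex_series_inv_pow_S (S k))).
    - intros y Hy. apply ex_series_inv_pow. }
  rewrite Series_scal_l in H.
  assert (H0 : is_derive (fun x => / x ^ S (S k)) x (- INR (S (S k)) * / x ^ S (S (S k)))).
  { assert (x ^ S (S k) <> 0) by (apply pow_nonzero; lra).
    assert (x ^ k <> 0) by (apply pow_nonzero; lra).
    auto_derive; [auto|].
    change (match k with O => 1 | S _ => INR k + 1 end + 1) with (INR (S (S k))).
    set (c := INR (S (S k))). simpl pow. field. split; auto; lra. }
  evar_last; [apply @is_derive_plus; [exact H0|apply is_derive_scal; exact H]|].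
  unfold plus; simpl. ring.
Qed.

Theorem lipschitz_formula (k : nat) (x : R) : 0 < x ->
  (2 * PI) ^ (S (S k)) * lipschitz_sum (S k) x = INR (fact (S k)) * bilateral (S (S k)) x.
Proof.
  revert x. induction k as [|k IH]; intros x Hx.
  - rewrite lipschitz_sum_1 by auto. unfold bilateral.
    assert (H := inv_sinh2_partial_fractions x Hx).
    rewrite (Series_ext _ (fun m => (x ^ 2 - INR (S m) ^ 2) / (x ^ 2 + INR (S m) ^ 2) ^ 2)).
    + rewrite <- H. simpl. ring.
    + intros m. pose proof (INR_S_ge_1 m). set (t := INR (S m)) in *.
      unfold inv_pow, Re, Cinv, Cmult; simpl. field. nra.
  - assert (H1 := is_derive_scal _ x ((2 * PI) ^ S (S k)) _ (is_derive_lipschitz_sum (S k) x Hx)).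
    assert (H2 := is_derive_scal _ x (INR (fact (S k))) _ (is_derive_bilateral k x Hx)).
    assert (H3 : is_derive (fun x => INR (fact (S k)) * bilateral (S (S k)) x) x
       ((2 * PI) ^ S (S k) * (- (2 * PI) * lipschitz_sum (S (S k)) x))).
    { apply (is_derive_ext_loc (fun x => (2 * PI) ^ S (S k) * lipschitz_sum (S k) x)); auto.
      exists (mkposreal x Hx). intros y Hy. apply IH.
      apply Rabs_def2 in Hy. simpl in Hy. unfold minus, plus, opp in Hy; simpl in Hy. lra. }
    assert (E := eq_trans (eq_sym (is_derive_unique _ _ _ H2)) (is_derive_unique _ _ _ H3)).
    change (fact (S (S k))) with (S (S k) * fact (S k))%nat. rewrite mult_INR.
    change ((2 * PI) ^ S (S (S k))) with (2 * PI * (2 * PI) ^ S (S k)). lra.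
Qed.

(** * Eisenstein series on the imaginary axis *)

(* The sum of [sigma_r n * exp (- 2 pi n y)], see [eis_sum_divisor]. *)
Definition eis_sum (r : nat) (y : R) : R :=
  Series (fun m => lipschitz_sum r (INR (S m) * y)).

Lemma exp_pow (x : R) (n : nat) : exp x ^ n = exp (x * INR n).
Proof.
  rewrite <- Rpower_pow by apply exp_pos. unfold Rpower. rewrite ln_exp. f_equal. ring.
Qed.

Lemma exp_neg_lt_1 (x : R) : 0 < x -> 0 < exp (- x) < 1.
Proof.
  intros Hx. split; [apply exp_pos|]. rewrite <- exp_0. apply exp_increasing. lra.
Qed.

Lemma exp_le (x y : R) : x <= y -> exp x <= exp y.
Proof. intros [H| ->]; [left; now apply exp_increasing|lra]. Qed.

Lemma is_series_geom_S (z : R) : 0 < z < 1 -> is_series (fun n => z ^ S n) (z / (1 - z)).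
Proof.
  intros Hz. apply (is_series_Rscal z (fun n => z ^ n)).
  apply is_series_geom. rewrite Rabs_pos_eq; lra.
Qed.

(** For [a, b >= 1] one has [2 a b >= a + b], so the exponential of a product is dominated by a
    product of exponentials. *)
Lemma eis_term_bound (r : nat) (y : R) (m n : nat) : 0 < y ->
  Rabs (INR (S n) ^ r * exp (- (2 * PI * (INR (S m) * y) * INR (S n)))) <=
  INR (S m) ^ 0 * exp (- (PI * y * INR (S m))) * (INR (S n) ^ r * exp (- (PI * y * INR (S n)))).
Proof.
  intros Hy. pose proof PI_RGT_0. pose proof (INR_S_ge_1 n). pose proof (INR_S_ge_1 m).
  set (a := INR (S n)) in *. set (b := INR (S m)) in *.
  rewrite Rabs_pos_eq by (apply Rmult_le_pos; [apply pow_le; lra|left; apply exp_pos]).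
  rewrite pow_O, Rmult_1_l.
  replace (exp (- (PI * y * b)) * (a ^ r * exp (- (PI * y * a)))) with
    (a ^ r * (exp (- (PI * y * b)) * exp (- (PI * y * a)))) by ring.
  apply Rmult_le_compat_l; [apply pow_le; lra|]. rewrite <- exp_plus. apply exp_le.
  assert (0 < PI * y) by nra. assert (a + b <= 2 * (b * a)) by nra.
  replace (- (2 * PI * (b * y) * a)) with (- (PI * y * (2 * (b * a)))) by ring. nra.
Qed.

Lemma ex_eis_sum (r : nat) (y : R) : 0 < y ->
  ex_series (fun m => lipschitz_sum r (INR (S m) * y)).
Proof.
  intros Hy. pose proof PI_RGT_0. assert (0 < PI * y) by nra.
  apply (ex_series_rows (fun m n => INR (S n) ^ r * exp (- (2 * PI * (INR (S m) * y) * INR (S n)))) _ _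
    (fun m n => eis_term_bound r y m n Hy)); now apply ex_series_pow_exp.
Qed.

(** Summing the geometric series in [m] first gives a Lambert series; for [r = 1] it is, up to a
    factor, the derivative of the logarithm of the product over [1 - q ^ n], see
    [is_derive_log_prod]. *)
Lemma eis_sum_lambert (r : nat) (y : R) : 0 < y ->
  is_series (fun n => INR (S n) ^ r *
    (exp (- (2 * PI * y * INR (S n))) / (1 - exp (- (2 * PI * y * INR (S n)))))) (eis_sum r y).
Proof.
  intros Hy. pose proof PI_RGT_0. assert (0 < PI * y) by nra.
  apply (is_series_ext (fun n => Series (fun m =>
     INR (S n) ^ r * exp (- (2 * PI * (INR (S m) * y) * INR (S n)))))).
  - intros n. rewrite Series_scal_l. f_equal.
    pose proof (INR_S_ge_1 n). set (z := exp (- (2 * PI * y * INR (S n)))).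
    assert (Hz : 0 < z < 1) by (apply exp_neg_lt_1; nra).
    apply is_series_unique. apply (is_series_ext (fun m => z ^ S m)); [|now apply is_series_geom_S].
    intros m. unfold z. rewrite exp_pow. f_equal. ring.
  - apply (is_series_swap _ _ _ (fun m n => eis_term_bound r y m n Hy)); now apply ex_series_pow_exp.
Qed.

Lemma psum_filter_seq (f : nat -> nat) (p : nat -> bool) (n : nat) :
  INR (list_sum (map f (filter p (seq 1 n)))) =
  psum (fun d => if p (S d) then INR (f (S d)) else 0) n.
Proof.
  induction n as [|n IH]; [reflexivity|].
  rewrite seq_S, filter_app, map_app, list_sum_app, plus_INR, IH. simpl psum. f_equal.
  simpl. destruct (p (S n)); simpl; [now rewrite Nat.add_0_r|reflexivity].
Qed.

Lemma is_series_finite (a : nat -> R) (N : nat) :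
  (forall n, (N <= n)%nat -> a n = 0) -> is_series a (psum a N).
Proof.
  intros H. change (is_lim_seq (sum_n a) (psum a N)).
  apply (is_lim_seq_ext_loc (fun _ => psum a N)); [|apply is_lim_seq_const].
  exists N. intros n Hn. rewrite <- psum_sum_n.
  replace (S n) with (N + (S n - N))%nat by lia. rewrite psum_add.
  enough (E : psum (fun k => a (N + k)%nat) (S n - N) = 0) by (rewrite E; ring).
  induction (S n - N)%nat as [|k IHk]; [reflexivity|]. simpl. rewrite IHk, H by lia. ring.
Qed.

Definition div_term (r : nat) (y : R) (n d : nat) : R :=
  if Nat.eqb (Nat.modulo (S n) (S d)) 0 then INR (S d) ^ r * exp (- (2 * PI * y * INR (S n))) else 0.

Lemma div_term_bound (r : nat) (y : R) (n d : nat) : 0 < y ->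
  Rabs (div_term r y n d) <=
  INR (S n) ^ 0 * exp (- (PI * y * INR (S n))) * (INR (S d) ^ r * exp (- (PI * y * INR (S d)))).
Proof.
  intros Hy. pose proof PI_RGT_0. assert (0 < PI * y) by nra.
  pose proof (INR_S_ge_1 n). pose proof (INR_S_ge_1 d).
  rewrite pow_O, Rmult_1_l. assert (0 <= INR (S d) ^ r) by (apply pow_le; lra).
  pose proof (exp_pos (- (PI * y * INR (S n)))). pose proof (exp_pos (- (PI * y * INR (S d)))).
  unfold div_term. destruct (Nat.eqb_spec (Nat.modulo (S n) (S d)) 0) as [E|E].
  - assert (Hdn : INR (S d) <= INR (S n)).
    { apply le_INR. apply Nat.Div0.mod_divides in E. destruct E as [c Hc]. destruct c; [lia|]. nia. }
    rewrite Rabs_pos_eq by (apply Rmult_le_pos; [auto|left; apply exp_pos]).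
    replace (exp (- (PI * y * INR (S n))) * (INR (S d) ^ r * exp (- (PI * y * INR (S d)))))
      with (INR (S d) ^ r * (exp (- (PI * y * INR (S n))) * exp (- (PI * y * INR (S d))))) by ring.
    apply Rmult_le_compat_l; auto. rewrite <- exp_plus. apply exp_le. nra.
  - rewrite Rabs_R0. apply Rmult_le_pos; [lra|]. apply Rmult_le_pos; lra.
Qed.

(** Instead of reindexing by the multiples of [S d], the series is shifted by the period [S d]: its
    sum then solves [S = z + z * S]. *)
Lemma Series_multiples (d : nat) (c : R) : 0 < c ->
  Series (fun n => if Nat.eqb (Nat.modulo (S n) (S d)) 0 then exp (- (c * INR (S n))) else 0) =
  exp (- (c * INR (S d))) / (1 - exp (- (c * INR (S d)))).
Proof.
  intros Hc. pose proof (INR_S_ge_1 d).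
  set (a := fun n => if Nat.eqb (Nat.modulo (S n) (S d)) 0 then exp (- (c * INR (S n))) else 0).
  assert (Ha : ex_series a).
  { apply (ex_series_dom _ (fun n => INR (S n) ^ 0 * exp (- (c * INR (S n))))); [|now apply ex_series_pow_exp].
    intros n. unfold a. rewrite pow_O, Rmult_1_l. pose proof (exp_pos (- (c * INR (S n)))).
    destruct (Nat.eqb _ 0); [rewrite Rabs_pos_eq; lra|rewrite Rabs_R0; lra]. }
  set (z := exp (- (c * INR (S d)))). assert (Hz : 0 < z < 1) by (apply exp_neg_lt_1; nra).
  enough (E : Series a = z + z * Series a).
  { apply Rmult_eq_reg_r with (1 - z); [|lra]. unfold Rdiv. rewrite Rmult_assoc, Rinv_l by lra. lra. }
  rewrite (Series_split a d Ha) at 1. f_equal.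
  - rewrite <- psum_sum_n. simpl. replace (psum a d) with 0.
    + unfold a. rewrite Nat.Div0.mod_same. simpl Nat.eqb. cbv iota. unfold z. ring.
    + symmetry. rewrite (psum_ext a (fun _ => 0 * 0)).
      * rewrite psum_scal. ring.
      * intros k Hk. unfold a. rewrite Nat.mod_small by lia. simpl. ring.
  - rewrite <- Series_scal_l. apply Series_ext. intros k. unfold a.
    replace (S (S d + k)) with (S k + 1 * S d)%nat by lia. rewrite Nat.Div0.mod_add.
    destruct (Nat.eqb _ 0); [|ring]. unfold z. rewrite <- exp_plus. f_equal.
    rewrite plus_INR, mult_INR. simpl (INR 1). ring.
Qed.

(** The divisor sum is a row of the array [div_term] indexed by [n] and [d]; its columns run over
    the multiples of [S d] and add up to the Lambert series. *)
Lemma eis_sum_divisor (r : nat) (y : R) : 0 < y ->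
  is_series (fun n => INR (divisor_sum r (S n)) * exp (- (2 * PI * y)) ^ S n) (eis_sum r y).
Proof.
  intros Hy. pose proof PI_RGT_0. assert (0 < PI * y) by nra.
  assert (HB := fun n d => div_term_bound r y n d Hy).
  assert (Hu := ex_series_pow_exp 0 (PI * y) ltac:(auto)).
  assert (Hv := ex_series_pow_exp r (PI * y) ltac:(auto)).
  replace (eis_sum r y) with (Series (fun n => Series (div_term r y n))).
  - apply (is_series_ext (fun n => Series (div_term r y n))).
    + intros n. apply is_series_unique.
      unfold divisor_sum. rewrite psum_filter_seq, Rmult_comm, <- psum_scal.
      erewrite psum_ext; [apply (is_series_finite (div_term r y n) (S n))|].
      * intros d Hd. unfold div_term. rewrite Nat.mod_small by lia. reflexivity.
      * intros d Hd. unfold div_term. rewrite exp_pow, pow_INR.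
        destruct (Nat.eqb _ 0); [|ring]. rewrite Rmult_comm. do 2 f_equal. ring.
    + apply Series_correct. apply (ex_series_rows _ _ _ HB); auto.
  - rewrite (Series_swap _ _ _ HB Hu Hv).
    rewrite <- (is_series_unique _ _ (eis_sum_lambert r y Hy)).
    apply Series_ext. intros d.
    rewrite (Series_ext _ (fun n => INR (S d) ^ r *
      (if Nat.eqb (Nat.modulo (S n) (S d)) 0 then exp (- (2 * PI * y * INR (S n))) else 0))).
    + rewrite Series_scal_l, Series_multiples by nra. reflexivity.
    + intros n. unfold div_term. destruct (Nat.eqb _ 0); ring.
Qed.

Definition zeta (k : nat) : R := Series (fun m => / INR (S m) ^ k).

Lemma inv_pow_scale (k : nat) (s x t : R) : 0 < s -> 0 < x ->
  Re (inv_pow k (x / s) t) = s ^ k * Re (inv_pow k x (s * t)).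
Proof.
  intros Hs Hx. unfold inv_pow.
  replace (/ ((x / s)%R, t))%C with (RtoC s * / (x, (s * t)%R))%C.
  - rewrite Cpow_mult_l, <- RtoC_pow. unfold Re, Cmult, RtoC; simpl. ring.
  - unfold Cinv, Cmult, RtoC; simpl. apply injective_projections; simpl; field; split; nra.
Qed.

(** [x + i t] is [i] times the conjugate of [t + i x]. An even power turns the factor [- i] into
    [(-1) ^ j], and conjugation leaves the real part alone. *)
Lemma inv_pow_rotate (j : nat) (x t : R) : 0 < x ->
  Re (inv_pow (2 * j) x t) = (-1) ^ j * Re (inv_pow (2 * j) t x).
Proof.
  intros Hx. unfold inv_pow.
  replace (/ (x, t))%C with (- Ci * Cconj (/ (t, x)))%C.
  - rewrite Cpow_mult_l, (Cpow_mult_r (- Ci)%C).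
    replace ((- Ci) ^ 2)%C with (RtoC (-1)) by (unfold Ci, RtoC, Copp, Cpow, Cmult; simpl; f_equal; ring).
    rewrite <- RtoC_pow, <- Cpow_conj. unfold Re, Cmult, RtoC, Cconj; simpl. ring.
  - unfold Cinv, Cmult, Ci, Copp, Cconj; simpl. apply injective_projections; simpl; field; nra.
Qed.

Section Transformation.
Variable y : R.
Hypothesis Hy : 0 < y.

(** Convergence of the sum of the row sums is a hypothesis because it has two sources: absolute
    convergence in higher weight, [lattice_sum_2_exchange] in weight two. *)
Lemma eis_sum_bilateral (k : nat) :
  ex_series (fun m => Series (fun n => Re (inv_pow (S (S k)) (INR (S m) * y) (INR (S n))))) ->
  (2 * PI) ^ S (S k) * eis_sum (S k) y = INR (fact (S k)) *
  (zeta (S (S k)) / y ^ S (S k) +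
   2 * Series (fun m => Series (fun n => Re (inv_pow (S (S k)) (INR (S m) * y) (INR (S n)))))).
Proof.
  intros H. unfold eis_sum. rewrite <- Series_scal_l.
  rewrite (Series_ext _ (fun m => INR (fact (S k)) * bilateral (S (S k)) (INR (S m) * y))).
  2:{ intros m. apply lipschitz_formula. pose proof (INR_S_ge_1 m). nra. }
  rewrite Series_scal_l. f_equal. unfold bilateral, zeta.
  rewrite Series_plus.
  - rewrite Series_scal_l. f_equal. unfold Rdiv. rewrite Rmult_comm, <- Series_scal_l.
    apply Series_ext. intros m. rewrite Rpow_mult_distr, Rinv_mult. ring.
  - apply (ex_series_ext (fun m => / y ^ S (S k) * / INR (S m) ^ S (S k))).
    + intros m. rewrite Rpow_mult_distr, Rinv_mult. apply Rmult_comm.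
    + apply (ex_series_Rscal _ _ (ex_series_inv_pow_S k)).
  - exact (ex_series_Rscal 2 _ H).
Qed.

Lemma zeta_lattice_bound (j m n : nat) :
  Rabs (Re (inv_pow (2 * j) (INR (S m) * y) (INR (S n)))) <=
  / y ^ j * / INR (S m) ^ j * / INR (S n) ^ j.
Proof.
  pose proof (INR_S_ge_1 m). pose proof (INR_S_ge_1 n).
  eapply Rle_trans; [apply inv_pow_even_bound; nra|].
  rewrite Rpow_mult_distr, Rinv_mult. right; ring.
Qed.

End Transformation.

Definition lattice_sum (k : nat) (y : R) : R :=
  Series (fun m => Series (fun n => Re (inv_pow k (INR (S m) * y) (INR (S n))))).

(** The rotation swaps the two lattice coordinates, so the double sum on the right runs in the
    opposite order. Restoring the order is left to the uses, since in weight two it changes the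
    value. *)
Lemma lattice_sum_inv (j : nat) (y : R) : 0 < y ->
  lattice_sum (2 * j) (/ y) =
  (-1) ^ j * y ^ (2 * j) *
  Series (fun m => Series (fun n => Re (inv_pow (2 * j) (INR (S n) * y) (INR (S m))))).
Proof.
  intros Hy. unfold lattice_sum. rewrite <- Series_scal_l. apply Series_ext. intros m.
  rewrite <- Series_scal_l. apply Series_ext. intros n.
  pose proof (INR_S_ge_1 m). pose proof (INR_S_ge_1 n).
  change (INR (S m) * / y) with (INR (S m) / y). rewrite inv_pow_scale by lra.
  rewrite inv_pow_rotate by lra. rewrite (Rmult_comm y). ring.
Qed.

Lemma ex_lattice_sum (j : nat) (y : R) : 0 < y -> (2 <= j)%nat ->
  ex_series (fun m => Series (fun n => Re (inv_pow (2 * j) (INR (S m) * y) (INR (S n))))).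
Proof.
  intros Hy Hj. destruct j as [|[|j]]; try lia.
  apply (ex_series_rows _ _ _ (zeta_lattice_bound y Hy (S (S j)))).
  - apply (ex_series_Rscal _ _ (ex_series_inv_pow_S j)).
  - apply ex_series_inv_pow_S.
Qed.

(** The lattice points off the axes contribute equally to both sums and cancel. What survives comes
    from the points on the axis [n = 0], hence the zeta value. *)
Lemma eis_sum_inv (j : nat) (y : R) : 0 < y -> (2 <= j)%nat ->
  (2 * PI) ^ (2 * j) * (eis_sum (2 * j - 1) (/ y) - (-1) ^ j * y ^ (2 * j) * eis_sum (2 * j - 1) y) =
  INR (fact (2 * j - 1)) * zeta (2 * j) * (y ^ (2 * j) - (-1) ^ j).
Proof.
  intros Hy Hj. pose proof (Rinv_0_lt_compat y Hy) as Hy'.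
  assert (Hk : exists k, (2 * j = S (S k) /\ 2 * j - 1 = S k)%nat) by (exists (2 * j - 2)%nat; lia).
  destruct Hk as [k [Ek Ek1]].
  assert (H1 := ex_lattice_sum j y Hy Hj). assert (H2 := ex_lattice_sum j (/ y) Hy' Hj).
  assert (HL := lattice_sum_inv j y Hy).
  replace (Series (fun m => Series (fun n => Re (inv_pow (2 * j) (INR (S n) * y) (INR (S m))))))
    with (lattice_sum (2 * j) y) in HL.
  2:{ destruct j as [|[|j]]; try lia.
      apply (Series_swap _ _ _ (zeta_lattice_bound y Hy (S (S j)))).
      - apply (ex_series_Rscal _ _ (ex_series_inv_pow_S j)).
      - apply ex_series_inv_pow_S. }
  rewrite Ek1. rewrite Ek in *.
  assert (E1 := eis_sum_bilateral y Hy k H1). assert (E2 := eis_sum_bilateral (/ y) Hy' k H2).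
  fold (lattice_sum (S (S k)) y) in E1. fold (lattice_sum (S (S k)) (/ y)) in E2. rewrite HL in E2.
  rewrite Rmult_minus_distr_l, E2.
  replace ((2 * PI) ^ S (S k) * ((-1) ^ j * y ^ S (S k) * eis_sum (S k) y)) with
    ((-1) ^ j * y ^ S (S k) * ((2 * PI) ^ S (S k) * eis_sum (S k) y)) by ring.
  rewrite E1. rewrite pow_inv. field. apply pow_nonzero; lra.
Qed.

(** * The weight two case and the discriminant *)

(** The exponent 3/2 is half of the decay of degree 3 met in [lattice_term_approx]. The comparison
    is with the telescoping series of [/ sqrt n]. *)
Lemma ex_series_three_halves : ex_series (fun n => / sqrt (INR (S n)) ^ 3).
Proof.
  apply (ex_series_dom _ (fun n => 4 * (/ sqrt (INR (S n)) - / sqrt (INR (S (S n)))))).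
  - intros n. pose proof (INR_S_ge_1 n). rewrite (S_INR (S n)). set (x := INR (S n)) in *.
    assert (Ha : 1 <= sqrt x) by (rewrite <- sqrt_1; apply sqrt_le_1_alt; lra).
    assert (Hb : sqrt x <= sqrt (x + 1)) by (apply sqrt_le_1_alt; lra).
    assert (Ea : sqrt x * sqrt x = x) by (apply sqrt_sqrt; lra).
    assert (Eb : sqrt (x + 1) * sqrt (x + 1) = x + 1) by (apply sqrt_sqrt; lra).
    set (a := sqrt x) in *. set (b := sqrt (x + 1)) in *.
    rewrite Rabs_pos_eq by (left; apply Rinv_0_lt_compat, pow_lt; lra).
    replace (4 * (/ a - / b)) with (4 * (b - a) * (b + a) / (a * b * (a + b))) by (field; lra).
    replace (4 * (b - a) * (b + a)) with 4 by nra.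
    assert (Hb2 : b <= 3 / 2 * a) by nra.
    assert (0 < a * b * (a + b)) by (apply Rmult_lt_0_compat; nra).
    apply Rmult_le_reg_r with (a ^ 3 * (a * b * (a + b))).
    + apply Rmult_lt_0_compat; auto. apply pow_lt; lra.
    + replace (/ a ^ 3 * (a ^ 3 * (a * b * (a + b)))) with (a * (b * (a + b))) by (field; lra).
      replace (4 / (a * b * (a + b)) * (a ^ 3 * (a * b * (a + b)))) with (a * (4 * a ^ 2)) by (field; lra).
      apply Rmult_le_compat_l; [lra|].
      apply Rle_trans with ((3 / 2 * a) * (5 / 2 * a)); [apply Rmult_le_compat; lra|nra].
  - apply (ex_series_Rscal 4 (fun n => / sqrt (INR (S n)) - / sqrt (INR (S (S n))))).
    eexists.
    apply (is_lim_seq_telescope (fun n => / sqrt (INR (S n))) 0).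
    apply (is_lim_seq_ext (fun n => sqrt (/ INR (S n)))).
    + intros n. apply sqrt_inv.
    + rewrite <- sqrt_0. apply (is_lim_seq_continuous sqrt); [apply continuity_pt_sqrt; lra|].
      apply is_lim_seq_inv_INR_S.
Qed.

Lemma Rabs_atan_le (z : R) : 0 <= z -> 0 <= atan z <= z.
Proof.
  intros Hz. destruct (Req_dec z 0) as [->|Hn]; [rewrite atan_0; lra|].
  destruct (MVT_gen atan 0 z (fun x => / (1 + x ^ 2))) as [c [_ Hc]].
  - intros x _. auto_derive; auto. unfold Rsqr. field. nra.
  - intros x _. apply derivable_continuous_pt, derivable_pt_atan.
  - rewrite atan_0, !Rminus_0_r in Hc. rewrite Hc.
    assert (0 < / (1 + c ^ 2) <= 1); [|nra]. split; [apply Rinv_0_lt_compat; nra|].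
    rewrite <- Rinv_1. apply Rinv_le_contravar; nra.
Qed.

Section WeightTwo.
Variable y : R.
Hypothesis Hy : 0 < y.

(* [psi] is chosen with [- d/dx (psi x t) = Re (x y + i t) ^ (- 2)], so that the
   telescoping term [psi x t - psi (x + 1) t] approximates the lattice term. *)
Let psi (x t : R) : R := x / (x ^ 2 * y ^ 2 + t ^ 2).
Let c (m n : nat) : R := Re (inv_pow 2 (INR (S m) * y) (INR (S n))).
Let e (m n : nat) : R := psi (INR (S m)) (INR (S n)) - psi (INR (S (S m))) (INR (S n)).

(** The difference has degree -3 in the lattice point, one better than the term itself, and is
    shared equally between the two indices. With [a = sqrt x] and [b = sqrt t] this comes down to
    [a b ^ 3 <= x ^ 2 + t ^ 2], seen by comparing [a] with [b]. *)
Lemma lattice_term_approx (m n : nat) :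
  Rabs (c m n - e m n) <=
  4 * (1 + / y ^ 2) * / sqrt (INR (S m)) ^ 3 * / sqrt (INR (S n)) ^ 3.
Proof.
  unfold c, e, psi. rewrite (S_INR (S m)).
  pose proof (INR_S_ge_1 m). pose proof (INR_S_ge_1 n).
  set (x := INR (S m)) in *. set (t := INR (S n)) in *.
  set (D := x ^ 2 * y ^ 2 + t ^ 2). set (D' := (x + 1) ^ 2 * y ^ 2 + t ^ 2).
  assert (Hy2 : 0 < y ^ 2) by nra.
  assert (Hx2 : 1 <= x ^ 2) by nra. assert (Ht2 : 1 <= t ^ 2) by nra.
  assert (HD : 0 < D) by (unfold D; nra).
  assert (HD' : D' = D + (2 * x + 1) * y ^ 2) by (unfold D, D'; ring).
  assert (HDD : D <= D') by nra.
  replace (Re (inv_pow 2 (x * y) t) - (x / D - (x + 1) / D')) with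
    (y ^ 2 * ((x ^ 2 * y ^ 2 - t ^ 2) * (2 * x + 1) - x * D) / (D ^ 2 * D')).
  2:{ unfold inv_pow, Re, Cinv, Cmult; simpl.
      unfold D, D'. field. repeat split; nra. }
  assert (B : Rabs ((x ^ 2 * y ^ 2 - t ^ 2) * (2 * x + 1) - x * D) <= 4 * x * D).
  { assert (- D <= x ^ 2 * y ^ 2 - t ^ 2 <= D) by (unfold D; nra). apply Rabs_le. nra. }
  assert (Hp : 0 < D ^ 2 * D') by (apply Rmult_lt_0_compat; nra).
  unfold Rdiv. rewrite !Rabs_mult, (Rabs_pos_eq (y ^ 2)), (Rabs_pos_eq (/ _))
    by (try (left; now apply Rinv_0_lt_compat); lra).
  apply Rle_trans with (4 * x * y ^ 2 / D ^ 2).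
  { apply Rmult_le_reg_r with (D ^ 2 * D'); auto.
    rewrite Rmult_assoc, Rinv_l by lra.
    replace (4 * x * y ^ 2 / D ^ 2 * (D ^ 2 * D')) with (y ^ 2 * (4 * x * D')) by (field; lra).
    rewrite Rmult_1_r. apply Rmult_le_compat_l; nra. }
  assert (Ha : 1 <= sqrt x) by (rewrite <- sqrt_1; apply sqrt_le_1_alt; lra).
  assert (Hb : 1 <= sqrt t) by (rewrite <- sqrt_1; apply sqrt_le_1_alt; lra).
  assert (Ea : sqrt x ^ 2 = x) by (apply pow2_sqrt; lra).
  assert (Eb : sqrt t ^ 2 = t) by (apply pow2_sqrt; lra).
  set (a := sqrt x) in *. set (b := sqrt t) in *.
  assert (Hab : a * b ^ 3 <= x ^ 2 + t ^ 2).
  { rewrite <- Ea, <- Eb. destruct (Rle_dec a b).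
    - assert (a * b ^ 3 <= b * b ^ 3) by (apply Rmult_le_compat_r; [apply pow_le; lra|auto]).
      assert (0 <= (a ^ 2) ^ 2) by (apply pow_le; nra). simpl in *. nra.
    - assert (a * b ^ 3 <= a * a ^ 3) by (apply Rmult_le_compat_l; [lra|apply pow_incr; lra]).
      assert (0 <= (b ^ 2) ^ 2) by (apply pow_le; nra). simpl in *. nra. }
  assert (Hpa : 0 < a ^ 3) by (apply pow_lt; lra). assert (Hpb : 0 < b ^ 3) by (apply pow_lt; lra).
  apply Rmult_le_reg_r with (D ^ 2 * (a ^ 3 * b ^ 3)); [apply Rmult_lt_0_compat; nra|].
  replace (4 * x * y ^ 2 / D ^ 2 * (D ^ 2 * (a ^ 3 * b ^ 3))) with (4 * (x ^ 2 * y ^ 2 * (a * b ^ 3)))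
    by (rewrite <- Ea; field; lra).
  replace (4 * (1 + / y ^ 2) * / a ^ 3 * / b ^ 3 * (D ^ 2 * (a ^ 3 * b ^ 3)))
    with (4 * (D * (D * (1 + / y ^ 2)))) by (field; lra).
  apply Rmult_le_compat_l; [lra|].
  apply Rmult_le_compat.
  - nra.
  - assert (0 <= b ^ 3) by lra. nra.
  - unfold D; nra.
  - eapply Rle_trans; [exact Hab|].
    replace (D * (1 + / y ^ 2)) with (x ^ 2 + t ^ 2 + x ^ 2 * y ^ 2 + t ^ 2 * / y ^ 2)
      by (unfold D; field; lra).
    assert (0 < / y ^ 2) by (now apply Rinv_0_lt_compat). nra.
Qed.

Lemma is_series_e_rows (n : nat) : is_series (fun m => e m n) (psi 1 (INR (S n))).
Proof.
  unfold e. replace (psi 1 (INR (S n))) with (psi (INR 1) (INR (S n)) - 0) by (simpl; ring).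
  apply (is_lim_seq_telescope (fun m => psi (INR (S m)) (INR (S n))) 0).
  apply (is_lim_seq_of_bound _ (fun m => / INR (S m)) 0 (/ y ^ 2)); [|apply is_lim_seq_inv_INR_S].
  intros m. rewrite Rminus_0_r. unfold psi.
  pose proof (INR_S_ge_1 m). pose proof (INR_S_ge_1 n).
  set (x := INR (S m)) in *. set (t := INR (S n)) in *.
  assert (0 < y ^ 2) by nra. assert (0 < x ^ 2 * y ^ 2) by (apply Rmult_lt_0_compat; nra).
  assert (0 < x ^ 2 * y ^ 2 + t ^ 2) by nra.
  rewrite Rabs_pos_eq by (apply Rmult_le_pos; [lra|left; now apply Rinv_0_lt_compat]).
  rewrite <- Rinv_mult. replace (/ (y ^ 2 * x)) with (x / (x ^ 2 * y ^ 2)) by (field; nra).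
  apply Rmult_le_compat_l; [lra|]. apply Rinv_le_contravar; nra.
Qed.

Lemma ex_series_psi (x : R) : 1 <= x -> ex_series (fun n => psi x (INR (S n))).
Proof.
  intros Hx. apply (ex_series_dom _ (fun n => x * / INR (S n) ^ 2)).
  - intros n. unfold psi. pose proof (INR_S_ge_1 n). set (t := INR (S n)) in *.
    assert (0 <= x ^ 2 * y ^ 2) by (apply Rmult_le_pos; nra).
    rewrite Rabs_pos_eq by (apply Rmult_le_pos; [lra|left; apply Rinv_0_lt_compat; nra]).
    apply Rmult_le_compat_l; [lra|]. apply Rinv_le_contravar; nra.
  - apply (ex_series_Rscal x _ ex_series_inv_sqr).
Qed.

(* [psi x] is the decreasing derivative of [t |-> atan (t / (x y)) / y]. *)
Lemma Series_psi_bounds (x : R) : 1 <= x ->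
  PI / (2 * y) - / (x * y ^ 2) <= Series (fun n => psi x (INR (S n))) <= PI / (2 * y).
Proof.
  intros Hx. assert (Hxy : 0 < x * y) by nra. assert (Hy2 : 0 < y ^ 2) by nra.
  set (g := fun t => / y * atan (t / (x * y))).
  assert (Hg : forall t, is_derive g t (psi x t)).
  { intros t. unfold g, psi. auto_derive; auto. unfold Rsqr. field. repeat split; nra. }
  assert (Hdec : forall s t, 0 <= s <= t -> psi x t <= psi x s).
  { intros s t Hst. unfold psi. apply Rmult_le_compat_l; [lra|].
    apply Rinv_le_contravar; nra. }
  assert (Hmvt : forall t, 0 <= t -> psi x (t + 1) <= g (t + 1) - g t <= psi x t).
  { intros t Ht. destruct (MVT_gen g t (t + 1) (psi x)) as [z [Hz E]].
    - intros; apply Hg.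
    - intros w _. apply continuity_pt_filterlim, (ex_derive_continuous g). eexists; apply Hg.
    - rewrite Rmin_left, Rmax_right in Hz by lra. rewrite E.
      replace (t + 1 - t) with 1 by ring. rewrite Rmult_1_r. split; apply Hdec; lra. }
  assert (Hlim : is_lim_seq (fun n => g (INR n)) (PI / (2 * y))).
  { apply is_lim_seq_incr_1.
    apply (is_lim_seq_of_bound _ (fun n => / INR (S n)) _ (/ y * (x * y))); [|apply is_lim_seq_inv_INR_S].
    intros n. pose proof (INR_S_ge_1 n). set (t := INR (S n)) in *. unfold g.
    replace (t / (x * y)) with (/ (x * y / t)) by (field; lra).
    assert (Hp : 0 < x * y / t) by (apply Rdiv_lt_0_compat; lra).
    rewrite atan_inv by auto. destruct (Rabs_atan_le (x * y / t)) as [A1 A2]; [lra|].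
    replace (/ y * (PI / 2 - atan (x * y / t)) - PI / (2 * y)) with (- (/ y * atan (x * y / t)))
      by (field; lra).
    pose proof (Rinv_0_lt_compat y Hy).
    rewrite Rabs_Ropp, Rabs_pos_eq by (apply Rmult_le_pos; lra).
    rewrite Rmult_assoc. apply Rmult_le_compat_l; lra. }
  assert (T : forall k, is_series (fun n => g (INR (S n + k)) - g (INR (n + k)))
              (PI / (2 * y) - g (INR k))).
  { intros k. assert (H := is_lim_seq_telescope (fun n => g (INR (n + k))) (PI / (2 * y))
      (proj1 (is_lim_seq_incr_n _ k (Finite _)) Hlim)).
    apply (is_series_Rscal (-1)) in H.
    replace (PI / (2 * y) - g (INR k)) with (-1 * (g (INR (0 + k)) - PI / (2 * y)))
      by (unfold scal; simpl; unfold mult; simpl; ring).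
    eapply is_series_ext; [|exact H]. intros n. unfold scal; simpl; unfold mult; simpl. ring. }
  assert (g0 : g 0 = 0) by (unfold g; replace (0 / (x * y)) with 0 by (field; lra); rewrite atan_0; ring).
  assert (Hpos : forall n, 0 <= psi x (INR (S n))).
  { intros n. unfold psi. pose proof (INR_S_ge_1 n).
    apply Rmult_le_pos; [lra|left; apply Rinv_0_lt_compat; nra]. }
  split.
  - apply Rle_trans with (PI / (2 * y) - g (INR 1)).
    + enough (g (INR 1) <= / (x * y ^ 2)) by lra. unfold g. simpl (INR 1).
      destruct (Rabs_atan_le (1 / (x * y))) as [A1 A2].
      { left; apply Rdiv_lt_0_compat; lra. }
      replace (/ (x * y ^ 2)) with (/ y * (1 / (x * y))) by (field; lra).
      apply Rmult_le_compat_l; [left; now apply Rinv_0_lt_compat|auto].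
    + rewrite <- (is_series_unique _ _ (T 1%nat)). apply Series_le; [|apply ex_series_psi; auto].
      intros n. rewrite !Nat.add_1_r, (S_INR (S n)).
      pose proof (INR_S_ge_1 n).
      destruct (Hmvt (INR (S n))) as [M1 M2]; [lra|]. split; auto.
      eapply Rle_trans; [|exact M1]. rewrite <- S_INR. apply Hpos.
  - replace (PI / (2 * y)) with (PI / (2 * y) - g (INR 0)) by (simpl; rewrite g0; ring).
    rewrite <- (is_series_unique _ _ (T 0%nat)). apply Series_le; [|eexists; apply T].
    intros n. rewrite !Nat.add_0_r. split; auto. rewrite S_INR.
    apply Hmvt. apply pos_INR.
Qed.

(** As [x] grows, each single [psi x t] tends to 0, but their sum over [n] tends to [PI / (2 * y)].
    Hence the two orders of summation of [e] differ by this amount, which is the whole defect in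
    weight two. *)
Lemma is_series_e_cols :
  is_series (fun m => Series (e m)) (Series (fun n => psi 1 (INR (S n))) - PI / (2 * y)).
Proof.
  apply (is_series_ext (fun m => Series (fun n => psi (INR (S m)) (INR (S n)))
                               - Series (fun n => psi (INR (S (S m))) (INR (S n))))).
  { intros m. symmetry. apply Series_minus; apply ex_series_psi; apply INR_S_ge_1. }
  apply (is_lim_seq_telescope (fun m => Series (fun n => psi (INR (S m)) (INR (S n)))) (PI / (2 * y))).
  apply (is_lim_seq_of_bound _ (fun m => / INR (S m)) _ (/ y ^ 2)); [|apply is_lim_seq_inv_INR_S].
  intros m. pose proof (INR_S_ge_1 m). destruct (Series_psi_bounds (INR (S m))) as [B1 B2]; auto.
  assert (0 < / (INR (S m) * y ^ 2)) by (apply Rinv_0_lt_compat; nra).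
  rewrite <- Rinv_mult, (Rmult_comm (y ^ 2)). apply Rabs_le. lra.
Qed.

(** [c = e + d], where [d] has a product majorant and may be interchanged, while [e] telescopes and
    is summed explicitly in either order. *)
Lemma lattice_sum_2_exchange :
  ex_series (fun m => Series (c m)) /\
  Series (fun m => Series (c m)) =
  Series (fun n => Series (fun m => c m n)) - PI / (2 * y).
Proof.
  set (d := fun m n => c m n - e m n).
  assert (Hd : forall m n, Rabs (d m n) <= (4 * (1 + / y ^ 2) * / sqrt (INR (S m)) ^ 3) * / sqrt (INR (S n)) ^ 3)
    by exact lattice_term_approx.
  assert (Hu : ex_series (fun m => 4 * (1 + / y ^ 2) * / sqrt (INR (S m)) ^ 3))
    by apply (ex_series_Rscal _ _ ex_series_three_halves).
  assert (Hv := ex_series_three_halves).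
  assert (He : forall m, ex_series (e m)).
  { intros m. apply (ex_series_minus (K := R_AbsRing) (fun n => psi (INR (S m)) (INR (S n))));
      apply ex_series_psi; apply INR_S_ge_1. }
  assert (Ec : forall m n, c m n = e m n + d m n) by (intros; unfold d; ring).
  assert (R1 : forall m, Series (c m) = Series (e m) + Series (d m)).
  { intros m. rewrite <- Series_plus; auto.
    - apply Series_ext, Ec.
    - apply (ex_series_row d _ _ Hd); auto. }
  assert (R2 : forall n, Series (fun m => c m n) = psi 1 (INR (S n)) + Series (fun m => d m n)).
  { intros n. rewrite <- (is_series_unique _ _ (is_series_e_rows n)), <- Series_plus.
    - apply Series_ext. intros; apply Ec.
    - eexists; apply is_series_e_rows.
    - apply (ex_series_col d _ _ Hd); auto. }
  assert (Hrows := ex_series_rows d _ _ Hd Hu Hv).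
  split.
  - apply (ex_series_ext (fun m => plus (Series (e m)) (Series (d m)))).
    + intros m; symmetry; apply R1.
    + apply (ex_series_plus (K := R_AbsRing) (V := R_NormedModule) (fun m => Series (e m)) (fun m => Series (d m))); auto. eexists; apply is_series_e_cols.
  - rewrite (Series_ext _ _ R1), (Series_ext _ _ R2), !Series_plus; auto.
    + rewrite (is_series_unique _ _ is_series_e_cols), (Series_swap d _ _ Hd Hu Hv). ring.
    + apply ex_series_psi; lra.
    + eexists. apply (is_series_swap d _ _ Hd Hu Hv).
    + eexists; apply is_series_e_cols.
Qed.

End WeightTwo.

(** Only the lattice sum at [y] is exchanged; the one at [/ y] already appears in the other order
    through [lattice_sum_inv]. Thus the defect enters once and leaves the term [PI * y]. *)
Lemma eis_sum_1_inv (y : R) : 0 < y ->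
  4 * PI ^ 2 * (eis_sum 1 (/ y) + y ^ 2 * eis_sum 1 y) = zeta 2 * (1 + y ^ 2) - PI * y.
Proof.
  intros Hy. pose proof (Rinv_0_lt_compat y Hy) as Hy'.
  destruct (lattice_sum_2_exchange y Hy) as [X1 E1].
  destruct (lattice_sum_2_exchange (/ y) Hy') as [X2 _].
  assert (L1 := eis_sum_bilateral y Hy 0 X1). assert (L2 := eis_sum_bilateral (/ y) Hy' 0 X2).
  assert (HL := lattice_sum_inv 1 y Hy). unfold lattice_sum in HL. simpl (2 * 1)%nat in HL.
  rewrite HL in L2. rewrite E1 in L1.
  set (W := Series (fun m => Series (fun n => Re (inv_pow 2 (INR (S n) * y) (INR (S m)))))) in *.
  simpl fact in *. simpl (INR 1) in *.
  replace (4 * PI ^ 2 * (eis_sum 1 (/ y) + y ^ 2 * eis_sum 1 y)) with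
    ((2 * PI) ^ 2 * eis_sum 1 (/ y) + y ^ 2 * ((2 * PI) ^ 2 * eis_sum 1 y)) by ring.
  rewrite L1, L2. field. lra.
Qed.

(** * Zeta values and Bernoulli numbers *)

Lemma is_series_terms_bounded (a : nat -> R) (l : R) :
  is_series a l -> exists M, 0 < M /\ forall n, Rabs (a n) <= M.
Proof.
  intros H. assert (H0 := ex_series_lim_0 a (ex_intro _ l H)).
  apply is_lim_seq_spec in H0. destruct (H0 (mkposreal 1 Rlt_0_1)) as [N HN]. simpl in HN.
  assert (HB : forall N, exists M, 0 < M /\ forall n, (n < N)%nat -> Rabs (a n) <= M).
  { intros k. induction k as [|k [M [HM IH]]]; [exists 1; split; [lra|lia]|].
    exists (M + Rabs (a k)). pose proof (Rabs_pos (a k)). split; [lra|].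
    intros n Hn. destruct (Nat.eq_dec n k) as [->|]; [lra|].
    specialize (IH n ltac:(lia)). lra. }
  destruct (HB N) as [M [HM HMn]]. exists (M + 1). split; [lra|].
  intros n. destruct (Nat.lt_ge_cases n N) as [h|h].
  - specialize (HMn n h). lra.
  - specialize (HN n h). rewrite Rminus_0_r in HN. lra.
Qed.

(** Once the lower coefficients vanish, dividing by [x ^ n] gives [Rabs (a n) <= K * x] for all
    small positive [x]. A right neighbourhood of 0 is all that is at hand when the variable is
    [X = x ^ 2]. *)
Lemma power_series_zero (a : nat -> R) (d : R) : 0 < d ->
  (forall x, 0 < x < d -> is_series (fun n => a n * x ^ n) 0) -> forall n, a n = 0.
Proof.
  intros Hd H.
  destruct (is_series_terms_bounded _ _ (H (d / 2) ltac:(lra))) as [M [HM HMn]].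
  set (r := d / 2) in *. assert (Hr : 0 < r) by (unfold r; lra).
  intros n. induction n as [n IH] using (well_founded_induction lt_wf).
  set (K := 2 * (M / r ^ S n)).
  assert (Hrn : 0 < r ^ S n) by (apply pow_lt; auto).
  assert (HK : 0 < K) by (unfold K; assert (0 < M / r ^ S n) by (apply Rdiv_lt_0_compat; auto); lra).
  assert (Hs : forall x, 0 < x <= r / 2 -> Rabs (a n) <= K * x).
  { intros x Hx. assert (Hxd : 0 < x < d) by (unfold r in Hx; lra).
    assert (Hxn : 0 < x ^ n) by (apply pow_lt; lra).
    assert (Hex := ex_intro _ 0 (H x Hxd) : ex_series (fun n => a n * x ^ n)).
    assert (E := is_series_unique _ _ (H x Hxd)). rewrite (Series_split _ n Hex) in E.
    replace (sum_n (fun n => a n * x ^ n) n) with (a n * x ^ n) in E.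
    2:{ rewrite <- psum_sum_n. simpl. rewrite (psum_ext _ (fun _ => 0 * 0)), psum_scal; [ring|].
        intros k Hk. rewrite IH by auto. ring. }
    rewrite (Series_ext _ (fun k => x ^ S n * (a (S n + k)%nat * x ^ k))) in E.
    2:{ intros k. rewrite pow_add. ring. }
    rewrite Series_scal_l in E.
    assert (B : Rabs (Series (fun k => a (S n + k)%nat * x ^ k)) <= Series (fun k => M / r ^ S n * (/ 2) ^ k)).
    { apply Series_dom.
      - intros k. specialize (HMn (S n + k)%nat).
        rewrite Rabs_mult, (Rabs_pos_eq (_ ^ _)) in HMn by (apply pow_le; lra).
        rewrite Rabs_mult, (Rabs_pos_eq (_ ^ _)) by (apply pow_le; lra).
        assert (Hrk : 0 < r ^ k) by (apply pow_lt; auto).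
        apply Rle_trans with (Rabs (a (S n + k)%nat) * (r * / 2) ^ k).
        + apply Rmult_le_compat_l; [apply Rabs_pos|]. apply pow_incr. lra.
        + rewrite Rpow_mult_distr, <- Rmult_assoc.
          apply Rmult_le_compat_r; [apply pow_le; lra|].
          apply Rmult_le_reg_r with (r ^ S n); auto. unfold Rdiv.
          rewrite (Rmult_assoc M), Rinv_l by lra. rewrite pow_add in HMn. lra.
      - apply ex_series_Rscal. eexists. apply is_series_geom.
        rewrite Rabs_pos_eq; lra. }
    rewrite Series_scal_l, Series_geom in B by (rewrite Rabs_pos_eq; lra).
    replace (M / r ^ S n * / (1 - / 2)) with K in B by (unfold K; field; lra).
    set (s := Series (fun k => a (S n + k)%nat * x ^ k)) in *. simpl pow in E.
    assert (E2 : a n = - (x * s)) by nra.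
    rewrite E2, Rabs_Ropp, Rabs_mult, (Rabs_pos_eq x) by lra. nra. }
  destruct (Req_dec (a n) 0) as [|Hne]; auto. exfalso.
  assert (Ha : 0 < Rabs (a n)) by now apply Rabs_pos_lt.
  set (x := Rmin (r / 2) (Rabs (a n) / (2 * K))).
  assert (0 < Rabs (a n) / (2 * K)) by (apply Rdiv_lt_0_compat; lra).
  assert (Hx : 0 < x) by (apply Rmin_pos; lra).
  specialize (Hs x (conj Hx (Rmin_l _ _))).
  assert (x <= Rabs (a n) / (2 * K)) by apply Rmin_r.
  assert (K * x <= K * (Rabs (a n) / (2 * K))) by (apply Rmult_le_compat_l; lra).
  replace (K * (Rabs (a n) / (2 * K))) with (Rabs (a n) / 2) in * by (field; lra). lra.
Qed.

Lemma ex_series_odd_geom (X : R) : 0 < X < 1 -> ex_series (fun i => (2 * INR i + 1) * X ^ S i).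
Proof.
  intros HX. assert (Hl : 0 < - ln X) by (assert (ln X < ln 1) by (apply ln_increasing; lra); rewrite ln_1 in *; lra).
  apply (ex_series_dom _ (fun i => 2 * (INR (S i) ^ 1 * exp (- (- ln X * INR (S i)))))).
  - intros i. assert (0 < X ^ S i) by (apply pow_lt; lra). pose proof (pos_INR i).
    rewrite Rabs_pos_eq by (apply Rmult_le_pos; lra).
    replace (- (- ln X * INR (S i))) with (ln X * INR (S i)) by ring.
    rewrite <- exp_pow, exp_ln by lra. rewrite pow_1, <- Rmult_assoc.
    apply Rmult_le_compat_r; [lra|]. rewrite S_INR. lra.
  - apply (ex_series_Rscal 2 _ (ex_series_pow_exp 1 _ Hl)).
Qed.

Lemma ex_series_odd_geom' (v X : R) : 0 < X < 1 -> Rabs v <= X -> ex_series (fun i => (2 * INR i + 1) * v ^ i).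
Proof.
  intros HX Hv. apply (ex_series_dom _ (fun i => / X * ((2 * INR i + 1) * X ^ S i))).
  - intros i. pose proof (pos_INR i). rewrite Rabs_mult, Rabs_pos_eq by lra.
    rewrite <- RPow_abs. simpl pow.
    replace (/ X * ((2 * INR i + 1) * (X * X ^ i))) with ((2 * INR i + 1) * X ^ i) by (field; lra).
    apply Rmult_le_compat_l; [lra|]. apply pow_incr. split; auto. apply Rabs_pos.
  - apply (ex_series_Rscal _ _ (ex_series_odd_geom X HX)).
Qed.

(** With [v = - (x / m) ^ 2], the expression [v (1 + v) / (1 - v) ^ 2] is [x ^ 2] times the [m]-th
    partial fraction of [inv_sinh2_partial_fractions]. *)
Lemma Series_odd_geom (v X : R) : 0 < X < 1 -> Rabs v <= X ->
  Series (fun i => (2 * INR i + 1) * v ^ i) = (1 + v) / (1 - v) ^ 2.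
Proof.
  intros HX Hv. assert (Hex := ex_series_odd_geom' v X HX Hv).
  assert (Hv1 : Rabs v < 1) by lra. assert (v < 1) by (apply Rabs_def2 in Hv1; lra).
  assert (E := Series_head _ Hex). cbv beta in E.
  rewrite (Series_ext (fun n => (2 * INR (S n) + 1) * v ^ S n)
      (fun n => v * ((2 * INR n + 1) * v ^ n) + 2 * v * v ^ n)) in E.
  2:{ intros n. rewrite S_INR. simpl pow. ring. }
  rewrite Series_plus, !Series_scal_l, Series_geom in E; auto.
  - set (s := Series _) in *. simpl in E.
    assert (E2 : s * (1 - v) = (1 + v) / (1 - v)).
    { replace (s * (1 - v)) with (s - v * s) by ring. rewrite E at 1. field. lra. }
    apply Rmult_eq_reg_r with (1 - v); [|lra]. rewrite E2. field. lra.
  - apply (ex_series_Rscal v _ Hex).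
  - apply (ex_series_Rscal (2 * v) (fun n => v ^ n)). eexists. now apply is_series_geom.
Qed.

(* Coefficients in [X = x ^ 2] of [(pi x / sinh (pi x)) ^ 2]. *)
Definition csch_coef (n : nat) : R :=
  match n with O => 1 | S i => 2 * (-1) ^ S i * (2 * INR i + 1) * zeta (2 * S i) end.

(* Coefficients in [X = x ^ 2] of [(sinh (pi x) / (pi x)) ^ 2]. *)
Definition sinh_coef (l : nat) : R := 2 * (2 * PI) ^ (2 * l) / INR (fact (2 * l + 2)).

Lemma csch_term_bound (x : R) (m i : nat) : 0 < x < 1 ->
  Rabs ((-1) ^ S i * (2 * INR i + 1) * (x ^ 2) ^ S i * / INR (S m) ^ (2 * S i)) <=
  / INR (S m) ^ 2 * ((2 * INR i + 1) * (x ^ 2) ^ S i).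
Proof.
  intros Hx. pose proof (pos_INR i). pose proof (INR_S_ge_1 m).
  assert (0 < (x ^ 2) ^ S i) by (apply pow_lt; nra).
  rewrite !Rabs_mult, pow_1_abs, Rmult_1_l, (Rabs_pos_eq (2 * INR i + 1)), (Rabs_pos_eq (_ ^ S i)) by lra.
  rewrite Rmult_comm. apply Rmult_le_compat_r; [apply Rmult_le_pos; lra|].
  rewrite Rabs_pos_eq by (left; apply Rinv_0_lt_compat, pow_lt; lra).
  apply Rinv_le_contravar; [apply pow_lt; lra|]. apply Rle_pow; auto. lia.
Qed.

(** Each partial fraction is expanded in powers of [x ^ 2]; after the interchange, the sums over [m]
    are the zeta values in [csch_coef]. *)
Lemma is_series_csch_coef (x : R) : 0 < x < 1 ->
  is_series (fun n => csch_coef n * (x ^ 2) ^ n)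
   (x ^ 2 * (4 * PI ^ 2 * (exp (- (2 * PI * x)) / (1 - exp (- (2 * PI * x))) ^ 2))).
Proof.
  intros Hx. rewrite inv_sinh2_partial_fractions by lra.
  set (Y := Series (fun m => (x ^ 2 - INR (S m) ^ 2) / (x ^ 2 + INR (S m) ^ 2) ^ 2)).
  assert (HX : 0 < x ^ 2 < 1) by nra.
  assert (HB := fun m i => csch_term_bound x m i Hx).
  assert (Hsw := is_series_swap _ _ _ HB ex_series_inv_sqr (ex_series_odd_geom (x ^ 2) HX)).
  cbv beta in Hsw.
  replace (Series (fun m => Series (fun i => (-1) ^ S i * (2 * INR i + 1) * (x ^ 2) ^ S i * / INR (S m) ^ (2 * S i))))
    with (x ^ 2 * Y) in Hsw.
  - replace (x ^ 2 * (/ x ^ 2 + 2 * Y)) with (plus (2 * (x ^ 2 * Y)) 1)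
      by (unfold plus; simpl; field; lra).
    replace 1 with (csch_coef 0 * (x ^ 2) ^ 0) at 2 by (simpl; ring).
    apply (is_series_decr_1 (V := R_NormedModule)).
    match goal with |- is_series _ ?l => replace l with (2 * (x ^ 2 * Y))
      by (unfold plus, opp; simpl; ring) end.
    apply (is_series_Rscal 2) in Hsw. eapply is_series_ext; [|exact Hsw].
    intros i. unfold csch_coef, zeta.
    rewrite Series_scal_l. simpl. ring.
  - unfold Y. rewrite <- Series_scal_l. apply Series_ext. intros m.
    pose proof (INR_S_ge_1 m). set (t := INR (S m)) in *.
    rewrite (Series_ext _ (fun i => - (x ^ 2 / t ^ 2) * ((2 * INR i + 1) * (- (x ^ 2 / t ^ 2)) ^ i))).
    + rewrite Series_scal_l, (Series_odd_geom _ (x ^ 2)); auto.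
      * field. repeat split; nra.
      * rewrite Rabs_Ropp. assert (0 < / t ^ 2 <= 1).
        { split; [apply Rinv_0_lt_compat; nra|]. rewrite <- Rinv_1. apply Rinv_le_contravar; nra. }
        rewrite Rabs_pos_eq by (unfold Rdiv; nra). unfold Rdiv; nra.
    + intros i. replace (- (x ^ 2 / t ^ 2)) with ((-1) * (x ^ 2) * / t ^ 2) by (unfold Rdiv; ring).
      rewrite !Rpow_mult_distr, pow_inv, pow_mult. simpl. field. split; [apply pow_nonzero; nra|lra].
Qed.

Lemma is_series_even (b : nat -> R) (l : R) :
  (forall n, b (2 * n + 1)%nat = 0) -> is_series b l -> is_series (fun n => b (2 * n)%nat) l.
Proof.
  intros Hb H. change (is_lim_seq (sum_n b) l) in H.
  change (is_lim_seq (sum_n (fun n => b (2 * n)%nat)) l).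
  apply (is_lim_seq_ext (fun n => sum_n b (2 * n))).
  - intros n. induction n as [|n IH]; [now rewrite !sum_O|].
    rewrite sum_Sn, <- IH. replace (2 * S n)%nat with (S (S (2 * n))) by lia.
    rewrite !sum_Sn. replace (S (2 * n)) with (2 * n + 1)%nat by lia. rewrite Hb.
    unfold plus; simpl. ring.
  - apply (is_lim_seq_subseq (sum_n b) l (fun n => (2 * n)%nat)); auto.
    apply eventually_subseq. intros; lia.
Qed.

(** With [t = 2 * PI * x] the sum is [(exp t + exp (- t) - 2) / t ^ 2]: in the two exponential
    series the odd terms cancel, and the constant term is removed. *)
Lemma is_series_sinh_coef (x : R) : 0 < x ->
  is_series (fun n => sinh_coef n * (x ^ 2) ^ n)
    ((1 - exp (- (2 * PI * x))) ^ 2 / (exp (- (2 * PI * x)) * (4 * PI ^ 2 * x ^ 2))).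
Proof.
  intros Hx. pose proof PI_RGT_0. set (t := 2 * PI * x). assert (Ht : 0 < t) by (unfold t; nra).
  assert (HS : is_series (fun n => (t ^ n + (- t) ^ n) / INR (fact n)) (exp t + exp (- t))).
  { assert (H1 := is_exp_Reals t). assert (H2 := is_exp_Reals (- t)).
    unfold is_pseries in H1, H2. eapply is_series_ext; [|apply (is_series_plus _ _ _ _ H1 H2)].
    intros n. rewrite !pow_n_pow.
    change (t ^ n * / INR (fact n) + (- t) ^ n * / INR (fact n) = (t ^ n + (- t) ^ n) / INR (fact n)).
    unfold Rdiv. ring. }
  apply is_series_even in HS.
  2:{ intros n. replace ((- t) ^ (2 * n + 1)) with (- t ^ (2 * n + 1)).
      - unfold Rdiv. ring.
      - replace (- t) with ((-1) * t) by ring. rewrite Rpow_mult_distr, (pow_add (-1)), pow_1_even. ring. }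
  assert (HS2 : is_series (fun n => 2 * t ^ (2 * n + 2) / INR (fact (2 * n + 2))) (exp t + exp (- t) - 2)).
  { apply (is_series_ext (fun n => (t ^ (2 * S n) + (- t) ^ (2 * S n)) / INR (fact (2 * S n)))).
    - intros n. replace (2 * S n)%nat with (2 * n + 2)%nat by lia.
      replace ((- t) ^ (2 * n + 2)) with (t ^ (2 * n + 2)).
      + match goal with |- ?a = ?b => change (@eq R a b) end. field. apply INR_fact_neq_0.
      + replace (2 * n + 2)%nat with (2 * S n)%nat by lia. rewrite !pow_mult. f_equal. ring.
    - apply (is_series_incr_1 (V := R_NormedModule) (fun n => (t ^ (2 * n) + (- t) ^ (2 * n)) / INR (fact (2 * n)))).
      match goal with |- is_series _ ?l => replace l with (exp t + exp (- t))
        by (unfold plus; simpl; field) end. exact HS. }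
  apply (is_series_Rscal (/ t ^ 2)) in HS2.
  match type of HS2 with is_series _ ?l =>
    replace l with ((1 - exp (- t)) ^ 2 / (exp (- t) * (4 * PI ^ 2 * x ^ 2))) in HS2 end.
  - eapply is_series_ext; [|exact HS2]. intros n. unfold sinh_coef.
    rewrite pow_add. unfold t. rewrite !Rpow_mult_distr, !pow_mult.
    match goal with |- ?a = ?b => change (@eq R a b) end. field. split; [apply INR_fact_neq_0|lra].
  - rewrite (exp_Ropp t). pose proof (exp_pos t).
    unfold t in *. field. repeat split; lra.
Qed.

(** The two power series are inverse to each other, so all coefficients of their Cauchy product
    after the constant one vanish. Solving for the last term yields a recursion that evaluates the
    even zeta values. *)
Lemma csch_coef_rec (n : nat) :
  csch_coef (S n) = - sum_f_R0 (fun k => csch_coef k * sinh_coef (S n - k)) n.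
Proof.
  set (c := fun n => sum_f_R0 (fun k => csch_coef k * sinh_coef (n - k)) n).
  assert (H : forall n, c n - (if Nat.eqb n 0 then 1 else 0) = 0).
  { apply (power_series_zero _ 1); [lra|]. intros X HX.
    set (x := sqrt X). assert (EX : x ^ 2 = X) by (apply pow2_sqrt; lra).
    assert (Hx : 0 < x < 1).
    { split; [apply sqrt_lt_R0; lra|]. unfold x. rewrite <- sqrt_1. apply sqrt_lt_1_alt. lra. }
    assert (H1 := is_series_csch_coef x Hx). assert (H2 := is_series_sinh_coef x ltac:(lra)).
    rewrite EX in H1, H2. pose proof PI_RGT_0.
    assert (Hd : exp (- (2 * PI * x)) < 1) by (apply exp_neg_lt_1; nra).
    pose proof (exp_pos (- (2 * PI * x))).
    assert (Habs1 : ex_series (fun n => Rabs (csch_coef n * X ^ n))).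
    { apply (ex_series_dom _ (fun n => match n with O => 1 | S i => 2 * Series (fun m => / INR (S m) ^ 2) * ((2 * INR i + 1) * X ^ S i) end)).
      - intros [|i]; rewrite Rabs_Rabsolu; [simpl; rewrite Rabs_pos_eq; lra|].
        unfold csch_coef. pose proof (pos_INR i). assert (0 < X ^ S i) by (apply pow_lt; lra).
        rewrite !Rabs_mult, pow_1_abs, (Rabs_pos_eq 2), (Rabs_pos_eq (2 * INR i + 1)), (Rabs_pos_eq (X ^ _)) by lra.
        assert (Hz : Rabs (zeta (2 * S i)) <= Series (fun m => / INR (S m) ^ 2)).
        { apply Series_dom; [|apply ex_series_inv_sqr]. intros m. pose proof (INR_S_ge_1 m).
          rewrite Rabs_pos_eq by (left; apply Rinv_0_lt_compat, pow_lt; lra).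
          apply Rinv_le_contravar; [apply pow_lt; lra|]. apply Rle_pow; auto. lia. }
        pose proof (Rabs_pos (zeta (2 * S i))).
        replace (2 * Series (fun m => / INR (S m) ^ 2) * ((2 * INR i + 1) * X ^ S i)) with
          (2 * (2 * INR i + 1) * X ^ S i * Series (fun m => / INR (S m) ^ 2)) by ring.
        replace (2 * 1 * (2 * INR i + 1) * Rabs (zeta (2 * S i)) * X ^ S i) with
          (2 * (2 * INR i + 1) * X ^ S i * Rabs (zeta (2 * S i))) by ring.
        apply Rmult_le_compat_l; auto. apply Rmult_le_pos; lra.
      - apply ex_series_incr_1. apply (ex_series_Rscal _ _ (ex_series_odd_geom X HX)). }
    assert (Habs2 : ex_series (fun n => Rabs (sinh_coef n * X ^ n))).
    { eexists. eapply is_series_ext; [|exact H2]. intros i. symmetry. apply Rabs_pos_eq.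
      apply Rmult_le_pos; [|apply pow_le; lra]. unfold sinh_coef.
      apply Rmult_le_pos; [apply Rmult_le_pos; [lra|apply pow_le; lra]|].
      left. apply Rinv_0_lt_compat, INR_fact_lt_0. }
    assert (HP := is_series_mult _ _ _ _ H1 H2 Habs1 Habs2).
    match type of HP with is_series _ ?l => replace l with 1 in HP end.
    2:{ field. repeat split; lra. }
    assert (HD : is_series (fun n => (if Nat.eqb n 0 then 1 else 0) * X ^ n) 1).
    { assert (HF := is_series_finite (fun n => (if Nat.eqb n 0 then 1 else 0) * X ^ n) 1).
      simpl psum in HF. replace (0 + 1 * 1) with 1 in HF by ring. apply HF.
      intros [|i] Hi; [lia|]. simpl. ring. }
    assert (HM := is_series_minus _ _ _ _ HP HD).
    match type of HM with is_series _ ?l =>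
      replace l with 0 in HM by (unfold minus, plus, opp; simpl; ring) end.
    eapply is_series_ext; [|exact HM].
    intros n0. unfold minus, plus, opp; simpl. unfold c.
    rewrite Rmult_minus_distr_r. unfold Rminus. f_equal. rewrite Rmult_comm, scal_sum.
    apply sum_eq. intros k Hk.
    assert (EXn : X ^ n0 = X ^ k * X ^ (n0 - k)) by (rewrite <- pow_add; f_equal; lia).
    rewrite EXn. ring. }
  specialize (H (S n)). unfold c in H. simpl Nat.eqb in H. rewrite tech5, Nat.sub_diag in H.
  replace (sinh_coef 0) with 1 in H; [lra|]. unfold sinh_coef. simpl. field.
Qed.

Lemma sinh_coef_S (l : nat) :
  sinh_coef (S l) = sinh_coef l * (4 * PI ^ 2 / (INR (2 * l + 3) * INR (2 * l + 4))).
Proof.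
  unfold sinh_coef. replace (2 * S l + 2)%nat with (S (S (2 * l + 2))) by lia.
  replace (2 * S l)%nat with (2 * l + 2)%nat by lia.
  rewrite !fact_simpl, !mult_INR, pow_add.
  replace (S (S (2 * l + 2))) with (2 * l + 4)%nat by lia.
  replace (S (2 * l + 2)) with (2 * l + 3)%nat by lia.
  field. repeat split; try apply INR_fact_neq_0; apply not_0_INR; lia.
Qed.

Lemma sinh_coef_values :
  sinh_coef 0 = 1 /\ sinh_coef 1 = / 3 * PI ^ 2 /\ sinh_coef 2 = 2 / 45 * PI ^ 4 /\
  sinh_coef 3 = / 315 * PI ^ 6 /\ sinh_coef 4 = 2 / 14175 * PI ^ 8 /\
  sinh_coef 5 = 2 / 467775 * PI ^ 10 /\ sinh_coef 6 = 4 / 42567525 * PI ^ 12 /\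
  sinh_coef 7 = / 638512875 * PI ^ 14.
Proof.
  assert (E0 : sinh_coef 0 = 1) by (unfold sinh_coef; simpl; field).
  repeat split; auto; rewrite ?sinh_coef_S, E0, ?INR_IZR_INZ; simpl Z.of_nat; field.
Qed.

Lemma csch_coef_values :
  csch_coef 1 = - / 3 * PI ^ 2 /\ csch_coef 2 = / 15 * PI ^ 4 /\
  csch_coef 3 = - 2 / 189 * PI ^ 6 /\ csch_coef 4 = / 675 * PI ^ 8 /\
  csch_coef 5 = - 2 / 10395 * PI ^ 10 /\ csch_coef 6 = 1382 / 58046625 * PI ^ 12 /\
  csch_coef 7 = - 4 / 1403325 * PI ^ 14.
Proof.
  destruct sinh_coef_values as (E0 & E1 & E2 & E3 & E4 & E5 & E6 & E7).
  assert (D0 : csch_coef 0 = 1) by reflexivity.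
  assert (D1 : csch_coef 1 = - / 3 * PI ^ 2).
  { rewrite csch_coef_rec. cbn [sum_f_R0 Nat.sub]. rewrite D0, E1. field. }
  assert (D2 : csch_coef 2 = / 15 * PI ^ 4).
  { rewrite csch_coef_rec. cbn [sum_f_R0 Nat.sub]. rewrite D0, D1, E1, E2. field. }
  assert (D3 : csch_coef 3 = - 2 / 189 * PI ^ 6).
  { rewrite csch_coef_rec. cbn [sum_f_R0 Nat.sub]. rewrite D0, D1, D2, E1, E2, E3. field. }
  assert (D4 : csch_coef 4 = / 675 * PI ^ 8).
  { rewrite csch_coef_rec. cbn [sum_f_R0 Nat.sub]. rewrite D0, D1, D2, D3, E1, E2, E3, E4. field. }
  assert (D5 : csch_coef 5 = - 2 / 10395 * PI ^ 10).
  { rewrite csch_coef_rec. cbn [sum_f_R0 Nat.sub].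
    rewrite D0, D1, D2, D3, D4, E1, E2, E3, E4, E5. field. }
  assert (D6 : csch_coef 6 = 1382 / 58046625 * PI ^ 12).
  { rewrite csch_coef_rec. cbn [sum_f_R0 Nat.sub].
    rewrite D0, D1, D2, D3, D4, D5, E1, E2, E3, E4, E5, E6. field. }
  assert (D7 : csch_coef 7 = - 4 / 1403325 * PI ^ 14).
  { rewrite csch_coef_rec. cbn [sum_f_R0 Nat.sub].
    rewrite D0, D1, D2, D3, D4, D5, D6, E1, E2, E3, E4, E5, E6, E7. field. }
  repeat split; assumption.
Qed.

Lemma zeta_csch_coef (i : nat) : zeta (2 * S i) = (-1) ^ S i * csch_coef (S i) / (2 * (2 * INR i + 1)).
Proof.
  unfold csch_coef. assert (E := sqr_pow_m1 (S i)).
  pose proof (pos_INR i).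
  replace ((-1) ^ S i * (2 * (-1) ^ S i * (2 * INR i + 1) * zeta (2 * S i))) with
    ((-1) ^ S i * (-1) ^ S i * (2 * (2 * INR i + 1)) * zeta (2 * S i)) by ring.
  rewrite E. field. lra.
Qed.

Lemma zeta_values :
  zeta 2 = PI ^ 2 / 6 /\ zeta 4 = PI ^ 4 / 90 /\ zeta 6 = PI ^ 6 / 945 /\ zeta 8 = PI ^ 8 / 9450 /\
  zeta 10 = PI ^ 10 / 93555 /\ zeta 14 = 2 / 18243225 * PI ^ 14.
Proof.
  destruct csch_coef_values as (D1 & D2 & D3 & D4 & D5 & D6 & D7).
  repeat split.
  - change (zeta 2) with (zeta (2 * 1)). rewrite (zeta_csch_coef 0), D1, INR_IZR_INZ. simpl Z.of_nat. field.
  - change (zeta 4) with (zeta (2 * 2)). rewrite (zeta_csch_coef 1), D2, INR_IZR_INZ. simpl Z.of_nat. field.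
  - change (zeta 6) with (zeta (2 * 3)). rewrite (zeta_csch_coef 2), D3, INR_IZR_INZ. simpl Z.of_nat. field.
  - change (zeta 8) with (zeta (2 * 4)). rewrite (zeta_csch_coef 3), D4, INR_IZR_INZ. simpl Z.of_nat. field.
  - change (zeta 10) with (zeta (2 * 5)). rewrite (zeta_csch_coef 4), D5, INR_IZR_INZ. simpl Z.of_nat. field.
  - change (zeta 14) with (zeta (2 * 7)). rewrite (zeta_csch_coef 6), D7, INR_IZR_INZ. simpl Z.of_nat. field.
Qed.

(** Integer binomials, which [vm_compute] can evaluate inside the Bernoulli recursion. *)
Fixpoint binomialZ (n k : nat) : Z :=
  match n, k with
  | _, O => 1
  | O, S _ => 0
  | S n, S k => binomialZ n k + binomialZ n (S k)
  end%Z.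

Lemma binomialZ_gt (n k : nat) : (n < k)%nat -> binomialZ n k = 0%Z.
Proof.
  revert k. induction n as [|n IH]; intros [|k] H; try lia; [reflexivity|].
  simpl. rewrite !IH by lia. reflexivity.
Qed.

Lemma binomial_binomialZ (n k : nat) : (k <= n)%nat -> Binomial.C n k = IZR (binomialZ n k).
Proof.
  assert (C0 : forall n, Binomial.C n 0 = 1).
  { intros m. unfold Binomial.C. rewrite Nat.sub_0_r. simpl. field. apply INR_fact_neq_0. }
  assert (Cn : forall n, Binomial.C n n = 1).
  { intros m. unfold Binomial.C. rewrite Nat.sub_diag. simpl. field. apply INR_fact_neq_0. }
  revert k. induction n as [|n IH]; intros [|k] H; try lia; [apply C0|rewrite C0; reflexivity|].
  simpl binomialZ. destruct (Nat.eq_dec k n) as [->|Hk].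
  - rewrite Cn, (binomialZ_gt n (S n)), Z.add_0_r, <- IH, Cn by lia. reflexivity.
  - rewrite <- Binomial.pascal, plus_IZR, !IH by lia. reflexivity.
Qed.

(** The recursion over the reals does not reduce to a numeral, so each new entry is proposed and
    then checked by one linear identity. *)
Lemma bernoulli_upto_14 : bernoulli_upto 14 =
  [1; -1/2; 1/6; 0; -1/30; 0; 1/42; 0; -1/30; 0; 5/66; 0; -691/2730; 0; 7/6].
Proof.
  assert (Hs : forall m l x, bernoulli_upto m = l ->
     - sum_f_R0 (fun i => IZR (binomialZ (m + 2) i) * nth i l 0) m / IZR (Z.of_nat (m + 2)) = x ->
     bernoulli_upto (S m) = l ++ [x]).
  { intros m l x <- <-. simpl. rewrite INR_IZR_INZ. do 4 f_equal. apply sum_eq.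
    intros i Hi. rewrite binomial_binomialZ by lia. reflexivity. }
  assert (L0 : bernoulli_upto 0 = [1]) by reflexivity.
  Ltac bern_step m L v H :=
    let l := match type of L with _ = ?l => l end in
    assert (H : bernoulli_upto (S m) = l ++ [v])
    by (match goal with Hs : _ |- _ => apply (Hs m l v L) end; cbn -[IZR Rmult Rplus Ropp Rdiv binomialZ Z.of_nat];
        repeat match goal with |- context [binomialZ ?a ?b] =>
          let v := eval vm_compute in (binomialZ a b) in change (binomialZ a b) with v end;
        simpl Z.of_nat; lra);
    cbn [app] in H.
  bern_step 0%nat L0 (-1/2) L1. bern_step 1%nat L1 (1/6) L2. bern_step 2%nat L2 0 L3.
  bern_step 3%nat L3 (-1/30) L4. bern_step 4%nat L4 0 L5. bern_step 5%nat L5 (1/42) L6.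
  bern_step 6%nat L6 0 L7. bern_step 7%nat L7 (-1/30) L8. bern_step 8%nat L8 0 L9.
  bern_step 9%nat L9 (5/66) L10. bern_step 10%nat L10 0 L11. bern_step 11%nat L11 (-691/2730) L12.
  bern_step 12%nat L12 0 L13. bern_step 13%nat L13 (7/6) L14. exact L14.
Qed.

Lemma nth_bernoulli_upto (n m : nat) : (n <= m)%nat -> nth n (bernoulli_upto m) 0 = bernoulli n.
Proof.
  intros H. induction H as [|m H IH]; [reflexivity|]. rewrite <- IH. simpl.
  apply app_nth1.
  assert (Hl : forall k, length (bernoulli_upto k) = S k).
  { intros k. induction k as [|k IHk]; [reflexivity|]. simpl. rewrite length_app, IHk. simpl. lia. }
  rewrite Hl. lia.
Qed.

(* The constant term [1] of [E_2j] is its constant term [2 zeta (2 j)] as a lattice sum, rescaled. *)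
Lemma eisenstein_constant (j : nat) : In j [2; 3; 4; 5; 7]%nat ->
  0 < - (-1) ^ j * bernoulli (2 * j) /\
  INR (4 * j) / bernoulli (2 * j) * (INR (fact (2 * j - 1)) * zeta (2 * j)) = - (-1) ^ j * (2 * PI) ^ (2 * j).
Proof.
  intros Hj. pose proof PI_RGT_0.
  destruct zeta_values as (_ & Z4 & Z6 & Z8 & Z10 & Z14).
  assert (HB : forall n l, (n <= 14)%nat -> bernoulli_upto 14 = l -> bernoulli n = nth n l 0)
    by (intros n l Hn <-; symmetry; now apply nth_bernoulli_upto).
  assert (HF : forall n, INR (fact (S n)) = INR (S n) * INR (fact n))
    by (intros; rewrite fact_simpl, mult_INR; reflexivity).
  assert (F3 : INR (fact 3) = 6) by (simpl; ring).
  assert (F5 : INR (fact 5) = 120) by (do 2 rewrite HF; rewrite F3, !INR_IZR_INZ; simpl Z.of_nat; ring).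
  assert (F7 : INR (fact 7) = 5040) by (do 2 rewrite HF; rewrite F5, !INR_IZR_INZ; simpl Z.of_nat; ring).
  assert (F9 : INR (fact 9) = 362880) by (do 2 rewrite HF; rewrite F7, !INR_IZR_INZ; simpl Z.of_nat; ring).
  assert (F13 : INR (fact 13) = 6227020800) by (do 4 rewrite HF; rewrite F9, !INR_IZR_INZ; simpl Z.of_nat; ring).
  assert (HB14 := fun n Hn => HB n _ Hn bernoulli_upto_14). clear HB.
  simpl in Hj. destruct Hj as [<-|[<-|[<-|[<-|[<-|[]]]]]]; rewrite HB14 by lia.
  - change (2 * 2 - 1)%nat with 3%nat. change (2 * 2)%nat with 4%nat. rewrite Z4, F3, INR_IZR_INZ. simpl Z.of_nat.
    cbn [nth]. split; [lra|]. field; lra.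
  - change (2 * 3 - 1)%nat with 5%nat. change (2 * 3)%nat with 6%nat. rewrite Z6, F5, INR_IZR_INZ. simpl Z.of_nat.
    cbn [nth]. split; [lra|]. field; lra.
  - change (2 * 4 - 1)%nat with 7%nat. change (2 * 4)%nat with 8%nat. rewrite Z8, F7, INR_IZR_INZ. simpl Z.of_nat.
    cbn [nth]. split; [lra|]. field; lra.
  - change (2 * 5 - 1)%nat with 9%nat. change (2 * 5)%nat with 10%nat. rewrite Z10, F9, INR_IZR_INZ. simpl Z.of_nat.
    cbn [nth]. split; [lra|]. field; lra.
  - change (2 * 7 - 1)%nat with 13%nat. change (2 * 7)%nat with 14%nat. rewrite Z14, F13, INR_IZR_INZ. simpl Z.of_nat.
    cbn [nth]. split; [lra|]. field; lra.
Qed.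

(** * The forms [Delta_k] on the imaginary axis *)

Definition eis_factor (j : nat) : R := INR (4 * j) / bernoulli (2 * j).

Definition eis (j : nat) (y : R) : R :=
  match j with O => 1 | _ => 1 - eis_factor j * eis_sum (2 * j - 1) y end.

(** By [eisenstein_constant], the zeta term left over in [eis_sum_inv] is exactly what the constant
    term 1 needs in order to transform with the same weight. *)
Lemma eis_inv (j : nat) (y : R) : 0 < y -> In j [0; 2; 3; 4; 5; 7]%nat ->
  eis j (/ y) = (-1) ^ j * y ^ (2 * j) * eis j y.
Proof.
  intros Hy Hj. destruct (Nat.eq_dec j 0) as [->|Hj0]; [simpl; ring|].
  assert (Hj' : In j [2; 3; 4; 5; 7]%nat) by (destruct Hj; [congruence|auto]).
  assert (Hj2 : (2 <= j)%nat) by (simpl in Hj'; lia).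
  destruct (eisenstein_constant j Hj') as [_ HC]. assert (H := eis_sum_inv j y Hy Hj2).
  pose proof PI_RGT_0. assert (HP : 0 < (2 * PI) ^ (2 * j)) by (apply pow_lt; lra).
  assert (E1 := sqr_pow_m1 j).
  fold (eis_factor j) in HC.
  assert (HE : forall w, eis j w = 1 - eis_factor j * eis_sum (2 * j - 1) w) by (intros; destruct j; [lia|reflexivity]).
  rewrite !HE.
  set (P := (2 * PI) ^ (2 * j)) in *. set (s := (-1) ^ j) in *. set (Y := y ^ (2 * j)) in *.
  set (A := eis_sum (2 * j - 1) (/ y)) in *. set (B := eis_sum (2 * j - 1) y) in *.
  apply Rmult_eq_reg_l with P; [|lra].
  assert (E : P * (eis_factor j * A - s * Y * (eis_factor j * B)) = - s * P * (Y - s)).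
  { rewrite <- HC. replace (P * (eis_factor j * A - s * Y * (eis_factor j * B)))
      with (eis_factor j * (P * (A - s * Y * B))) by ring. rewrite H. ring. }
  nra.
Qed.

Lemma ex_Series_bound_term (r : nat) (y : R) (m : nat) : 0 < y ->
  0 <= lipschitz_sum r (INR (S m) * y) <=
  exp (- (PI * y * INR (S m))) * Series (fun n => INR (S n) ^ r * exp (- (PI * y * INR (S n)))).
Proof.
  intros Hy. pose proof PI_RGT_0. assert (0 < PI * y) by nra. pose proof (INR_S_ge_1 m). split.
  - apply Series_nonneg; [apply ex_lipschitz_sum; nra|]. intros n. pose proof (INR_S_ge_1 n).
    apply Rmult_le_pos; [apply pow_le; lra|left; apply exp_pos].
  - rewrite <- Series_scal_l. eapply Rle_trans; [apply Rle_abs|]. apply Series_dom.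
    + intros n. assert (HB := eis_term_bound r y m n Hy). rewrite pow_O, Rmult_1_l in HB. exact HB.
    + apply ex_series_Rscal, ex_series_pow_exp; auto.
Qed.

Lemma lipschitz_sum_decreasing (r : nat) (x y : R) : 0 < x <= y -> lipschitz_sum r y <= lipschitz_sum r x.
Proof.
  intros Hxy. pose proof PI_RGT_0. apply Series_le; [|apply ex_lipschitz_sum; lra].
  intros n. pose proof (INR_S_ge_1 n). assert (0 <= INR (S n) ^ r) by (apply pow_le; lra).
  split; [apply Rmult_le_pos; auto; left; apply exp_pos|].
  apply Rmult_le_compat_l; auto. apply exp_le. assert (0 < PI * INR (S n)) by nra. nra.
Qed.

Lemma ex_derive_eis_sum (r : nat) (y : R) : 0 < y -> ex_derive (eis_sum r) y.
Proof.
  intros Hy. pose proof PI_RGT_0. eexists.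
  apply (is_derive_Series (fun m y => lipschitz_sum r (INR (S m) * y))
    (fun m y => INR (S m) * (- (2 * PI) * lipschitz_sum (S r) (INR (S m) * y)))
    (fun m => 2 * PI * Series (fun n => INR (S n) ^ S r * exp (- (PI * (y / 2) * INR (S n)))) *
              (INR (S m) ^ 1 * exp (- (PI * (y / 2) * INR (S m))))) (y / 2)); try lra.
  - intros m z Hz. pose proof (INR_S_ge_1 m).
    apply (is_derive_comp (lipschitz_sum r) (fun z => INR (S m) * z)).
    + apply is_derive_lipschitz_sum. nra.
    + set (t := INR (S m)). auto_derive; auto. ring.
  - intros m z Hz. pose proof (INR_S_ge_1 m).
    destruct (ex_Series_bound_term (S r) (y / 2) m) as [_ HB]; [lra|].
    destruct (ex_Series_bound_term (S r) z m) as [Hnn _]; [lra|].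
    assert (Hd := lipschitz_sum_decreasing (S r) (INR (S m) * (y / 2)) (INR (S m) * z) ltac:(nra)).
    rewrite !Rabs_mult, Rabs_Ropp, (Rabs_pos_eq (INR (S m))), (Rabs_pos_eq (2 * PI)), (Rabs_pos_eq (lipschitz_sum _ _)) by lra.
    rewrite pow_1.
    apply Rle_trans with (INR (S m) * (2 * PI * (exp (- (PI * (y / 2) * INR (S m))) *
      Series (fun n => INR (S n) ^ S r * exp (- (PI * (y / 2) * INR (S n))))))); [|right; ring].
    apply Rmult_le_compat_l; [lra|]. apply Rmult_le_compat_l; lra.
  - apply ex_series_Rscal, ex_series_pow_exp. nra.
  - intros z Hz. apply ex_eis_sum. lra.
Qed.

Lemma divisor_sum_pos (r n : nat) : (1 <= n)%nat -> (1 <= divisor_sum r n)%nat.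
Proof.
  intros Hn. destruct n as [|n]; [lia|]. unfold divisor_sum. simpl seq. cbn [filter].
  rewrite Nat.mod_1_r. simpl. rewrite Nat.pow_1_l. lia.
Qed.

Lemma eis_sum_decreasing (r : nat) (x y : R) : 0 < x < y -> eis_sum r y < eis_sum r x.
Proof.
  intros Hxy. pose proof PI_RGT_0.
  assert (H1 := eis_sum_divisor r x ltac:(lra)). assert (H2 := eis_sum_divisor r y ltac:(lra)).
  apply Rminus_lt_0. rewrite <- (is_series_unique _ _ H1), <- (is_series_unique _ _ H2).
  rewrite <- Series_minus; try (eexists; eassumption).
  assert (Hq : exp (- (2 * PI * y)) < exp (- (2 * PI * x))) by (apply exp_increasing; nra).
  pose proof (exp_pos (- (2 * PI * y))).
  assert (Hd : forall n, 1 <= INR (divisor_sum r (S n)))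
    by (intros n; replace 1 with (INR 1) by reflexivity; apply le_INR, divisor_sum_pos; lia).
  apply Series_pos.
  - apply (ex_series_minus (V := R_NormedModule)); eexists; eassumption.
  - intros n. rewrite <- Rmult_minus_distr_l. specialize (Hd n). apply Rmult_le_pos; [lra|].
    assert (exp (- (2 * PI * y)) ^ S n <= exp (- (2 * PI * x)) ^ S n) by (apply pow_incr; lra). lra.
  - specialize (Hd 0%nat). rewrite !pow_1. nra.
Qed.

Lemma eis_sum_pos (r : nat) (y : R) : 0 < y -> 0 < eis_sum r y.
Proof.
  intros Hy. assert (eis_sum r (2 * y) < eis_sum r y) by (apply eis_sum_decreasing; lra).
  enough (0 <= eis_sum r (2 * y)) by lra.
  apply Series_nonneg; [apply ex_eis_sum; lra|]. intros m. apply ex_Series_bound_term. lra.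
Qed.

Lemma continuous_eis (j : nat) (y : R) : 0 < y -> continuous (eis j) y.
Proof.
  intros Hy. destruct j as [|j]; [apply continuous_const|].
  apply (ex_derive_continuous (fun y => 1 - eis_factor (S j) * eis_sum (2 * S j - 1) y)).
  apply @ex_derive_minus; [apply ex_derive_const|].
  apply ex_derive_scal, ex_derive_eis_sum, Hy.
Qed.

Lemma eis_factor_sign (j : nat) : In j [2; 3; 4; 5; 7]%nat -> 0 < - (-1) ^ j * eis_factor j.
Proof.
  intros Hj. destruct (eisenstein_constant j Hj) as [HB _].
  unfold eis_factor, Rdiv. assert (0 < INR (4 * j)) by (apply lt_0_INR; simpl in Hj; lia).
  assert (E1 := sqr_pow_m1 j).
  set (s := (-1) ^ j) in *. set (b := bernoulli (2 * j)) in *.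
  assert (b <> 0) by (intros E; rewrite E in HB; lra).
  replace (- s * (INR (4 * j) * / b)) with (INR (4 * j) * / (- s * b)).
  - apply Rmult_lt_0_compat; auto. now apply Rinv_0_lt_compat.
  - field_simplify_eq; [|split; auto; intros E; rewrite E in E1; lra].
    replace (s ^ 2) with (s * s) by ring. rewrite E1. ring.
Qed.

(** By [eis_factor_sign], for even [j > 0] both terms of [eis j y] are positive. For odd [j] the
    inversion law at the fixed point 1 reads [eis j 1 = - eis j 1], and the opposite sign of the
    factor makes [eis j] increase from this zero. *)
Lemma eis_pos (j : nat) (y : R) : 1 < y -> In j [0; 2; 3; 4; 5; 7]%nat -> 0 < eis j y.
Proof.
  intros Hy Hj. destruct (Nat.eq_dec j 0) as [->|Hj0]; [simpl; lra|].
  assert (Hj' : In j [2; 3; 4; 5; 7]%nat) by (destruct Hj; [congruence|auto]).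
  assert (HS := eis_factor_sign j Hj').
  assert (HE : forall w, eis j w = 1 - eis_factor j * eis_sum (2 * j - 1) w) by (intros; destruct j; [lia|reflexivity]).
  assert (H1 := eis_inv j 1 Rlt_0_1 Hj). rewrite Rinv_1, pow1 in H1.
  assert (Hd := eis_sum_decreasing (2 * j - 1) 1 y ltac:(lra)). assert (Hp := eis_sum_pos (2 * j - 1) y ltac:(lra)).
  destruct (Nat.Even_or_Odd j) as [[i Hi]|[i Hi]].
  - assert (E : (-1) ^ j = 1) by (rewrite Hi; apply pow_1_even).
    rewrite E in HS. rewrite HE. nra.
  - assert (E : (-1) ^ j = -1) by (rewrite Hi, Nat.add_1_r; apply pow_1_odd).
    rewrite E in *. rewrite !HE in *. nra.
Qed.

Lemma eis_bounded (j : nat) (y : R) : 1 <= y -> Rabs (eis j y) <= 1 + Rabs (eis_factor j) * eis_sum (2 * j - 1) 1.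
Proof.
  intros Hy. destruct j as [|j].
  - simpl. rewrite Rabs_R1. assert (H := eis_sum_pos (2 * 0 - 1) 1 Rlt_0_1). pose proof (Rabs_pos (eis_factor 0)).
    enough (0 <= Rabs (eis_factor 0) * eis_sum (2 * 0 - 1) 1) by (simpl in *; lra). apply Rmult_le_pos; lra.
  - unfold eis. eapply Rle_trans; [apply Rabs_triang|]. rewrite Rabs_R1, Rabs_Ropp, Rabs_mult.
    apply Rplus_le_compat_l, Rmult_le_compat_l; [apply Rabs_pos|].
    rewrite Rabs_pos_eq by (left; apply eis_sum_pos; lra).
    destruct (Req_dec y 1) as [->|]; [lra|]. left; apply eis_sum_decreasing; lra.
Qed.

(** * The discriminant and its inversion law *)

Definition log_prod (y : R) : R := Series (fun n => ln (1 - exp (- (2 * PI * y * INR (S n))))).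

(** As an exponential of a series of logarithms it is visibly positive, and its inversion law
    reduces to one for [log_prod], whose derivative is a multiple of [eis_sum 1]. *)
Definition disc (y : R) : R := exp (- (2 * PI * y) + 24 * log_prod y).

Lemma ex_log_prod (y : R) : 0 < y -> ex_series (fun n => ln (1 - exp (- (2 * PI * y * INR (S n))))).
Proof.
  intros Hy. pose proof PI_RGT_0. assert (0 < 2 * PI * y) by nra.
  assert (H1 := exp_neg_lt_1 (2 * PI * y) ltac:(auto)).
  apply (ex_series_dom _ (fun n => / (1 - exp (- (2 * PI * y))) * (INR (S n) ^ 0 * exp (- (2 * PI * y * INR (S n)))))).
  - intros n. pose proof (INR_S_ge_1 n). rewrite pow_O, Rmult_1_l.
    assert (Hz := exp_neg_lt_1 (2 * PI * y * INR (S n)) ltac:(nra)).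
    assert (Hzz : exp (- (2 * PI * y * INR (S n))) <= exp (- (2 * PI * y))) by (apply exp_le; nra).
    set (z := exp (- (2 * PI * y * INR (S n)))) in *. set (w := exp (- (2 * PI * y))) in *.
    assert (Hl : ln (1 - z) <= 0) by (rewrite <- ln_1; left; apply ln_increasing; lra).
    rewrite <- Rabs_Ropp, Rabs_pos_eq by lra.
    rewrite <- ln_Rinv by lra.
    (* [ln x <= x - 1] at [x = / (1 - z)]; afterwards [z <= w] makes the factor in front of [z]
       uniform in [n]. *)
    apply Rle_trans with (/ (1 - z) - 1).
    + assert (HI : 0 < / (1 - z)) by (apply Rinv_0_lt_compat; lra).
      assert (HI1 : 1 <= / (1 - z)) by (rewrite <- Rinv_1 at 1; apply Rinv_le_contravar; lra).
      destruct (Req_dec (ln (/ (1 - z))) 0) as [->|Hn]; [lra|].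
      pose proof (exp_ineq1 _ Hn) as He. rewrite exp_ln in He by auto. lra.
    + replace (/ (1 - z) - 1) with (/ (1 - z) * z) by (field; lra).
      apply Rmult_le_compat_r; [lra|]. apply Rinv_le_contravar; lra.
  - apply ex_series_Rscal, ex_series_pow_exp; auto.
Qed.

Lemma is_derive_log_prod (y : R) : 0 < y -> is_derive log_prod y (2 * PI * eis_sum 1 y).
Proof.
  intros Hy. pose proof PI_RGT_0.
  rewrite <- (is_series_unique _ _ (eis_sum_lambert 1 y Hy)), <- Series_scal_l.
  assert (H1 := exp_neg_lt_1 (2 * PI * (y / 2)) ltac:(nra)).
  apply (is_derive_Series (fun n y => ln (1 - exp (- (2 * PI * y * INR (S n)))))
    (fun n y => 2 * PI * (INR (S n) ^ 1 * (exp (- (2 * PI * y * INR (S n))) / (1 - exp (- (2 * PI * y * INR (S n)))))))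
    (fun n => 2 * PI * / (1 - exp (- (2 * PI * (y / 2)))) * (INR (S n) ^ 1 * exp (- (2 * PI * (y / 2) * INR (S n)))))
    (y / 2)); try lra.
  - intros n z Hz. pose proof (INR_S_ge_1 n). assert (0 < 2 * PI * z) by nra.
    assert (Hw := exp_neg_lt_1 (2 * PI * z * INR (S n)) ltac:(nra)). set (t := INR (S n)) in *.
    auto_derive; [lra|]. field. lra.
  - intros n z Hz. pose proof (INR_S_ge_1 n). assert (0 < 2 * PI * (y / 2)) by nra.
    assert (Ha : exp (- (2 * PI * z * INR (S n))) <= exp (- (2 * PI * (y / 2) * INR (S n)))).
    { apply exp_le. assert (0 < PI * INR (S n)) by nra.
      assert (PI * INR (S n) * (y / 2) <= PI * INR (S n) * z) by (apply Rmult_le_compat_l; lra). lra. }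
    assert (Hb : exp (- (2 * PI * (y / 2) * INR (S n))) <= exp (- (2 * PI * (y / 2)))) by (apply exp_le;
      assert (2 * PI * (y / 2) * 1 <= 2 * PI * (y / 2) * INR (S n)) by (apply Rmult_le_compat_l; lra); lra).
    pose proof (exp_pos (- (2 * PI * z * INR (S n)))).
    set (a := exp (- (2 * PI * z * INR (S n)))) in *. set (b := exp (- (2 * PI * (y / 2) * INR (S n)))) in *.
    set (w := exp (- (2 * PI * (y / 2)))) in *.
    assert (0 < / (1 - a)) by (apply Rinv_0_lt_compat; lra).
    rewrite pow_1, Rabs_pos_eq.
    2:{ apply Rmult_le_pos; [lra|]. apply Rmult_le_pos; [lra|]. apply Rmult_le_pos; lra. }
    apply Rle_trans with (2 * PI * (INR (S n) * (b * / (1 - w)))); [|right; field; lra].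
    apply Rmult_le_compat_l; [lra|].
    apply Rmult_le_compat_l; [lra|]. unfold Rdiv. apply Rmult_le_compat; try lra.
    apply Rinv_le_contravar; lra.
  - apply ex_series_Rscal, ex_series_pow_exp. nra.
  - intros z Hz. apply ex_log_prod. lra.
Qed.

(** [g] is the logarithm of [disc (/ y) / (y ^ 12 * disc y)]. Since [zeta 2 = PI ^ 2 / 6], the law
    of [eis_sum 1] says [24 (a + z ^ 2 b) = 1 + z ^ 2 - 6 z / PI]; its last term cancels the
    derivative [12 / z] of [12 * ln z] and the others those of the exponents. So [g] is constant,
    and it vanishes at the fixed point 1. *)
Lemma disc_inv (y : R) : 0 < y -> disc (/ y) = y ^ 12 * disc y.
Proof.
  intros Hy. pose proof PI_RGT_0.
  set (g := fun y => (- (2 * PI * / y) + 24 * log_prod (/ y)) - (- (2 * PI * y) + 24 * log_prod y) - 12 * ln y).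
  assert (Hg : forall z, 0 < z -> is_derive g z 0).
  { intros z Hz. pose proof (Rinv_0_lt_compat z Hz) as Hz'.
    assert (D1 := is_derive_log_prod z Hz).
    assert (D2 : is_derive (fun z => log_prod (/ z)) z (- / z ^ 2 * (2 * PI * eis_sum 1 (/ z)))).
    { apply (is_derive_comp log_prod (fun z => / z)); [now apply is_derive_log_prod|].
      auto_derive; [lra|]. field. lra. }
    assert (T := eis_sum_1_inv z Hz). rewrite (proj1 zeta_values) in T.
    assert (D3 : is_derive (fun z => - (2 * PI * / z)) z (2 * PI / z ^ 2)) by (auto_derive; [lra|field; lra]).
    assert (D4 : is_derive (fun z => - (2 * PI * z)) z (- (2 * PI))) by (auto_derive; auto; ring).
    assert (D5 : is_derive (fun z => 12 * ln z) z (12 / z)) by (auto_derive; auto; field; lra).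
    apply (is_derive_scal _ _ 24) in D1. apply (is_derive_scal _ _ 24) in D2.
    evar_last.
    - apply @is_derive_minus; [|exact D5]. apply @is_derive_minus; apply @is_derive_plus; eassumption.
    - unfold minus, plus, opp; simpl.
      set (a := eis_sum 1 (/ z)) in *. set (b := eis_sum 1 z) in *.
      assert (E : 24 * (a + z ^ 2 * b) = 1 + z ^ 2 - 6 * z / PI).
      { apply Rmult_eq_reg_l with (PI ^ 2 / 6); [|nra]. rewrite <- Rmult_assoc.
        replace (PI ^ 2 / 6 * 24) with (4 * PI ^ 2) by field. rewrite T. field. lra. }
      assert (Ea : a = (1 + z ^ 2 - 6 * z / PI) / 24 - z ^ 2 * b) by lra.
      rewrite Ea. field. lra. }
  assert (E : g y = g 1).
  { destruct (MVT_gen g 1 y (fun _ => 0)) as [c [_ Hc]].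
    - intros z Hz. apply Hg. unfold Rmin in Hz. destruct (Rle_dec 1 y); lra.
    - intros z Hz. apply continuity_pt_filterlim, (ex_derive_continuous g). eexists. apply Hg.
      unfold Rmin in Hz. destruct (Rle_dec 1 y); lra.
    - lra. }
  unfold g in E. rewrite ln_1, Rinv_1 in E.
  unfold disc. replace (- (2 * PI * / y) + 24 * log_prod (/ y)) with (12 * ln y + (- (2 * PI * y) + 24 * log_prod y)) by lra.
  rewrite exp_plus. f_equal. rewrite <- (Rpower_pow 12 y Hy). unfold Rpower. f_equal. rewrite INR_IZR_INZ. reflexivity.
Qed.

Lemma disc_pos (y : R) : 0 < disc y.
Proof. apply exp_pos. Qed.

Lemma disc_bound (y : R) : 0 < y -> disc y <= exp (- (2 * PI * y)).
Proof.
  intros Hy. pose proof PI_RGT_0. apply exp_le.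
  enough (0 <= - log_prod y) by lra. unfold log_prod. rewrite <- Series_opp.
  apply Series_nonneg.
  - apply (ex_series_opp (V := R_NormedModule)), ex_log_prod, Hy.
  - intros n. pose proof (INR_S_ge_1 n). assert (0 < 2 * PI * y) by nra.
    assert (Hw := exp_neg_lt_1 (2 * PI * y * INR (S n)) ltac:(nra)).
    enough (ln (1 - exp (- (2 * PI * y * INR (S n)))) < 0) by lra.
    rewrite <- ln_1. apply ln_increasing; lra.
Qed.

Lemma continuous_disc (y : R) : 0 < y -> continuous disc y.
Proof.
  intros Hy. apply (ex_derive_continuous (V := R_NormedModule)).
  assert (H := is_derive_log_prod y Hy). unfold disc.
  apply (ex_derive_comp exp (fun y => - (2 * PI * y) + 24 * log_prod y)).
  - eexists; apply is_derive_exp.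
  - apply @ex_derive_plus; [auto_derive; auto|]. apply ex_derive_scal. eexists; exact H.
Qed.

(** * Values of the complex forms on the imaginary axis *)

Lemma q_imaginary (y : R) : q (0, y) = RtoC (exp (- (2 * PI * y))).
Proof.
  unfold q, Cexp.
  replace (2 * PI * Ci * (0, y))%C with (RtoC (- (2 * PI * y)))
    by (unfold Ci, Cmult, RtoC; simpl; f_equal; ring).
  unfold RtoC; simpl. rewrite cos_0, sin_0. f_equal; ring.
Qed.

Lemma Re_sum_n (a : nat -> C) (n : nat) : Re (sum_n a n) = sum_n (fun k => Re (a k)) n.
Proof. induction n as [|n IH]; [now rewrite !sum_O|]. rewrite !sum_Sn, <- IH. reflexivity. Qed.

Lemma Im_sum_n (a : nat -> C) (n : nat) : Im (sum_n a n) = sum_n (fun k => Im (a k)) n.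
Proof. induction n as [|n IH]; [now rewrite !sum_O|]. rewrite !sum_Sn, <- IH. reflexivity. Qed.

Lemma C_lim_seq_RtoC (u : nat -> C) (v : nat -> R) (l : R) :
  (forall n, u n = RtoC (v n)) -> is_lim_seq v l -> C_lim_seq u = RtoC l.
Proof.
  intros H Hv. unfold C_lim_seq, RtoC. f_equal.
  - rewrite (Lim_seq_ext _ v) by (intros; now rewrite H). now rewrite (is_lim_seq_unique _ _ Hv).
  - rewrite (Lim_seq_ext _ (fun _ => 0)) by (intros; now rewrite H). now rewrite Lim_seq_const.
Qed.

Lemma discriminant_imaginary (y : R) : 0 < y -> discriminant (0, y) = RtoC (disc y).
Proof.
  intros Hy. pose proof PI_RGT_0. unfold discriminant, disc. rewrite q_imaginary, exp_plus, RtoC_mult. f_equal.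
  apply (C_lim_seq_RtoC _ (fun n => exp (24 * psum (fun n => ln (1 - exp (- (2 * PI * y * INR (S n))))) n))).
  - intros n. induction n as [|n IH].
    + simpl. rewrite Rmult_0_r, exp_0. reflexivity.
    + cbn [C_prod psum]. rewrite IH, Rmult_plus_distr_l, exp_plus, RtoC_mult. f_equal.
      pose proof (INR_S_ge_1 n). assert (0 < 2 * PI * y) by nra.
      assert (Hw := exp_neg_lt_1 (2 * PI * y * INR (S n)) ltac:(nra)).
      rewrite <- RtoC_pow, <- RtoC_minus, <- RtoC_pow. f_equal. rewrite exp_pow.
      replace (- (2 * PI * y) * INR (S n)) with (- (2 * PI * y * INR (S n))) by ring.
      rewrite <- (Rpower_pow 24) by lra. unfold Rpower. do 2 f_equal. rewrite INR_IZR_INZ. reflexivity.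
  - apply (is_lim_seq_continuous exp); [apply derivable_continuous, derivable_exp|].
    replace (Finite (24 * log_prod y)) with (Rbar_mult 24 (log_prod y)) by reflexivity.
    apply is_lim_seq_scal_l. apply is_lim_seq_incr_1.
    apply (is_lim_seq_ext (sum_n (fun n => ln (1 - exp (- (2 * PI * y * INR (S n))))))).
    + intros n. symmetry. apply psum_sum_n.
    + apply (Series_correct _ (ex_log_prod y Hy)).
Qed.

Lemma Eisenstein_imaginary (j : nat) (y : R) : 0 < y -> Eisenstein j (0, y) = RtoC (eis j y).
Proof.
  intros Hy. destruct j as [|j]; [reflexivity|].
  unfold Eisenstein, eis. rewrite RtoC_minus, RtoC_mult. do 2 f_equal.
  apply (C_lim_seq_RtoC _ (sum_n (fun n => INR (divisor_sum (2 * S j - 1) (S n)) * exp (- (2 * PI * y)) ^ S n))).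
  - intros n. induction n as [|n IH].
    + rewrite !sum_O, q_imaginary, <- RtoC_pow, <- RtoC_mult. reflexivity.
    + rewrite !sum_Sn, IH, q_imaginary, <- RtoC_pow, <- RtoC_mult. unfold plus; simpl. now rewrite RtoC_plus.
  - apply (eis_sum_divisor _ y Hy).
Qed.

Lemma Delta_form_imaginary (k : nat) (y : R) : 0 < y ->
  Delta_form k (0, y) = RtoC (disc y * eis (Nat.div2 (k - 12)) y).
Proof.
  intros Hy. unfold Delta_form. now rewrite discriminant_imaginary, Eisenstein_imaginary, RtoC_mult.
Qed.

(** * Complex differentiation *)

(** Stated by components because path integrals are taken as pairs of real integrals; [ccont_eps]
    gives the equivalent form with the modulus. *)
Definition ccont (f : C -> C) (z : C) : Prop :=
  continuous (T := C_UniformSpace) (U := R_UniformSpace) (fun w => Re (f w)) z /\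
  continuous (T := C_UniformSpace) (U := R_UniformSpace) (fun w => Im (f w)) z.

Lemma Cmod_le_add (z : C) : Cmod z <= Rabs (Re z) + Rabs (Im z).
Proof.
  rewrite <- (sqrt_pow2 (Rabs (Re z) + Rabs (Im z))).
  - unfold Cmod. apply sqrt_le_1_alt. rewrite <- (pow2_abs (fst z)), <- (pow2_abs (snd z)).
    pose proof (Rabs_pos (fst z)). pose proof (Rabs_pos (snd z)). unfold Re, Im. nra.
  - pose proof (Rabs_pos (Re z)). pose proof (Rabs_pos (Im z)). lra.
Qed.

Lemma ccont_eps (f : C -> C) (z : C) :
  ccont f z <->
  forall e, 0 < e -> exists d, 0 < d /\ forall w, Cmod (w - z) < d -> Cmod (f w - f z) < e.
Proof.
  split.
  - intros [HR HI] e He.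
    assert (He2 : 0 < e / 2) by lra.
    destruct (HR _ (locally_ball (T := R_UniformSpace) (Re (f z)) (mkposreal _ He2))) as [d1 H1].
    destruct (HI _ (locally_ball (T := R_UniformSpace) (Im (f z)) (mkposreal _ He2))) as [d2 H2].
    exists (Rmin d1 d2). split; [apply Rmin_pos; apply cond_pos|].
    intros w Hw.
    assert (B : forall d : posreal, Rmin d1 d2 <= d -> ball (M := C_UniformSpace) z d w).
    { intros d Hd. split.
      - apply Rle_lt_trans with (Cmod (w - z)); [apply (Re_le_Cmod (w - z))|lra].
      - apply Rle_lt_trans with (Cmod (w - z)); [apply (Im_le_Cmod (w - z))|lra]. }
    specialize (H1 w (B d1 (Rmin_l _ _))). specialize (H2 w (B d2 (Rmin_r _ _))).
    change (Rabs (Re (f w) - Re (f z)) < e / 2) in H1.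
    change (Rabs (Im (f w) - Im (f z)) < e / 2) in H2.
    eapply Rle_lt_trans; [apply Cmod_le_add|].
    change (Rabs (Re (f w) - Re (f z)) + Rabs (Im (f w) - Im (f z)) < e). lra.
  - intros H.
    assert (HB : forall e : posreal, exists d : posreal, forall w : C_UniformSpace,
      ball (M := C_UniformSpace) z d w -> Cmod (f w - f z) < e).
    { intros e. destruct (H e (cond_pos e)) as [d [Hd Hf]]. assert (Hd2 : 0 < d / 2) by lra.
      exists (mkposreal _ Hd2). intros w [Hw1 Hw2]. apply Hf.
      eapply Rle_lt_trans; [apply Cmod_le_add|].
      change (Rabs (Re w - Re z) < d / 2) in Hw1. change (Rabs (Im w - Im z) < d / 2) in Hw2.
      change (Rabs (Re w - Re z) + Rabs (Im w - Im z) < d). lra. }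
    split; intros P [e HP]; destruct (HB e) as [d Hd]; exists d; intros w Hw; apply HP;
      (apply Rle_lt_trans with (Cmod (f w - f z)); [|now apply Hd]).
    + apply (Re_le_Cmod (f w - f z)).
    + apply (Im_le_Cmod (f w - f z)).
Qed.

Lemma ccont_const (c z : C) : ccont (fun _ => c) z.
Proof. split; apply continuous_const. Qed.

Lemma ccont_id (z : C) : ccont (fun w => w) z.
Proof.
  split; intros P [e He]; exists e; intros y Hy; apply He, Hy.
Qed.

Lemma ccont_plus (f g : C -> C) (z : C) : ccont f z -> ccont g z -> ccont (fun w => f w + g w)%C z.
Proof.
  intros [F1 F2] [G1 G2]. split.
  - apply (continuous_plus (V := R_NormedModule) (fun w => Re (f w)) (fun w => Re (g w))); auto.
  - apply (continuous_plus (V := R_NormedModule) (fun w => Im (f w)) (fun w => Im (g w))); auto.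
Qed.

Lemma ccont_mult (f g : C -> C) (z : C) : ccont f z -> ccont g z -> ccont (fun w => f w * g w)%C z.
Proof.
  intros [F1 F2] [G1 G2]. split.
  - apply (continuous_minus (V := R_NormedModule) (fun w => Re (f w) * Re (g w)) (fun w => Im (f w) * Im (g w)));
      apply (continuous_mult (K := R_AbsRing)); auto.
  - apply (continuous_plus (V := R_NormedModule) (fun w => Re (f w) * Im (g w)) (fun w => Im (f w) * Re (g w)));
      apply (continuous_mult (K := R_AbsRing)); auto.
Qed.

Lemma ccont_opp (f : C -> C) (z : C) : ccont f z -> ccont (fun w => - f w)%C z.
Proof.
  intros [F1 F2]. split.
  - apply (continuous_opp (V := R_NormedModule) (fun w => Re (f w))); auto.
  - apply (continuous_opp (V := R_NormedModule) (fun w => Im (f w))); auto.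
Qed.

Lemma ccont_minus (f g : C -> C) (z : C) : ccont f z -> ccont g z -> ccont (fun w => f w - g w)%C z.
Proof. intros F G. apply (ccont_plus f (fun w => - g w)%C); auto. now apply ccont_opp. Qed.

Lemma ccont_inv (f : C -> C) (z : C) : ccont f z -> f z <> 0 -> ccont (fun w => / f w)%C z.
Proof.
  intros [F1 F2] H.
  assert (Hn : Re (f z) ^ 2 + Im (f z) ^ 2 <> 0).
  { intros E. apply H. unfold Re, Im in E. destruct (f z) as [a b]; simpl in E.
    assert (a = 0) by nra. assert (b = 0) by nra. subst. reflexivity. }
  assert (HN : continuous (T := C_UniformSpace) (U := R_UniformSpace) (fun w => / (Re (f w) ^ 2 + Im (f w) ^ 2)) z).
  { apply (continuous_comp (fun w => Re (f w) ^ 2 + Im (f w) ^ 2) Rinv).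
    - apply (continuous_plus (V := R_NormedModule) (fun w => Re (f w) ^ 2) (fun w => Im (f w) ^ 2)).
      + apply (continuous_comp (fun w => Re (f w)) (fun x => x ^ 2)); auto.
        smooth.
      + apply (continuous_comp (fun w => Im (f w)) (fun x => x ^ 2)); auto.
        smooth.
    - now apply continuous_Rinv. }
  split.
  - apply (continuous_mult (K := R_AbsRing) (fun w => Re (f w))); auto.
  - apply (continuous_mult (K := R_AbsRing) (fun w => - Im (f w))); auto.
    apply (continuous_opp (V := R_NormedModule) (fun w => Im (f w))); auto.
Qed.

Lemma ccont_ext_loc (f g : C -> C) (z : C) (d : R) : 0 < d ->
  (forall w, Cmod (w - z) < d -> f w = g w) -> ccont f z -> ccont g z.
Proof.
  intros Hd H Hf. rewrite ccont_eps in Hf |- *. intros e He.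
  destruct (Hf e He) as [d1 [Hd1 H1]]. exists (Rmin d d1). split; [now apply Rmin_pos|].
  intros w Hw. rewrite <- !H.
  - apply H1. eapply Rlt_le_trans; [exact Hw|apply Rmin_r].
  - replace (z - z)%C with (RtoC 0) by (apply injective_projections; simpl; ring).
    rewrite Cmod_0. auto.
  - eapply Rlt_le_trans; [exact Hw|apply Rmin_l].
Qed.

(** The value [l] on the diagonal fills the removable point. The same function later serves as
    integrand in Cauchy's formula and as the quotient of [L] by [s - 1 / 2]. *)
Definition slope (f : C -> C) (z l w : C) : C :=
  if excluded_middle_informative (w = z) then l else ((f w - f z) / (w - z))%C.

(* Caratheodory's form of the derivative. *)
Definition cder (f : C -> C) (z l : C) : Prop := ccont (slope f z l) z.

Lemma Cminus_eq_0 (w z : C) : (w - z)%C = 0 -> w = z.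
Proof. intros H. replace w with (w - z + z)%C by ring. rewrite H. ring. Qed.

Lemma slope_eq (f : C -> C) (z l w : C) : f w = (f z + slope f z l w * (w - z))%C.
Proof.
  unfold slope. destruct (excluded_middle_informative (w = z)) as [->|H]; [ring|].
  field. intros E. apply H. now apply Cminus_eq_0.
Qed.

Lemma slope_self (f : C -> C) (z l : C) : slope f z l z = l.
Proof. unfold slope. destruct (excluded_middle_informative (z = z)); congruence. Qed.

(** Any continuous factor [phi] has to agree with the slope near [z]. The differentiation rules thus
    reduce to an algebraic factorisation and the continuity of its factor. *)
Lemma cder_intro (f phi : C -> C) (z l : C) (d : R) : 0 < d ->
  (forall w, Cmod (w - z) < d -> f w = f z + phi w * (w - z))%C ->
  phi z = l -> ccont phi z -> cder f z l.
Proof.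
  intros Hd H Hl Hphi. apply (ccont_ext_loc phi _ z d Hd); auto.
  intros w Hw. unfold slope. destruct (excluded_middle_informative (w = z)) as [->|Hn]; auto.
  rewrite (H w Hw). field. intros E. apply Hn. now apply Cminus_eq_0.
Qed.

Lemma cder_ccont (f : C -> C) (z l : C) : cder f z l -> ccont f z.
Proof.
  intros H. apply (ccont_ext_loc (fun w => f z + slope f z l w * (w - z))%C _ z 1 Rlt_0_1).
  - intros w _. symmetry. apply slope_eq.
  - apply ccont_plus; [apply ccont_const|]. apply ccont_mult; auto.
    apply ccont_minus; [apply ccont_id|apply ccont_const].
Qed.

Lemma cder_mult (f g : C -> C) (z l m : C) : cder f z l -> cder g z m ->
  cder (fun w => f w * g w)%C z (l * g z + f z * m)%C.
Proof.
  intros Hf Hg.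
  apply (cder_intro _ (fun w => slope f z l w * g w + f z * slope g z m w)%C z _ 1 Rlt_0_1).
  - intros w _. rewrite (slope_eq f z l w) at 1. rewrite (slope_eq g z m w). ring.
  - now rewrite !slope_self.
  - apply ccont_plus; apply ccont_mult; auto using ccont_const. now apply cder_ccont in Hg.
Qed.

Lemma cder_plus (f g : C -> C) (z l m : C) : cder f z l -> cder g z m ->
  cder (fun w => f w + g w)%C z (l + m)%C.
Proof.
  intros Hf Hg.
  apply (cder_intro _ (fun w => slope f z l w + slope g z m w)%C z _ 1 Rlt_0_1).
  - intros w _. rewrite (slope_eq f z l w) at 1. rewrite (slope_eq g z m w) at 1. ring.
  - now rewrite !slope_self.
  - now apply ccont_plus.
Qed.

Lemma cder_const (c z : C) : cder (fun _ => c) z 0.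
Proof.
  apply (cder_intro _ (fun _ => RtoC 0) z _ 1 Rlt_0_1); auto using ccont_const.
  intros w _. ring.
Qed.

Lemma cder_id (z : C) : cder (fun w => w) z 1.
Proof.
  apply (cder_intro _ (fun _ => RtoC 1) z _ 1 Rlt_0_1); auto using ccont_const.
  intros w _. ring.
Qed.

Lemma cder_inv (f : C -> C) (z l : C) : cder f z l -> f z <> 0 ->
  cder (fun w => / f w)%C z (- l / (f z * f z))%C.
Proof.
  intros Hf H. assert (Hc := cder_ccont _ _ _ Hf).
  destruct (proj1 (ccont_eps f z) Hc (Cmod (f z)) (proj1 (Cmod_gt_0 _) H)) as [d [Hd Hdf]].
  apply (cder_intro _ (fun w => - slope f z l w * / (f w * f z))%C z _ d Hd).
  - intros w Hw. assert (Hw0 : f w <> 0).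
    { intros E. specialize (Hdf w Hw). rewrite E in Hdf.
      replace (0 - f z)%C with (- f z)%C in Hdf by ring. rewrite Cmod_opp in Hdf. lra. }
    assert (E := slope_eq f z l w).
    replace (/ f z + - slope f z l w * / (f w * f z) * (w - z))%C with
      (/ f z - (slope f z l w * (w - z)) * / (f w * f z))%C by (field; split; auto).
    replace (slope f z l w * (w - z))%C with (f w - f z)%C by (rewrite E at 1; ring).
    field. split; auto.
  - rewrite slope_self. reflexivity.
  - apply ccont_mult; [now apply ccont_opp|]. apply ccont_inv.
    + apply ccont_mult; auto using ccont_const.
    + now apply Cmult_neq_0.
Qed.

Lemma cder_pow (f : C -> C) (z l : C) (n : nat) : cder f z l ->
  cder (fun w => f w ^ S n)%C z (INR (S n) * f z ^ n * l)%C.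
Proof.
  intros H. induction n as [|n IH].
  - replace (INR 1 * f z ^ 0 * l)%C with l by (simpl; ring).
    apply (cder_intro _ (slope f z l) z l 1 Rlt_0_1); auto using slope_self.
    intros w _. rewrite !Cpow_1_r. apply slope_eq.
  - assert (HM := cder_mult f (fun w => f w ^ S n)%C z l _ H IH). cbv beta in HM.
    replace (INR (S (S n)) * f z ^ S n * l)%C with
      (l * f z ^ S n + f z * (INR (S n) * f z ^ n * l))%C; [exact HM|].
    rewrite (S_INR (S n)), RtoC_plus, !Cpow_S. ring.
Qed.

Lemma is_derive_cder (f : C -> C) (z l : C) :
  is_derive (K := C_AbsRing) (V := C_NormedModule) f z l <-> cder f z l.
Proof.
  split.
  - intros [_ H]. specialize (H z (fun P HP => HP)). apply ccont_eps. intros e He.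
    assert (He2 : 0 < e / 2) by lra.
    destruct (H (mkposreal _ He2)) as [d Hd]. exists d. split; [apply cond_pos|].
    intros w Hw. rewrite slope_self. unfold slope.
    destruct (excluded_middle_informative (w = z)) as [->|Hn].
    + replace (l - l)%C with (RtoC 0) by ring. rewrite Cmod_0; auto.
    + specialize (Hd w Hw). simpl in Hd.
      change (Cmod ((f w - f z) - (w - z) * l) <= e / 2 * Cmod (w - z)) in Hd.
      assert (Hwz : (w - z <> 0)%C) by (intros E; apply Hn; now apply Cminus_eq_0).
      assert (Hp := proj1 (Cmod_gt_0 _) Hwz).
      apply Rle_lt_trans with (e / 2); [|lra].
      apply Rmult_le_reg_r with (Cmod (w - z)); auto. rewrite <- Cmod_mult.
      replace (((f w - f z) / (w - z) - l) * (w - z))%C with ((f w - f z) - (w - z) * l)%C by (field; auto).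
      exact Hd.
  - intros H. split; [apply is_linear_scal_l|].
    intros x Hx. assert (E : z = x) by (apply (is_filter_lim_locally_unique (K := C_AbsRing) (V := AbsRing_NormedModule C_AbsRing)); exact Hx).
    subst x. intros e. apply ccont_eps with (e := e) in H; [|apply cond_pos].
    destruct H as [d [Hd H]]. exists (mkposreal d Hd). intros w Hw. simpl.
    change (Cmod (w - z) < d) in Hw. specialize (H w Hw). rewrite slope_self in H.
    change (Cmod ((f w - f z) - (w - z) * l) <= e * Cmod (w - z)).
    rewrite (slope_eq f z l w).
    replace (f z + slope f z l w * (w - z) - f z - (w - z) * l)%C with ((slope f z l w - l) * (w - z))%C by ring.
    rewrite Cmod_mult. apply Rmult_le_compat_r; [apply Cmod_ge_0|lra].
Qed.

(** * Cauchy's theorem on rectangles *)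

Definition ex_CI (f : R -> C) (a b : R) : Prop :=
  ex_RInt (fun t => Re (f t)) a b /\ ex_RInt (fun t => Im (f t)) a b.

Definition CI (f : R -> C) (a b : R) : C :=
  (RInt (fun t => Re (f t)) a b, RInt (fun t => Im (f t)) a b).

Lemma CI_ext (f g : R -> C) (a b : R) : a <= b ->
  (forall t, a <= t <= b -> f t = g t) -> CI f a b = CI g a b.
Proof.
  intros Hab H. unfold CI. f_equal; apply RInt_ext; intros t Ht;
    rewrite Rmin_left, Rmax_right in Ht by lra; rewrite H by lra; reflexivity.
Qed.

Lemma CI_plus (f g : R -> C) (a b : R) : ex_CI f a b -> ex_CI g a b ->
  CI (fun t => f t + g t)%C a b = (CI f a b + CI g a b)%C.
Proof.
  intros [F1 F2] [G1 G2]. unfold CI, Cplus; simpl. f_equal.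
  - apply (RInt_plus (V := R_CompleteNormedModule) (fun t => Re (f t)) (fun t => Re (g t))); auto.
  - apply (RInt_plus (V := R_CompleteNormedModule) (fun t => Im (f t)) (fun t => Im (g t))); auto.
Qed.

Lemma CI_scal (c : C) (f : R -> C) (a b : R) : ex_CI f a b ->
  CI (fun t => c * f t)%C a b = (c * CI f a b)%C.
Proof.
  intros [F1 F2]. unfold CI, Cmult; simpl.
  assert (Hs : forall k (h : R -> R), ex_RInt h a b -> RInt (fun t => k * h t) a b = k * RInt h a b)
    by (intros; now apply (RInt_scal (V := R_CompleteNormedModule))).
  assert (Es : forall k (h : R -> R), ex_RInt h a b -> ex_RInt (fun t => k * h t) a b)
    by (intros; now apply (ex_RInt_scal (V := R_NormedModule))).
  f_equal.
  - rewrite <- !Hs by auto.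
    apply (RInt_minus (V := R_CompleteNormedModule) (fun t => fst c * Re (f t)) (fun t => snd c * Im (f t))); auto.
  - rewrite <- !Hs by auto.
    apply (RInt_plus (V := R_CompleteNormedModule) (fun t => fst c * Im (f t)) (fun t => snd c * Re (f t))); auto.
Qed.

Lemma CI_Chasles (f : R -> C) (a b c : R) : ex_CI f a b -> ex_CI f b c ->
  CI f a c = (CI f a b + CI f b c)%C.
Proof.
  intros [F1 F2] [G1 G2]. unfold CI, Cplus; simpl. f_equal; symmetry.
  - now apply (RInt_Chasles (V := R_CompleteNormedModule)).
  - now apply (RInt_Chasles (V := R_CompleteNormedModule)).
Qed.

(** The factor 2 is the price of estimating real and imaginary parts separately. *)
Lemma CI_bound (f : R -> C) (a b M : R) : a <= b -> ex_CI f a b ->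
  (forall t, a <= t <= b -> Cmod (f t) <= M) -> Cmod (CI f a b) <= 2 * (b - a) * M.
Proof.
  intros Hab [F1 F2] H. eapply Rle_trans; [apply Cmod_le_add|]. simpl.
  assert (B1 : Rabs (RInt (fun t => Re (f t)) a b) <= (b - a) * M).
  { apply abs_RInt_le_const; auto. intros t Ht. eapply Rle_trans; [apply Re_le_Cmod|auto]. }
  assert (B2 : Rabs (RInt (fun t => Im (f t)) a b) <= (b - a) * M).
  { apply abs_RInt_le_const; auto. intros t Ht. eapply Rle_trans; [apply Im_le_Cmod|auto]. }
  lra.
Qed.

Lemma continuous_hline (c t : R) : continuous (T := R_UniformSpace) (U := C_UniformSpace) (fun x => (x, c)) t.
Proof. intros P [e He]. exists e. intros y Hy. apply He. split; [exact Hy|apply ball_center]. Qed.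

Lemma continuous_vline (c t : R) : continuous (T := R_UniformSpace) (U := C_UniformSpace) (fun y => (c, y)) t.
Proof. intros P [e He]. exists e. intros y Hy. apply He. split; [apply ball_center|exact Hy]. Qed.

Definition on_hline (f : C -> C) (c : R) : R -> C := fun x => f (x, c).
Definition on_vline (f : C -> C) (c : R) : R -> C := fun y => f (c, y).

Lemma ccont_path (f : C -> C) (g : R -> C) (t : R) :
  continuous (T := R_UniformSpace) (U := C_UniformSpace) g t -> ccont f (g t) ->
  continuous (fun x => Re (f (g x))) t /\ continuous (fun x => Im (f (g x))) t.
Proof.
  intros Hg [H1 H2]. split.
  - exact (continuous_comp (U := R_UniformSpace) (V := C_UniformSpace) (W := R_UniformSpace) g (fun w => Re (f w)) t Hg H1).
  - exact (continuous_comp (U := R_UniformSpace) (V := C_UniformSpace) (W := R_UniformSpace) g (fun w => Im (f w)) t Hg H2).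
Qed.

Lemma ex_CI_path (f : C -> C) (g : R -> C) (a b : R) : a <= b ->
  (forall t, continuous (T := R_UniformSpace) (U := C_UniformSpace) g t) ->
  (forall x, a <= x <= b -> ccont f (g x)) -> ex_CI (fun x => f (g x)) a b.
Proof.
  intros Hab Hg H. split; apply (ex_RInt_continuous (V := R_CompleteNormedModule));
    intros x Hx; rewrite Rmin_left, Rmax_right in Hx by lra; now apply (ccont_path f g x (Hg x) (H x Hx)).
Qed.

Lemma ex_CI_hline (f : C -> C) (a b c : R) : a <= b ->
  (forall x, a <= x <= b -> ccont f (x, c)) -> ex_CI (on_hline f c) a b.
Proof. intros Hab H. exact (ex_CI_path f (fun x => (x, c)) a b Hab (continuous_hline c) H). Qed.

Lemma ex_CI_vline (f : C -> C) (a b c : R) : a <= b ->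
  (forall x, a <= x <= b -> ccont f (c, x)) -> ex_CI (on_vline f c) a b.
Proof. intros Hab H. exact (ex_CI_path f (fun x => (c, x)) a b Hab (continuous_vline c) H). Qed.

Lemma cder_hline (F : C -> C) (x c : R) (l : C) : cder F (x, c) l ->
  is_derive (fun x => Re (F (x, c))) x (Re l) /\ is_derive (fun x => Im (F (x, c))) x (Im l).
Proof.
  intros H.
  assert (D : forall e, 0 < e -> exists d : posreal, forall h, h <> 0 -> Rabs h < d ->
     Cmod ((F ((x + h)%R, c) - F (x, c)) * / RtoC h - l)%C < e).
  { intros e He. apply ccont_eps with (e := e) in H; auto. destruct H as [d [Hd H]].
    exists (mkposreal d Hd). intros h Hh Hhd.
    assert (Eh : (((x + h)%R, c) - (x, c))%C = RtoC h) by (apply injective_projections; simpl; ring).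
    specialize (H ((x + h)%R, c)). rewrite slope_self, Eh, Cmod_R in H. specialize (H Hhd).
    unfold slope in H. match type of H with context [excluded_middle_informative ?p] =>
      destruct (excluded_middle_informative p) as [E|_] end.
    - exfalso. injection E. lra.
    - rewrite Eh in H. exact H. }
  split; apply is_derive_Reals; intros e He; destruct (D e He) as [d Hd]; exists d; intros h Hh Hhd;
    specialize (Hd h Hh Hhd).
  - eapply Rle_lt_trans; [|exact Hd]. eapply Rle_trans; [|apply Re_le_Cmod]. right. f_equal.
    rewrite <- RtoC_inv by auto. unfold Re, Cmult, Cminus, Cplus, Copp, RtoC; simpl. field. auto.
  - eapply Rle_lt_trans; [|exact Hd]. eapply Rle_trans; [|apply Im_le_Cmod]. right. f_equal.
    rewrite <- RtoC_inv by auto. unfold Im, Cmult, Cminus, Cplus, Copp, RtoC; simpl. field. auto.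
Qed.

Lemma Cmod_Ci : Cmod Ci = 1.
Proof.
  unfold Cmod, Ci; simpl. replace (0 * (0 * 1) + 1 * (1 * 1)) with 1 by ring. apply sqrt_1.
Qed.

Lemma ccont_rot (f : C -> C) (z : C) : ccont f (Ci * z)%C -> ccont (fun w => f (Ci * w)%C) z.
Proof.
  rewrite !ccont_eps. intros H e He. destruct (H e He) as [d [Hd Hw]].
  exists d. split; auto. intros w Hwd. apply Hw.
  replace (Ci * w - Ci * z)%C with (Ci * (w - z))%C by ring. rewrite Cmod_mult, Cmod_Ci. lra.
Qed.

(** Multiplication by [Ci] maps the horizontal line at height [- c] onto the vertical line at
    abscissa [c], so the fundamental theorem on vertical segments follows from the horizontal
    one. *)
Lemma cder_rot (F : C -> C) (y c : R) (l : C) : cder F (c, y) l ->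
  cder (fun w => F (Ci * w)%C) (y, (- c)%R) (Ci * l)%C.
Proof.
  intros H.
  assert (E : (Ci * (y, (- c)%R))%C = (c, y)) by (unfold Ci, Cmult; apply injective_projections; simpl; ring).
  apply (cder_intro _ (fun w => slope F (c, y) l (Ci * w) * Ci)%C _ _ 1 Rlt_0_1).
  - intros w _. rewrite E. rewrite (slope_eq F (c, y) l (Ci * w)%C) at 1.
    replace (Ci * w - (c, y))%C with (Ci * (w - (y, (- c)%R)))%C by (rewrite <- E; ring). ring.
  - rewrite E, slope_self. ring.
  - apply ccont_mult; [|apply ccont_const]. apply ccont_rot. rewrite E. exact H.
Qed.

Lemma CI_FTC_h (F f : C -> C) (a b c : R) : a <= b ->
  (forall x, a <= x <= b -> cder F (x, c) (f (x, c))) ->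
  (forall x, a <= x <= b -> ccont f (x, c)) ->
  CI (on_hline f c) a b = (F (b, c) - F (a, c))%C.
Proof.
  intros Hab HF Hf. apply injective_projections; simpl; apply is_RInt_unique.
  - apply (is_RInt_derive (V := R_CompleteNormedModule) (fun x => Re (F (x, c))));
      intros x Hx; rewrite Rmin_left, Rmax_right in Hx by lra.
    + exact (proj1 (cder_hline F x c _ (HF x Hx))).
    + exact (proj1 (ccont_path f _ x (continuous_hline c x) (Hf x Hx))).
  - apply (is_RInt_derive (V := R_CompleteNormedModule) (fun x => Im (F (x, c))));
      intros x Hx; rewrite Rmin_left, Rmax_right in Hx by lra.
    + exact (proj2 (cder_hline F x c _ (HF x Hx))).
    + exact (proj2 (ccont_path f _ x (continuous_hline c x) (Hf x Hx))).
Qed.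

Lemma CI_FTC_v (F f : C -> C) (a b c : R) : a <= b ->
  (forall x, a <= x <= b -> cder F (c, x) (f (c, x))) ->
  (forall x, a <= x <= b -> ccont f (c, x)) ->
  (Ci * CI (on_vline f c) a b)%C = (F (c, b) - F (c, a))%C.
Proof.
  intros Hab HF Hf.
  assert (E : forall y, (Ci * (y, (- c)%R))%C = (c, y))
    by (intros; unfold Ci, Cmult; apply injective_projections; simpl; ring).
  rewrite <- CI_scal by (apply ex_CI_vline; auto).
  rewrite (CI_ext _ (on_hline (fun w => Ci * f (Ci * w))%C (- c))); auto.
  2:{ intros t _. unfold on_hline, on_vline. now rewrite E. }
  rewrite (CI_FTC_h (fun w => F (Ci * w)%C)); auto.
  - now rewrite !E.
  - intros y Hy. rewrite E. now apply cder_rot, HF.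
  - intros y Hy. apply ccont_mult; [apply ccont_const|]. apply ccont_rot. rewrite E. now apply Hf.
Qed.

(* Counterclockwise around [[a, b] x [c, d]]. *)
Definition RI (f : C -> C) (a b c d : R) : C :=
  (CI (on_hline f c) a b + Ci * CI (on_vline f b) c d
   - CI (on_hline f d) a b - Ci * CI (on_vline f a) c d)%C.

Definition on_boundary (a b c d : R) (z : C) : Prop :=
  a <= fst z <= b /\ c <= snd z <= d /\ (fst z = a \/ fst z = b \/ snd z = c \/ snd z = d).

Section Boundary.
Variables a b c d : R.
Hypothesis Hab : a <= b.
Hypothesis Hcd : c <= d.

Definition bcont (f : C -> C) : Prop := forall z, on_boundary a b c d z -> ccont f z.

Lemma boundary_edges :
  (forall x, a <= x <= b -> on_boundary a b c d (x, c)) /\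
  (forall y, c <= y <= d -> on_boundary a b c d (b, y)) /\
  (forall x, a <= x <= b -> on_boundary a b c d (x, d)) /\
  (forall y, c <= y <= d -> on_boundary a b c d (a, y)).
Proof. unfold on_boundary; simpl. intuition lra. Qed.

Lemma bcont_edges (f : C -> C) : bcont f ->
  ex_CI (on_hline f c) a b /\ ex_CI (on_vline f b) c d /\ ex_CI (on_hline f d) a b /\ ex_CI (on_vline f a) c d.
Proof.
  intros H. destruct boundary_edges as (B1 & B2 & B3 & B4).
  split; [apply ex_CI_hline; auto|split; [apply ex_CI_vline; auto|split; [apply ex_CI_hline|apply ex_CI_vline]; auto]].
Qed.

Lemma RI_ext (f g : C -> C) : (forall z, on_boundary a b c d z -> f z = g z) -> RI f a b c d = RI g a b c d.
Proof.
  intros H. destruct boundary_edges as (B1 & B2 & B3 & B4). unfold RI.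
  rewrite (CI_ext (on_hline f c) (on_hline g c)), (CI_ext (on_vline f b) (on_vline g b)),
    (CI_ext (on_hline f d) (on_hline g d)), (CI_ext (on_vline f a) (on_vline g a)); auto;
    intros t Ht; apply H; auto.
Qed.

Lemma RI_plus (f g : C -> C) : bcont f -> bcont g ->
  RI (fun z => f z + g z)%C a b c d = (RI f a b c d + RI g a b c d)%C.
Proof.
  intros Hf Hg. destruct (bcont_edges f Hf) as (F1 & F2 & F3 & F4).
  destruct (bcont_edges g Hg) as (G1 & G2 & G3 & G4). unfold RI.
  assert (HP := CI_plus). unfold on_hline, on_vline in *. rewrite !HP by auto. ring.
Qed.

Lemma RI_scal (k : C) (f : C -> C) : bcont f -> RI (fun z => k * f z)%C a b c d = (k * RI f a b c d)%C.
Proof.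
  intros Hf. destruct (bcont_edges f Hf) as (F1 & F2 & F3 & F4). unfold RI.
  assert (HP := CI_scal k). unfold on_hline, on_vline in *. rewrite !HP by auto. ring.
Qed.

Lemma RI_bound (f : C -> C) (M : R) : bcont f -> (forall z, on_boundary a b c d z -> Cmod (f z) <= M) ->
  Cmod (RI f a b c d) <= 4 * (b - a + (d - c)) * M.
Proof.
  intros Hf H. destruct boundary_edges as (E1 & E2 & E3 & E4). destruct (bcont_edges f Hf) as (F1 & F2 & F3 & F4). unfold RI.
  assert (Hi := Cmod_Ci).
  assert (B1 : Cmod (CI (on_hline f c) a b) <= 2 * (b - a) * M)
    by (apply CI_bound; auto; intros t Ht; apply H; auto).
  assert (B2 : Cmod (CI (on_vline f b) c d) <= 2 * (d - c) * M)
    by (apply CI_bound; auto; intros t Ht; apply H; auto).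
  assert (B3 : Cmod (CI (on_hline f d) a b) <= 2 * (b - a) * M)
    by (apply CI_bound; auto; intros t Ht; apply H; auto).
  assert (B4 : Cmod (CI (on_vline f a) c d) <= 2 * (d - c) * M)
    by (apply CI_bound; auto; intros t Ht; apply H; auto).
  unfold Cminus. eapply Rle_trans; [apply Cmod_triangle|]. rewrite Cmod_opp, Cmod_mult, Hi.
  eapply Rle_trans; [apply Rplus_le_compat_r, Cmod_triangle|]. rewrite Cmod_opp.
  eapply Rle_trans; [do 2 apply Rplus_le_compat_r; apply Cmod_triangle|]. rewrite Cmod_mult, Hi. lra.
Qed.

Lemma RI_primitive (F f : C -> C) : (forall z, on_boundary a b c d z -> cder F z (f z)) -> bcont f ->
  RI f a b c d = 0.
Proof.
  intros HF Hf. destruct boundary_edges as (E1 & E2 & E3 & E4). unfold RI.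
  rewrite !(CI_FTC_h F), !(CI_FTC_v F); auto. ring.
Qed.

End Boundary.

Lemma RI_split_v (f : C -> C) (a m b c d : R) : a <= m <= b ->
  (forall x, a <= x <= b -> ccont f (x, c)) -> (forall x, a <= x <= b -> ccont f (x, d)) ->
  RI f a b c d = (RI f a m c d + RI f m b c d)%C.
Proof.
  intros Hm Hc Hd. unfold RI.
  rewrite (CI_Chasles (on_hline f c) a m b), (CI_Chasles (on_hline f d) a m b); [ring|..];
    apply ex_CI_hline; try lra; intros x Hx; first [exact (Hc x ltac:(lra))|exact (Hd x ltac:(lra))].
Qed.

Lemma RI_split_h (f : C -> C) (a b c m d : R) : c <= m <= d ->
  (forall y, c <= y <= d -> ccont f (a, y)) -> (forall y, c <= y <= d -> ccont f (b, y)) ->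
  RI f a b c d = (RI f a b c m + RI f a b m d)%C.
Proof.
  intros Hm Hc Hd. unfold RI.
  rewrite (CI_Chasles (on_vline f a) c m d), (CI_Chasles (on_vline f b) c m d); [ring|..];
    apply ex_CI_vline; try lra; intros y Hy; first [exact (Hc y ltac:(lra))|exact (Hd y ltac:(lra))].
Qed.

Section Goursat.
Variables (f : C -> C) (a b c d : R).
Hypothesis Hab : a < b.
Hypothesis Hcd : c < d.
Hypothesis Hf : forall z : C, a <= fst z <= b -> c <= snd z <= d -> exists l, cder f z l.

Let wd (n : nat) : R := (b - a) / 2 ^ n.
Let ht (n : nat) : R := (d - c) / 2 ^ n.
Let cell (n : nat) (p : R * R) : C := RI f (fst p) (fst p + wd n) (snd p) (snd p + ht n).
Let V : R := Cmod (RI f a b c d).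

Let inside (n : nat) (p : R * R) : Prop :=
  a <= fst p /\ fst p + wd n <= b /\ c <= snd p /\ snd p + ht n <= d.

(* Bisection keeps a quarter carrying at least a quarter of the integral. *)
Let next (n : nat) (p : R * R) : R * R :=
  let '(x, y) := p in
  if Rle_dec (V / 4 ^ S n) (Cmod (cell (S n) (x, y))) then (x, y) else
  if Rle_dec (V / 4 ^ S n) (Cmod (cell (S n) (x + wd (S n), y))) then (x + wd (S n), y) else
  if Rle_dec (V / 4 ^ S n) (Cmod (cell (S n) (x, y + ht (S n)))) then (x, y + ht (S n)) else
  (x + wd (S n), y + ht (S n)).

Let corner (n : nat) : R * R := nat_rec (fun _ => R * R)%type (a, c) next n.

Lemma wd_pos (n : nat) : 0 < wd n.
Proof. apply Rdiv_lt_0_compat; [lra|apply pow_lt; lra]. Qed.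

Lemma ht_pos (n : nat) : 0 < ht n.
Proof. apply Rdiv_lt_0_compat; [lra|apply pow_lt; lra]. Qed.

Lemma wd_S (n : nat) : wd n = wd (S n) + wd (S n).
Proof. unfold wd. simpl. field. apply pow_nonzero; lra. Qed.

Lemma ht_S (n : nat) : ht n = ht (S n) + ht (S n).
Proof. unfold ht. simpl. field. apply pow_nonzero; lra. Qed.

Lemma goursat_ccont (z : C) : a <= fst z <= b -> c <= snd z <= d -> ccont f z.
Proof. intros H1 H2. destruct (Hf z H1 H2) as [l Hl]. eapply cder_ccont, Hl. Qed.

Lemma cell_split (n : nat) (x y : R) : inside n (x, y) ->
  cell n (x, y) = (cell (S n) (x, y) + cell (S n) ((x + wd (S n))%R, y) +
    (cell (S n) (x, (y + ht (S n))%R) + cell (S n) ((x + wd (S n))%R, (y + ht (S n))%R)))%C.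
Proof.
  intros (I1 & I2 & I3 & I4); simpl in *. pose proof (wd_pos (S n)). pose proof (ht_pos (S n)).
  rewrite wd_S in I2. rewrite ht_S in I4. unfold cell; simpl fst; simpl snd. rewrite wd_S, ht_S.
  rewrite <- !Rplus_assoc.
  assert (HC : forall u v, x <= u <= x + wd (S n) + wd (S n) -> y <= v <= y + ht (S n) + ht (S n) -> ccont f (u, v))
    by (intros; apply goursat_ccont; simpl; lra).
  rewrite (RI_split_h f _ _ y (y + ht (S n))); try lra; try (intros; apply HC; lra).
  rewrite (RI_split_v f x (x + wd (S n)) _ y), (RI_split_v f x (x + wd (S n)) _ (y + ht (S n)));
    try lra; try (intros; apply HC; lra).
  reflexivity.
Qed.

Lemma next_spec (n : nat) (p : R * R) : inside n p -> V / 4 ^ n <= Cmod (cell n p) ->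
  inside (S n) (next n p) /\ V / 4 ^ S n <= Cmod (cell (S n) (next n p)) /\
  fst p <= fst (next n p) /\ fst (next n p) + wd (S n) <= fst p + wd n /\
  snd p <= snd (next n p) /\ snd (next n p) + ht (S n) <= snd p + ht n.
Proof.
  destruct p as [x y]. intros HI HV. assert (HS := cell_split n x y HI).
  destruct HI as (I1 & I2 & I3 & I4); simpl in I1, I2, I3, I4.
  pose proof (wd_pos (S n)). pose proof (ht_pos (S n)). assert (Ew := wd_S n). assert (Eh := ht_S n).
  unfold next.
  destruct (Rle_dec (V / 4 ^ S n) (Cmod (cell (S n) (x, y)))) as [h1|h1];
    [unfold inside; cbn [fst snd]; repeat split; lra|].
  destruct (Rle_dec (V / 4 ^ S n) (Cmod (cell (S n) (x + wd (S n), y)))) as [h2|h2];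
    [unfold inside; cbn [fst snd]; repeat split; lra|].
  destruct (Rle_dec (V / 4 ^ S n) (Cmod (cell (S n) (x, y + ht (S n))))) as [h3|h3];
    [unfold inside; cbn [fst snd]; repeat split; lra|].
  (* When the other three quarters fall short of the bound, the triangle inequality forces the last
     one to reach it. *)
  assert (h4 : V / 4 ^ S n <= Cmod (cell (S n) (x + wd (S n), y + ht (S n)))).
  { rewrite HS in HV.
    pose proof (Cmod_triangle (cell (S n) (x, y) + cell (S n) (x + wd (S n), y))
      (cell (S n) (x, y + ht (S n)) + cell (S n) (x + wd (S n), y + ht (S n)))) as T1.
    pose proof (Cmod_triangle (cell (S n) (x, y)) (cell (S n) (x + wd (S n), y))) as T2.
    pose proof (Cmod_triangle (cell (S n) (x, y + ht (S n))) (cell (S n) (x + wd (S n), y + ht (S n)))) as T3.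
    replace (V / 4 ^ n) with (4 * (V / 4 ^ S n)) in HV by (simpl; field; apply pow_nonzero; lra). lra. }
  unfold inside; cbn [fst snd]. repeat split; lra.
Qed.

Lemma corner_spec (n : nat) : inside n (corner n) /\ V / 4 ^ n <= Cmod (cell n (corner n)).
Proof.
  induction n as [|n [IH1 IH2]].
  - unfold inside, cell, corner, wd, ht; simpl. replace (a + (b - a) / 1) with b by field.
    replace (c + (d - c) / 1) with d by field. split; [lra|]. right. unfold V. field.
  - change (corner (S n)) with (next n (corner n)). split; apply next_spec; auto.
Qed.

(** Nested intervals in one coordinate; the limit of the left ends lies in all of them. *)
Lemma nested_point (u w : nat -> R) : (forall n, 0 <= w n) ->
  (forall n, u n <= u (S n)) -> (forall n, u (S n) + w (S n) <= u n + w n) ->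
  exists l, forall n, u n <= l <= u n + w n.
Proof.
  intros Hw Hu Hv.
  assert (HB : forall n, u n + w n <= u 0%nat + w 0%nat) by (intros n; induction n as [|n IH]; [lra|specialize (Hv n); lra]).
  destruct (ex_finite_lim_seq_incr u (u 0%nat + w 0%nat) Hu) as [l Hl].
  { intros n. specialize (HB n). specialize (Hw n). lra. }
  exists l. intros n. split.
  - now apply (is_lim_seq_incr_compare u l).
  - assert (HD : is_lim_seq (fun k => u (k + n)%nat) l) by now apply -> is_lim_seq_incr_n.
    assert (Hle : Rbar_le l (u n + w n)).
    { apply (is_lim_seq_le (fun k => u (k + n)%nat) (fun _ => u n + w n)); auto; [|apply is_lim_seq_const].
      intros k. assert (HK : u (k + n)%nat + w (k + n)%nat <= u n + w n)
        by (induction k as [|k IH]; [simpl; lra|specialize (Hv (k + n)%nat); simpl; lra]).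
      specialize (Hw (k + n)%nat). lra. }
    exact Hle.
Qed.

Lemma goursat : RI f a b c d = 0.
Proof.
  assert (HN : forall n, let p := corner n in let p' := corner (S n) in
    fst p <= fst p' /\ fst p' + wd (S n) <= fst p + wd n /\ snd p <= snd p' /\ snd p' + ht (S n) <= snd p + ht n).
  { intros n. destruct (corner_spec n) as [H1 H2]. apply (next_spec n (corner n) H1 H2). }
  destruct (nested_point (fun n => fst (corner n)) wd) as [x Hx];
    try (intros n; try (left; apply wd_pos); apply HN).
  destruct (nested_point (fun n => snd (corner n)) ht) as [y Hy];
    try (intros n; try (left; apply ht_pos); apply HN).
  assert (Hin : a <= x <= b /\ c <= y <= d).
  { specialize (Hx 0%nat). specialize (Hy 0%nat). destruct (corner_spec 0) as [(I1 & I2 & I3 & I4) _].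
    simpl in Hx, Hy. lra. }
  destruct (Hf (x, y) (proj1 Hin) (proj2 Hin)) as [l Hl].
  apply Cmod_eq_0. apply Rle_antisym; [|apply Cmod_ge_0]. fold V.
  set (S0 := b - a + (d - c)). assert (HS0 : 0 < S0) by (unfold S0; lra).
  apply Rnot_lt_le. intros HV.
  (* Chosen so that the bound [4 * S * (e * S)] for a cell with [S = S0 / 2 ^ N] equals half of
     [V / 4 ^ N], against the lower bound kept by the bisection. *)
  set (e := V / (8 * S0 ^ 2)). assert (He : 0 < e) by (apply Rdiv_lt_0_compat; nra).
  destruct (proj1 (ccont_eps _ _) Hl e He) as [dl [Hdl Hs]]. rewrite slope_self in Hs.
  destruct (archimed_cor1 (dl / S0)) as [N [HN1 HN2]]; [apply Rdiv_lt_0_compat; lra|].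
  assert (H2N : INR N <= 2 ^ N).
  { rewrite <- INR_pow2. apply le_INR. pose proof (Nat.pow_gt_lin_r 2 N). lia. }
  assert (HN0 : 0 < INR N) by (apply lt_0_INR; lia).
  assert (Hdiam : wd N + ht N < dl).
  { unfold wd, ht. replace ((b - a) / 2 ^ N + (d - c) / 2 ^ N) with (S0 * / 2 ^ N) by (unfold S0; field; apply pow_nonzero; lra).
    apply Rle_lt_trans with (S0 * / INR N).
    - apply Rmult_le_compat_l; [lra|]. apply Rinv_le_contravar; auto.
    - apply Rlt_le_trans with (S0 * (dl / S0)); [apply Rmult_lt_compat_l; auto|right; field; lra]. }
  destruct (corner_spec N) as [(I1 & I2 & I3 & I4) HVN]. specialize (Hx N). specialize (Hy N).
  destruct (corner N) as [u v]; simpl in *. unfold cell in HVN; simpl in HVN.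
  pose proof (wd_pos N) as Hw. pose proof (ht_pos N) as Hh.
  set (z0 := (x, y) : C) in *.
  assert (Hnear : forall z, on_boundary u (u + wd N) v (v + ht N) z -> Cmod (z - z0) <= wd N + ht N).
  { intros z (B1 & B2 & _). eapply Rle_trans; [apply Cmod_le_add|].
    change (Rabs (fst z - x) + Rabs (snd z - y) <= wd N + ht N).
    assert (Rabs (fst z - x) <= wd N) by (apply Rabs_le; lra).
    assert (Rabs (snd z - y) <= ht N) by (apply Rabs_le; lra). lra. }
  (* [f = Aff + E]: the affine part has a primitive and integrates to 0, and the remainder is at
     most [e] times the distance to [z0]. *)
  set (E := fun z => ((slope f z0 l z - l) * (z - z0))%C).
  set (Aff := fun z => (f z0 + l * (z - z0))%C).
  assert (Hc : bcont u (u + wd N) v (v + ht N) f).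
  { intros z (B1 & B2 & _). apply goursat_ccont; lra. }
  assert (HcA : bcont u (u + wd N) v (v + ht N) Aff).
  { intros z _. apply ccont_plus; [apply ccont_const|]. apply ccont_mult; [apply ccont_const|].
    apply ccont_minus; [apply ccont_id|apply ccont_const]. }
  assert (EE : forall z, E z = (f z + (-1) * Aff z)%C).
  { intros z. unfold E, Aff. rewrite (slope_eq f z0 l z). ring. }
  assert (HcE : bcont u (u + wd N) v (v + ht N) E).
  { intros z Hz. apply (ccont_ext_loc (fun z => f z + (-1) * Aff z)%C _ z 1 Rlt_0_1); [intros; now rewrite EE|].
    apply ccont_plus; auto. apply ccont_mult; auto using ccont_const. }
  assert (HRI : RI f u (u + wd N) v (v + ht N) = RI E u (u + wd N) v (v + ht N)).
  { rewrite (RI_ext u (u + wd N) v (v + ht N) ltac:(lra) ltac:(lra) E (fun z => f z + (-1) * Aff z)%C)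
      by (intros; apply EE).
    rewrite RI_plus, RI_scal; auto; try lra.
    2:{ intros z Hz. apply ccont_mult; auto using ccont_const. }
    rewrite (RI_primitive u (u + wd N) v (v + ht N) ltac:(lra) ltac:(lra)
      (fun z => f z0 * z + l * / 2 * ((z - z0) * (z - z0)))%C Aff); auto; [ring|].
    intros z _. unfold Aff.
    assert (D1 : cder (fun w => w - z0)%C z 1).
    { replace (RtoC 1) with (1 + 0)%C by ring. apply (cder_plus (fun w => w) (fun _ => - z0)%C);
        [apply cder_id|apply cder_const]. }
    assert (D2 := cder_mult _ _ z _ _ (cder_const (l * / 2)%C z) (cder_mult _ _ z _ _ D1 D1)).
    assert (D3 := cder_plus _ _ z _ _ (cder_mult _ _ z _ _ (cder_const (f z0) z) (cder_id z)) D2).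
    cbv beta in D3.
    match type of D3 with cder _ _ ?m => replace (f z0 + l * (z - z0))%C with m end; [exact D3|].
    field. }
  rewrite HRI in HVN.
  assert (HB := RI_bound u (u + wd N) v (v + ht N) ltac:(lra) ltac:(lra) E (e * (wd N + ht N)) HcE).
  assert (HB2 : Cmod (RI E u (u + wd N) v (v + ht N)) <= 4 * (wd N + ht N) * (e * (wd N + ht N))).
  { replace (4 * (wd N + ht N)) with (4 * (u + wd N - u + (v + ht N - v))) by ring. apply HB.
    intros z Hz. unfold E. rewrite Cmod_mult. specialize (Hnear z Hz).
    apply Rmult_le_compat; auto using Cmod_ge_0. left. apply Hs. lra. }
  assert (Hsum : wd N + ht N = S0 / 2 ^ N) by (unfold wd, ht, S0; field; apply pow_nonzero; lra).
  rewrite Hsum in HB2.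
  assert (H4 : 2 ^ N * 2 ^ N = 4 ^ N) by (rewrite <- Rpow_mult_distr; f_equal; ring).
  assert (Hp : 0 < 2 ^ N) by (apply pow_lt; lra).
  replace (4 * (S0 / 2 ^ N) * (e * (S0 / 2 ^ N))) with (/ 2 * (V / 4 ^ N)) in HB2
    by (unfold e; rewrite <- H4; field; split; lra).
  assert (0 < V / 4 ^ N) by (apply Rdiv_lt_0_compat; [auto|apply pow_lt; lra]). lra.
Qed.

End Goursat.

(** * Taylor expansion of entire functions *)

Definition centire (f : C -> C) : Prop := forall z, exists l, cder f z l.

Lemma slope_cder (f : C -> C) (z l w : C) : w <> z -> (exists m, cder f w m) -> exists m, cder (slope f z l) w m.
Proof.
  intros Hwz [m Hm].
  assert (Hn : (w - z <> 0)%C) by (intros E; apply Hwz; now apply Cminus_eq_0).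
  assert (D1 : cder (fun w => w - z)%C w (1 + 0)%C)
    by (apply (cder_plus (fun w => w) (fun _ => - z)%C); [apply cder_id|apply cder_const]).
  assert (D2 := cder_mult _ _ w _ _ (cder_plus f (fun _ => - f z)%C w _ _ Hm (cder_const _ w))
     (cder_inv _ w _ D1 Hn)).
  eexists. eapply (cder_intro _ _ w _ (Cmod (w - z))); [now apply Cmod_gt_0| |apply slope_self|exact D2].
  intros x Hx.
  assert (Es : forall y, y <> z -> slope f z l y = ((f y + - f z) * / (y - z))%C).
  { intros y Hy. unfold slope. destruct (excluded_middle_informative (y = z)); [congruence|reflexivity]. }
  rewrite (Es w Hwz), (Es x); [exact (slope_eq (fun y => (f y + - f z) * / (y - z))%C w _ x)|].
  intros ->. replace (z - w)%C with (- (w - z))%C in Hx by ring. rewrite Cmod_opp in Hx. lra.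
Qed.

(** Away from [z] the slope is holomorphic, so [goursat] shrinks the contour to an arbitrarily small
    square around [z]. There the slope is bounded by continuity, and the integral is at most a
    constant times the side. *)
Lemma slope_integral (f : C -> C) (T : R) (z l : C) : centire f -> Cmod z < T -> cder f z l ->
  RI (slope f z l) (- T) T (- T) T = 0.
Proof.
  intros Hf HT Hl. set (g := slope f z l). set (u := fst z). set (v := snd z).
  assert (Hu : Rabs u < T) by (eapply Rle_lt_trans; [apply (Re_le_Cmod z)|auto]).
  assert (Hv : Rabs v < T) by (eapply Rle_lt_trans; [apply (Im_le_Cmod z)|auto]).
  assert (Hu' := Rabs_def2 _ _ Hu). assert (Hv' := Rabs_def2 _ _ Hv).
  assert (Hc : forall w, ccont g w).
  { intros w. destruct (excluded_middle_informative (w = z)) as [->|Hn]; [exact Hl|].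
    destruct (slope_cder f z l w Hn (Hf w)) as [m Hm]. eapply cder_ccont, Hm. }
  assert (HG : forall a b c d, a < b -> c < d -> ~ (a <= u <= b /\ c <= v <= d) -> RI g a b c d = 0).
  { intros a b c d Hab Hcd Hn. apply goursat; auto. intros w Hw1 Hw2. apply slope_cder; auto.
    intros ->. apply Hn. split; auto. }
  assert (Hsmall : forall r, 0 < r -> r < T - Rabs u -> r < T - Rabs v ->
    RI g (- T) T (- T) T = RI g (u - r) (u + r) (v - r) (v + r)).
  { intros r Hr Hru Hrv.
    assert (- T < u - r) by (unfold Rabs in Hru; destruct (Rcase_abs u); lra).
    assert (u + r < T) by (unfold Rabs in Hru; destruct (Rcase_abs u); lra).
    assert (- T < v - r) by (unfold Rabs in Hrv; destruct (Rcase_abs v); lra).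
    assert (v + r < T) by (unfold Rabs in Hrv; destruct (Rcase_abs v); lra).
    rewrite (RI_split_v g (- T) (u - r)), (RI_split_v g (u - r) (u + r)); auto; try lra.
    rewrite (HG (- T) (u - r)), (HG (u + r) T); try lra.
    rewrite (RI_split_h g (u - r) (u + r) (- T) (v - r)), (RI_split_h g (u - r) (u + r) (v - r) (v + r)); auto; try lra.
    rewrite (HG (u - r) (u + r) (- T)), (HG (u - r) (u + r) (v + r)); try lra. ring. }
  destruct (proj1 (ccont_eps _ _) (Hc z) 1 Rlt_0_1) as [dl [Hdl Hs]].
  unfold g at 2 in Hs. rewrite slope_self in Hs.
  assert (HM : forall r, 0 < r -> r < T - Rabs u -> r < T - Rabs v -> r < dl / 2 ->
    (* The 16 comes from [RI_bound] on a square of side [2 r], as [4 * (2 r + 2 r)]; [Cmod l + 1]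
       bounds the slope near [z]. *)
    Cmod (RI g (- T) T (- T) T) <= r * (16 * (Cmod l + 1))).
  { intros r Hr Hru Hrv Hrd. rewrite (Hsmall r) by auto.
    replace (r * (16 * (Cmod l + 1))) with (4 * (u + r - (u - r) + (v + r - (v - r))) * (Cmod l + 1)) by ring.
    apply RI_bound; try lra; [intros w _; apply Hc|].
    intros w (W1 & W2 & _). assert (Hwz : Cmod (w - z) < dl).
    { eapply Rle_lt_trans; [apply Cmod_le_add|].
      change (Rabs (fst w - u) + Rabs (snd w - v) < dl).
      assert (Rabs (fst w - u) <= r) by (apply Rabs_le; lra).
      assert (Rabs (snd w - v) <= r) by (apply Rabs_le; lra). lra. }
    specialize (Hs w Hwz). replace (g w) with (l + (g w - l))%C by ring.
    eapply Rle_trans; [apply Cmod_triangle|]. lra. }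
  apply Cmod_eq_0. apply Rle_antisym; [|apply Cmod_ge_0]. apply Rnot_lt_le. intros HV.
  set (K := 16 * (Cmod l + 1)) in *. assert (HK : 0 < K) by (unfold K; pose proof (Cmod_ge_0 l); lra).
  set (V := Cmod (RI g (- T) T (- T) T)) in *.
  set (r := Rmin (Rmin ((T - Rabs u) / 2) ((T - Rabs v) / 2)) (Rmin (dl / 4) (V / (2 * K)))).
  assert (0 < V / (2 * K)) by (apply Rdiv_lt_0_compat; lra).
  assert (Hr : 0 < r) by (unfold r; repeat apply Rmin_pos; lra).
  assert (R1 : r <= (T - Rabs u) / 2) by (eapply Rle_trans; [apply Rmin_l|apply Rmin_l]).
  assert (R2 : r <= (T - Rabs v) / 2) by (eapply Rle_trans; [apply Rmin_l|apply Rmin_r]).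
  assert (R3 : r <= dl / 4) by (eapply Rle_trans; [apply Rmin_r|apply Rmin_l]).
  assert (R4 : r <= V / (2 * K)) by (eapply Rle_trans; [apply Rmin_r|apply Rmin_r]).
  specialize (HM r Hr ltac:(lra) ltac:(lra) ltac:(lra)).
  assert (r * K <= V / (2 * K) * K) by (apply Rmult_le_compat_r; lra).
  replace (V / (2 * K) * K) with (V / 2) in * by (field; lra). lra.
Qed.

Lemma path_bounded (f : C -> C) (g : R -> C) (a b : R) : (forall z, ccont f z) ->
  (forall t, continuous (T := R_UniformSpace) (U := C_UniformSpace) g t) ->
  exists M, forall x, a <= x <= b -> Cmod (f (g x)) <= M.
Proof.
  intros H Hg.
  destruct (bounded_continuity (V := R_NormedModule) (fun x => Re (f (g x))) a b) as [M1 H1];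
    [intros x _; now apply (ccont_path f g x)|].
  destruct (bounded_continuity (V := R_NormedModule) (fun x => Im (f (g x))) a b) as [M2 H2];
    [intros x _; now apply (ccont_path f g x)|].
  exists (M1 + M2). intros x Hx. specialize (H1 x Hx). specialize (H2 x Hx).
  change (Rabs (Re (f (g x))) < M1) in H1. change (Rabs (Im (f (g x))) < M2) in H2.
  eapply Rle_trans; [apply Cmod_le_add|]. lra.
Qed.

Lemma boundary_bounded (f : C -> C) (T : R) : (forall z, ccont f z) ->
  exists M, 0 < M /\ forall z, on_boundary (- T) T (- T) T z -> Cmod (f z) <= M.
Proof.
  intros H.
  destruct (path_bounded f _ (- T) T H (continuous_hline (- T))) as [M1 H1].
  destruct (path_bounded f _ (- T) T H (continuous_hline T)) as [M2 H2].
  destruct (path_bounded f _ (- T) T H (continuous_vline (- T))) as [M3 H3].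
  destruct (path_bounded f _ (- T) T H (continuous_vline T)) as [M4 H4].
  exists (Rabs M1 + Rabs M2 + Rabs M3 + Rabs M4 + 1).
  pose proof (Rabs_pos M1). pose proof (Rabs_pos M2). pose proof (Rabs_pos M3). pose proof (Rabs_pos M4).
  pose proof (Rle_abs M1). pose proof (Rle_abs M2). pose proof (Rle_abs M3). pose proof (Rle_abs M4).
  split; [lra|]. intros [x y] (B1 & B2 & B3); simpl in *.
  destruct B3 as [E|[E|[E|E]]]; rewrite E.
  - specialize (H3 y B2). lra.
  - specialize (H4 y B2). lra.
  - specialize (H1 x B1). lra.
  - specialize (H2 x B1). lra.
Qed.

Fixpoint csum (a : nat -> C) (z : C) (n : nat) : C :=
  match n with O => 0%C | S m => (csum a z m + a m * z ^ m)%C end.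

Section Taylor.
Variable T : R.
Hypothesis HT : 0 < T.

Let Q (f : C -> C) : C := RI f (- T) T (- T) T.
Let bd (w : C) : Prop := on_boundary (- T) T (- T) T w.

Lemma bd_Cmod (w : C) : bd w -> T <= Cmod w.
Proof.
  intros (_ & _ & H).
  assert (H1 := Re_le_Cmod w). assert (H2 := Im_le_Cmod w). unfold Re, Im in *.
  destruct H as [H|[H|[H|H]]]; rewrite H in *; rewrite ?Rabs_Ropp in *; rewrite Rabs_pos_eq in * by lra; lra.
Qed.

Lemma bd_neq_0 (w : C) : bd w -> w <> 0.
Proof. intros H E. apply bd_Cmod in H. rewrite E, Cmod_0 in H. lra. Qed.

Lemma bd_minus (w z : C) : bd w -> T - Cmod z <= Cmod (w - z).
Proof.
  intros H. apply bd_Cmod in H. assert (H1 := Cmod_triangle (w - z) z).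
  replace (w - z + z)%C with w in H1 by ring. lra.
Qed.

Lemma bd_minus_neq (w z : C) : bd w -> Cmod z < T -> (w - z <> 0)%C.
Proof.
  intros H Hz E. apply (bd_minus w z) in H. rewrite E, Cmod_0 in H. lra.
Qed.

(** Remainder term of the finite geometric expansion: [/ (w - z)] is the sum of
    [z ^ k / w ^ (k + 1)] over [k < n] plus [z ^ n / (w ^ n (w - z))]. Integrating it against [f]
    gives [kernel_expand]. *)
Let kernel (f : C -> C) (z : C) (n : nat) (w : C) : C := (f w * (/ w ^ n * / (w - z)))%C.
Let coef (f : C -> C) (n : nat) : C := Q (fun w => f w * / w ^ S n)%C.

Lemma ccont_pow_inv (n : nat) (w : C) : w <> 0 -> ccont (fun w => / w ^ n)%C w.
Proof.
  intros Hw. apply ccont_inv; [|now apply Cpow_nz].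
  induction n as [|n IH]; [apply ccont_const|]. apply ccont_mult; [apply ccont_id|exact IH].
Qed.

Lemma kernel_bcont (f : C -> C) (z : C) (n : nat) : (forall w, ccont f w) -> Cmod z < T ->
  bcont (- T) T (- T) T (kernel f z n).
Proof.
  intros Hf Hz w Hw. apply ccont_mult; auto. apply ccont_mult; [apply ccont_pow_inv; now apply bd_neq_0|].
  apply ccont_inv; [|now apply bd_minus_neq].
  apply ccont_minus; [apply ccont_id|apply ccont_const].
Qed.

Lemma coef_bcont (f : C -> C) (n : nat) : (forall w, ccont f w) ->
  bcont (- T) T (- T) T (fun w => f w * / w ^ n)%C.
Proof. intros Hf w Hw. apply ccont_mult; auto. apply ccont_pow_inv. now apply bd_neq_0. Qed.

Lemma kernel_step (f : C -> C) (z : C) (n : nat) : (forall w, ccont f w) -> Cmod z < T ->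
  Q (kernel f z n) = (coef f n + z * Q (kernel f z (S n)))%C.
Proof.
  intros Hf Hz. unfold coef, Q.
  rewrite <- RI_scal by (try lra; now apply kernel_bcont).
  rewrite <- RI_plus; try lra; [|now apply coef_bcont|].
  2:{ intros w Hw. apply ccont_mult; [apply ccont_const|]. now apply kernel_bcont. }
  apply RI_ext; try lra. intros w Hw. unfold kernel. rewrite !Cpow_S.
  assert (w <> 0) by now apply bd_neq_0. assert (Hwz := bd_minus_neq w z Hw Hz).
  assert (w ^ n <> 0)%C by now apply Cpow_nz. field. auto.
Qed.

Lemma kernel_expand (f : C -> C) (z : C) (N : nat) : (forall w, ccont f w) -> Cmod z < T ->
  Q (kernel f z 0) = (csum (coef f) z N + z ^ N * Q (kernel f z N))%C.
Proof.
  intros Hf Hz. induction N as [|N IH]; [simpl; ring|].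
  rewrite IH, (kernel_step f z N) by auto. simpl. ring.
Qed.

Lemma kernel_bound (f : C -> C) (z : C) (M : R) (N : nat) : (forall w, ccont f w) -> Cmod z < T ->
  (forall w, bd w -> Cmod (f w) <= M) ->
  Cmod (z ^ N * Q (kernel f z N)) <= 16 * T * M * (Cmod z / T) ^ N / (T - Cmod z).
Proof.
  intros Hf Hz HM. rewrite Cmod_mult, Cmod_pow.
  assert (HTN : 0 < T ^ N) by (now apply pow_lt).
  assert (HB : Cmod (Q (kernel f z N)) <= 4 * (T - - T + (T - - T)) * (M * (/ T ^ N * / (T - Cmod z)))).
  { apply (RI_bound (- T) T (- T) T ltac:(lra) ltac:(lra) (kernel f z N)); [apply kernel_bcont; auto|].
    intros w Hw. unfold kernel.
    assert (H1 := bd_Cmod w Hw). assert (H2 := bd_minus w z Hw).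
    assert (Hw0 := bd_neq_0 w Hw). assert (Hwz := bd_minus_neq w z Hw Hz).
    rewrite !Cmod_mult, !Cmod_inv by (auto; now apply Cpow_nz). rewrite Cmod_pow.
    apply Rmult_le_compat; auto using Cmod_ge_0.
    - apply Rmult_le_pos; left; apply Rinv_0_lt_compat; [apply pow_lt; lra|lra].
    - apply Rmult_le_compat; try (left; apply Rinv_0_lt_compat; try apply pow_lt; lra).
      + apply Rinv_le_contravar; auto. apply pow_incr. lra.
      + apply Rinv_le_contravar; lra. }
  unfold Rdiv. rewrite Rpow_mult_distr, pow_inv.
  assert (0 <= Cmod z ^ N) by (apply pow_le, Cmod_ge_0).
  apply Rle_trans with (Cmod z ^ N * (4 * (T - - T + (T - - T)) * (M * (/ T ^ N * / (T - Cmod z))))).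
  - apply Rmult_le_compat_l; auto.
  - right. ring.
Qed.

Lemma coef_one (n : nat) : coef (fun _ => RtoC 1) (S n) = 0.
Proof.
  unfold coef, Q.
  apply (RI_primitive (- T) T (- T) T ltac:(lra) ltac:(lra) (fun w => (- / INR (S n)) * / w ^ S n)%C).
  - intros w Hw. assert (Hw0 := bd_neq_0 w Hw).
    assert (D := cder_mult _ _ w _ _ (cder_const (- / INR (S n))%C w)
      (cder_inv _ w _ (cder_pow (fun w => w) w 1 n (cder_id w)) (Cpow_nz w (S n) Hw0))).
    cbv beta in D.
    match type of D with cder _ _ ?m => replace (1 * / w ^ S (S n))%C with m end; [exact D|].
    rewrite !Cpow_S. assert (w ^ n <> 0)%C by now apply Cpow_nz.
    assert (HI : RtoC (INR (S n)) <> 0) by (intros EI; apply RtoC_inj in EI; pose proof (INR_S_ge_1 n); lra).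
    field. auto.
  - intros w Hw. apply (coef_bcont (fun _ => RtoC 1) (S (S n))); auto. intros; apply ccont_const.
Qed.

(** The integral of [/ w] around the square is never evaluated: it only has to be nonzero. Each of
    the four sides contributes the same positive integral to its imaginary part. *)
Lemma coef_one_0 : coef (fun _ => RtoC 1) 0 <> 0.
Proof.
  intros E. apply (f_equal Im) in E. unfold coef, Q, RI in E.
  assert (Hpos : 0 < RInt (fun t => T / (T ^ 2 + t ^ 2)) (- T) T).
  { apply RInt_gt_0; try lra.
    - intros t _. apply Rdiv_lt_0_compat; nra.
    - intros t _. apply (ex_derive_continuous (V := R_NormedModule)). auto_derive. nra. }
  assert (E1 : Im (CI (on_hline (fun w => 1 * / w ^ 1)%C (- T)) (- T) T) = RInt (fun t => T / (T ^ 2 + t ^ 2)) (- T) T).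
  { unfold CI, on_hline; simpl. apply RInt_ext. intros t _. unfold Cmult, Cinv; simpl. field. nra. }
  assert (E2 : Im (CI (on_hline (fun w => 1 * / w ^ 1)%C T) (- T) T) = - RInt (fun t => T / (T ^ 2 + t ^ 2)) (- T) T).
  { unfold CI, on_hline; simpl. rewrite <- (RInt_opp (V := R_CompleteNormedModule)).
    - apply RInt_ext. intros t _. unfold Cmult, Cinv, opp; simpl. field. nra.
    - apply (ex_RInt_continuous (V := R_CompleteNormedModule)). intros t _.
      apply (ex_derive_continuous (V := R_NormedModule)). auto_derive. nra. }
  assert (E3 : Re (CI (on_vline (fun w => 1 * / w ^ 1)%C T) (- T) T) = RInt (fun t => T / (T ^ 2 + t ^ 2)) (- T) T).
  { unfold CI, on_vline; simpl. apply RInt_ext. intros t _. unfold Cmult, Cinv; simpl. field. nra. }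
  assert (E4 : Re (CI (on_vline (fun w => 1 * / w ^ 1)%C (- T)) (- T) T) = - RInt (fun t => T / (T ^ 2 + t ^ 2)) (- T) T).
  { unfold CI, on_vline; simpl. rewrite <- (RInt_opp (V := R_CompleteNormedModule)).
    - apply RInt_ext. intros t _. unfold Cmult, Cinv, opp; simpl. field. nra.
    - apply (ex_RInt_continuous (V := R_CompleteNormedModule)). intros t _.
      apply (ex_derive_continuous (V := R_NormedModule)). auto_derive. nra. }
  set (c1 := CI (on_hline _ (- T)) _ _) in *. set (c2 := CI (on_hline _ T) _ _) in *.
  set (c3 := CI (on_vline _ T) _ _) in *. set (c4 := CI (on_vline _ (- T)) _ _) in *.
  clearbody c1 c2 c3 c4. unfold Im, Re in *. unfold Cminus, Cplus, Copp, Cmult, Ci, RtoC in E; simpl in E. lra.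
Qed.

(** The integral of [/ (w - z)] is independent of [z]: by [coef_one] only the first coefficient of
    its geometric expansion survives, and the remainder tends to 0. *)
Lemma kernel_one (z : C) : Cmod z < T -> Q (kernel (fun _ => RtoC 1) z 0) = coef (fun _ => RtoC 1) 0.
Proof.
  intros Hz. apply Cminus_eq_0, Cmod_eq_0.
  set (K := 16 * T * 1 / (T - Cmod z)).
  assert (H : forall N, Cmod (Q (kernel (fun _ => RtoC 1) z 0) - coef (fun _ => RtoC 1) 0)%C <= K * (Cmod z / T) ^ S N).
  { intros N. rewrite (kernel_expand (fun _ => RtoC 1) z (S N)) by (auto; intros; apply ccont_const).
    replace (csum (coef (fun _ => RtoC 1)) z (S N)) with (coef (fun _ => RtoC 1) 0).
    - match goal with |- Cmod ?x <= _ => replace x with (z ^ S N * Q (kernel (fun _ => RtoC 1) z (S N)))%C by ring end.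
      eapply Rle_trans; [apply (kernel_bound _ z 1); auto|].
      + intros; apply ccont_const.
      + intros w _. rewrite Cmod_1. lra.
      + right. unfold K, Rdiv. ring.
    - induction N as [|N IH]; [simpl; ring|].
      change (csum (coef (fun _ => RtoC 1)) z (S (S N))) with
        (csum (coef (fun _ => RtoC 1)) z (S N) + coef (fun _ => RtoC 1) (S N) * z ^ S N)%C.
      rewrite <- IH, coef_one. ring. }
  apply Rle_antisym; [|apply Cmod_ge_0].
  assert (Hq := ratio_bounds (Cmod z) T (conj (Cmod_ge_0 z) Hz)).
  assert (HL : is_lim_seq (fun N => K * (Cmod z / T) ^ S N) (K * 0)).
  { apply (is_lim_seq_scal_l _ K (Finite 0)). apply -> (is_lim_seq_incr_1 (fun N => (Cmod z / T) ^ N)).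
    apply is_lim_seq_geom. rewrite Rabs_pos_eq; lra. }
  assert (HLe := is_lim_seq_le _ _ _ _ H (is_lim_seq_const _) HL). simpl in HLe. lra.
Qed.

(** The vanishing integral of the slope says that the integral of [f w / (w - z)] is [f z] times
    that of [/ (w - z)], which is the constant [J]. Dividing by [J] gives Cauchy's formula, and the
    geometric expansion of the kernel the Taylor polynomial with its error. *)
Theorem taylor (f : C -> C) : centire f -> exists (a : nat -> C) (K : R), 0 <= K /\
  forall N z, Cmod z < T -> Cmod (f z - csum a z N) <= K * (Cmod z / T) ^ N / (T - Cmod z).
Proof.
  intros Hf.
  assert (Hc : forall z, ccont f z) by (intros z; destruct (Hf z) as [l Hl]; eapply cder_ccont, Hl).
  set (J := coef (fun _ => RtoC 1) 0). assert (HJ : J <> 0) by apply coef_one_0.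
  destruct (boundary_bounded f T Hc) as [M [HM HMb]].
  exists (fun n => / J * coef f n)%C, (/ Cmod J * (16 * T * M)).
  assert (HJp : 0 < / Cmod J) by (apply Rinv_0_lt_compat; now apply Cmod_gt_0).
  split; [apply Rmult_le_pos; nra|]. intros N z Hz.
  destruct (Hf z) as [l Hl].
  assert (E : Q (kernel f z 0) = (f z * J)%C).
  { unfold J. rewrite <- (kernel_one z Hz). unfold Q.
    rewrite <- RI_scal; try lra; [|apply kernel_bcont; auto; intros; apply ccont_const].
    assert (HS := slope_integral f T z l Hf Hz Hl).
    replace (RI (fun w => f z * kernel (fun _ => RtoC 1) z 0 w)%C (- T) T (- T) T) with
      (RI (slope f z l) (- T) T (- T) T + RI (fun w => f z * kernel (fun _ => RtoC 1) z 0 w)%C (- T) T (- T) T)%C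
      by (rewrite HS; ring).
    rewrite <- RI_plus; try lra.
    - apply RI_ext; try lra. intros w Hw. assert (Hwz := bd_minus_neq w z Hw Hz).
      unfold kernel. rewrite (slope_eq f z l w). simpl. field. auto.
    - intros w Hw. assert (Hwz := bd_minus_neq w z Hw Hz).
      destruct (slope_cder f z l w) as [m Hm]; [|auto|eapply cder_ccont, Hm].
      intros ->. apply Hwz. ring.
    - intros w Hw. apply ccont_mult; [apply ccont_const|]. apply kernel_bcont; auto. intros; apply ccont_const. }
  assert (Hsum : csum (fun n => / J * coef f n)%C z N = (/ J * csum (coef f) z N)%C).
  { induction N as [|N IH]; simpl; [ring|]. rewrite IH. ring. }
  rewrite Hsum.
  replace (f z - / J * csum (coef f) z N)%C with (/ J * (z ^ N * Q (kernel f z N)))%C.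
  - rewrite Cmod_mult, Cmod_inv by auto.
    replace (/ Cmod J * (16 * T * M) * (Cmod z / T) ^ N / (T - Cmod z)) with
      (/ Cmod J * (16 * T * M * (Cmod z / T) ^ N / (T - Cmod z))) by (unfold Rdiv; ring).
    apply Rmult_le_compat_l; [lra|]. now apply kernel_bound.
  - replace (f z) with (/ J * Q (kernel f z 0))%C by (rewrite E; field; auto).
    rewrite (kernel_expand f z N) by auto. ring.
Qed.

End Taylor.

(** * Two-sided Laplace integrals *)

(** Integer symmetric cutoffs give an ordinary sequence limit; [LI_approx] shows that other cutoffs
    lead to the same value. *)
Definition LI (p : R -> R) : R := real (Lim_seq (fun N => RInt p (- INR N) (INR N))).

(** Both constants are tracked: [K] provides the majorants when series are integrated termwise, and
    [A] is the radius of convergence in [laplace_expansion]. *)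
Definition lap (p : R -> R) (K A : R) : Prop :=
  0 < A /\ (forall u, continuous p u) /\ forall u, Rabs (p u) <= K * exp (- (A * Rabs u)).

Lemma ex_RInt_cont (p : R -> R) (a b : R) : (forall u, continuous p u) -> ex_RInt p a b.
Proof. intros H. apply (ex_RInt_continuous (V := R_CompleteNormedModule)). intros; apply H. Qed.

Lemma lap_K_nonneg (p : R -> R) (K A : R) : lap p K A -> 0 <= K.
Proof.
  intros (HA & _ & H). specialize (H 0). rewrite Rabs_R0, Rmult_0_r, Ropp_0, exp_0 in H.
  pose proof (Rabs_pos (p 0)). lra.
Qed.

Lemma RInt_reflect (p : R -> R) (a b : R) : (forall u, continuous p u) ->
  RInt (fun u => p (- u)) a b = RInt p (- b) (- a).
Proof.
  intros Hp.
  assert (H1 := RInt_comp_lin (V := R_CompleteNormedModule) p (-1) 0 a b (ex_RInt_cont _ _ _ Hp)).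
  assert (H2 := opp_RInt_swap (V := R_CompleteNormedModule) p (- a) (- b) (ex_RInt_cont _ _ _ Hp)).
  rewrite (RInt_ext _ (fun u => -1 * p (- u))) in H1.
  2:{ intros u _. unfold scal; simpl; unfold mult; simpl. f_equal. f_equal. ring. }
  replace (-1 * a + 0) with (- a) in H1 by ring. replace (-1 * b + 0) with (- b) in H1 by ring.
  assert (H3 := RInt_scal (V := R_CompleteNormedModule) (fun u => p (- u)) a b (-1)).
  assert (Hc : forall u, continuous (fun u => p (- u)) u).
  { intros u. apply (continuous_comp Ropp p); auto.
    apply (continuous_opp (V := R_NormedModule)), continuous_id. }
  specialize (H3 (ex_RInt_cont _ _ _ Hc)).
  change (RInt (fun u => -1 * p (- u)) a b = -1 * RInt (fun u => p (- u)) a b) in H3.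
  change (- RInt p (- a) (- b) = RInt p (- b) (- a)) in H2. lra.
Qed.

Lemma RInt_tail (p : R -> R) (K A x y : R) : lap p K A -> 0 <= x <= y ->
  Rabs (RInt p x y) <= K / A * exp (- (A * x)).
Proof.
  intros HL Hxy. assert (HK := lap_K_nonneg p K A HL). destruct HL as (HA & Hc & HB).
  assert (HI : is_RInt (fun u => K * exp (- (A * u))) x y (K / A * (exp (- (A * x)) - exp (- (A * y))))).
  { replace (K / A * (exp (- (A * x)) - exp (- (A * y)))) with
      (minus (- (K / A) * exp (- (A * y))) (- (K / A) * exp (- (A * x))))
      by (unfold minus, plus, opp; simpl; ring).
    apply (is_RInt_derive (V := R_CompleteNormedModule) (fun u => - (K / A) * exp (- (A * u)))).
    - intros u _. auto_derive; auto. field. lra.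
    - intros u _. smooth. }
  eapply Rle_trans; [apply abs_RInt_le; [lra|now apply ex_RInt_cont]|].
  eapply Rle_trans; [apply (RInt_le _ (fun u => K * exp (- (A * u)))); [lra| |eexists; exact HI|]|].
  - apply ex_RInt_cont. intros u. apply (continuous_comp p Rabs); auto. apply continuous_Rabs.
  - intros u Hu. eapply Rle_trans; [apply HB|]. rewrite (Rabs_pos_eq u); lra.
  - rewrite (is_RInt_unique _ _ _ _ HI). pose proof (exp_pos (- (A * y))).
    assert (0 <= K / A) by (apply Rmult_le_pos; [auto|left; now apply Rinv_0_lt_compat]). nra.
Qed.

Lemma lap_reflect (p : R -> R) (K A : R) : lap p K A -> lap (fun u => p (- u)) K A.
Proof.
  intros (HA & Hc & HB). split; [auto|split].
  - intros u. apply (continuous_comp Ropp p); auto.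
    apply (continuous_opp (V := R_NormedModule)), continuous_id.
  - intros u. rewrite <- (Rabs_Ropp u). apply HB.
Qed.

Lemma RInt_tail_neg (p : R -> R) (K A x y : R) : lap p K A -> 0 <= x <= y ->
  Rabs (RInt p (- y) (- x)) <= K / A * exp (- (A * x)).
Proof.
  intros HL Hxy. assert (Hc := proj1 (proj2 HL)).
  rewrite <- (RInt_reflect p x y Hc). apply (RInt_tail (fun u => p (- u))); auto. now apply lap_reflect.
Qed.

Lemma RInt_nested (p : R -> R) (K A a b x : R) : lap p K A -> 0 <= x -> a <= - x -> x <= b ->
  Rabs (RInt p a b - RInt p (- x) x) <= 2 * (K / A) * exp (- (A * x)).
Proof.
  intros HL Hx Ha Hb. assert (Hc := proj1 (proj2 HL)).
  assert (E : RInt p a b = RInt p a (- x) + RInt p (- x) x + RInt p x b).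
  { assert (E1 := RInt_Chasles (V := R_CompleteNormedModule) p a (- x) x
      (ex_RInt_cont _ _ _ Hc) (ex_RInt_cont _ _ _ Hc)).
    assert (E2 := RInt_Chasles (V := R_CompleteNormedModule) p a x b
      (ex_RInt_cont _ _ _ Hc) (ex_RInt_cont _ _ _ Hc)).
    unfold plus in E1, E2; simpl in E1, E2. lra. }
  assert (B1 := RInt_tail p K A x b HL ltac:(lra)).
  assert (B2 := RInt_tail_neg p K A x (- a) HL ltac:(lra)). rewrite Ropp_involutive in B2.
  rewrite E. apply Rabs_le_between in B1. apply Rabs_le_between in B2. apply Rabs_le. lra.
Qed.

Lemma exp_neg_INR_lim (A : R) : 0 < A -> is_lim_seq (fun N => exp (- (A * INR N))) 0.
Proof.
  intros HA. apply (is_lim_seq_ext (fun N => exp (- A) ^ N)).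
  - intros n. rewrite exp_pow. f_equal. ring.
  - apply is_lim_seq_geom. pose proof (exp_neg_lt_1 A HA). rewrite Rabs_pos_eq; lra.
Qed.

Lemma LI_lim (p : R -> R) (K A : R) : lap p K A ->
  is_lim_seq (fun N => RInt p (- INR N) (INR N)) (LI p).
Proof.
  intros HL. apply Lim_seq_correct'. apply ex_lim_seq_cauchy_corr. intros e.
  assert (HK := lap_K_nonneg p K A HL). assert (HA := proj1 HL).
  assert (H0 := exp_neg_INR_lim A HA). apply (is_lim_seq_scal_l _ (2 * (K / A))) in H0.
  apply is_lim_seq_spec in H0. simpl Rbar_mult in H0. rewrite Rmult_0_r in H0.
  destruct e as [e He]. assert (He2 : 0 < e / 2) by lra.
  destruct (H0 (mkposreal _ He2)) as [N HN]. specialize (HN N (le_n _)). simpl in HN.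
  rewrite Rminus_0_r in HN. apply Rabs_def2 in HN.
  assert (HB : forall n, (N <= n)%nat -> Rabs (RInt p (- INR n) (INR n) - RInt p (- INR N) (INR N)) < e / 2).
  { intros n Hn. apply le_INR in Hn. eapply Rle_lt_trans; [apply (RInt_nested p K A); auto using pos_INR; lra|lra]. }
  exists N. intros n m Hn Hm. simpl. assert (B1 := HB n Hn). assert (B2 := HB m Hm).
  apply Rabs_def2 in B1. apply Rabs_def2 in B2. apply Rabs_def1; lra.
Qed.

Lemma LI_approx (p : R -> R) (K A a b x : R) : lap p K A -> 0 <= x -> a <= - x -> x <= b ->
  Rabs (RInt p a b - LI p) <= 4 * (K / A) * exp (- (A * x)).
Proof.
  intros HL Hx Ha Hb. assert (HK := lap_K_nonneg p K A HL). assert (HA := proj1 HL).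
  assert (B1 := RInt_nested p K A a b x HL Hx Ha Hb).
  enough (B2 : Rabs (LI p - RInt p (- x) x) <= 2 * (K / A) * exp (- (A * x))).
  { apply Rabs_le_between in B1. apply Rabs_le_between in B2. apply Rabs_le. lra. }
  assert (HLim := LI_lim p K A HL).
  assert (H1 : is_lim_seq (fun N => Rabs (RInt p (- INR N) (INR N) - RInt p (- x) x)) (Rabs (LI p - RInt p (- x) x))).
  { apply (is_lim_seq_abs _ (Finite _)). apply is_lim_seq_minus'; auto. apply is_lim_seq_const. }
  destruct (nfloor_ex x Hx) as [n0 Hn0].
  assert (Hev : eventually (fun N => Rabs (RInt p (- INR N) (INR N) - RInt p (- x) x) <= 2 * (K / A) * exp (- (A * x)))).
  { exists (S n0). intros n Hn. apply le_INR in Hn. rewrite S_INR in Hn.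
    apply (RInt_nested p K A); auto; lra. }
  assert (HLe := is_lim_seq_le_loc _ _ _ _ Hev H1 (is_lim_seq_const _)).
  exact HLe.
Qed.

Lemma LI_bound (p : R -> R) (K A : R) : lap p K A -> Rabs (LI p) <= 4 * (K / A).
Proof.
  intros HL. assert (H := LI_approx p K A 0 0 0 HL ltac:(lra) ltac:(lra) ltac:(lra)).
  rewrite Rmult_0_r, Ropp_0, exp_0 in H. rewrite (RInt_point (V := R_CompleteNormedModule)) in H.
  unfold zero in H; simpl in H. rewrite <- Rabs_Ropp. replace (- LI p) with (0 - LI p) by ring. lra.
Qed.

Lemma LI_ext (p q : R -> R) : (forall u, p u = q u) -> LI p = LI q.
Proof.
  intros H. unfold LI. f_equal. apply Lim_seq_ext. intros n. apply RInt_ext. intros; apply H.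
Qed.

Lemma lap_plus (p q : R -> R) (K L A : R) : lap p K A -> lap q L A -> lap (fun u => p u + q u) (K + L) A.
Proof.
  intros (HA & Hc & HB) (_ & Hc' & HB'). split; [auto|split].
  - intros u. apply (continuous_plus (V := R_NormedModule)); auto.
  - intros u. eapply Rle_trans; [apply Rabs_triang|]. specialize (HB u). specialize (HB' u). lra.
Qed.

Lemma lap_scal (c : R) (p : R -> R) (K A : R) : lap p K A -> lap (fun u => c * p u) (Rabs c * K) A.
Proof.
  intros (HA & Hc & HB). split; [auto|split].
  - intros u. apply (continuous_scal_r (V := R_NormedModule) c p), Hc.
  - intros u. rewrite Rabs_mult, Rmult_assoc. apply Rmult_le_compat_l; auto using Rabs_pos.
Qed.

Lemma LI_plus (p q : R -> R) (K L A : R) : lap p K A -> lap q L A ->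
  LI (fun u => p u + q u) = LI p + LI q.
Proof.
  intros Hp Hq. assert (H1 := LI_lim _ _ _ Hp). assert (H2 := LI_lim _ _ _ Hq).
  assert (H3 := LI_lim _ _ _ (lap_plus _ _ _ _ _ Hp Hq)).
  assert (H4 := is_lim_seq_plus' _ _ _ _ H1 H2).
  apply is_lim_seq_unique in H3. apply is_lim_seq_unique in H4.
  rewrite (Lim_seq_ext _ (fun N => RInt p (- INR N) (INR N) + RInt q (- INR N) (INR N))) in H3.
  - rewrite H4 in H3. now injection H3.
  - intros n. apply (RInt_plus (V := R_CompleteNormedModule)); apply ex_RInt_cont; [apply Hp|apply Hq].
Qed.

Lemma LI_scal (c : R) (p : R -> R) (K A : R) : lap p K A -> LI (fun u => c * p u) = c * LI p.
Proof.
  intros Hp. assert (H1 := LI_lim _ _ _ Hp).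
  assert (H3 := LI_lim _ _ _ (lap_scal c _ _ _ Hp)).
  assert (H4 := is_lim_seq_scal_l _ c _ H1).
  apply is_lim_seq_unique in H3. apply is_lim_seq_unique in H4.
  rewrite (Lim_seq_ext _ (fun N => c * RInt p (- INR N) (INR N))) in H3.
  - rewrite H4 in H3. now injection H3.
  - intros n. apply (RInt_scal (V := R_CompleteNormedModule)); apply ex_RInt_cont, Hp.
Qed.

Lemma LI_shift (p : R -> R) (K A h : R) : lap p K A -> LI (fun u => p (u + h)) = LI p.
Proof.
  intros Hp. unfold LI at 1.
  assert (HL : is_lim_seq (fun N => RInt (fun u => p (u + h)) (- INR N) (INR N)) (LI p)).
  (* For the cutoff [n + S n0] the shifted window still contains the interval from [- n] to [n]. *)
  { destruct (nfloor_ex (Rabs h) (Rabs_pos h)) as [n0 Hn0]. apply (is_lim_seq_incr_n _ (S n0)).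
    apply (is_lim_seq_of_bound _ (fun N => exp (- (A * INR N))) _ (4 * (K / A))).
    2: apply exp_neg_INR_lim, Hp.
    intros n. replace (RInt (fun u => p (u + h)) (- INR (n + S n0)) (INR (n + S n0))) with
      (RInt p (1 * - INR (n + S n0) + h) (1 * INR (n + S n0) + h)).
    - pose proof (pos_INR n). rewrite plus_INR, S_INR. pose proof (Rle_abs h). pose proof (Rle_abs (- h)) as Hm.
      rewrite Rabs_Ropp in Hm. apply (LI_approx p K A); auto; lra.
    - rewrite <- (RInt_comp_lin (V := R_CompleteNormedModule) p 1 h) by (apply ex_RInt_cont, Hp).
      apply RInt_ext. intros u _. unfold scal; simpl; unfold mult; simpl. rewrite !Rmult_1_l. reflexivity. }
  now rewrite (is_lim_seq_unique _ _ HL).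
Qed.

Lemma LI_reflect (p : R -> R) (K A : R) : lap p K A -> LI (fun u => p (- u)) = LI p.
Proof.
  intros Hp. unfold LI. f_equal. apply Lim_seq_ext. intros n.
  rewrite RInt_reflect by apply Hp. f_equal. ring.
Qed.

Lemma LI_nonneg (p : R -> R) (K A : R) : lap p K A -> (forall u, 0 <= p u) -> 0 <= LI p.
Proof.
  intros Hp H. assert (HL := LI_lim _ _ _ Hp).
  assert (Hge : forall n, 0 <= RInt p (- INR n) (INR n)).
  { intros n. pose proof (pos_INR n). apply RInt_ge_0; auto; [lra|]. apply ex_RInt_cont, Hp. }
  assert (HLe := is_lim_seq_le (fun _ => 0) _ 0 _ Hge (is_lim_seq_const _) HL).
  exact HLe.
Qed.

(** Strict positivity is asked on an interval only, since the integrands [p u * u ^ m] may vanish at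
    0. *)
Lemma LI_pos (p : R -> R) (K A : R) : lap p K A -> (forall u, 0 <= p u) -> (forall u, 0 < u < 1 -> 0 < p u) ->
  0 < LI p.
Proof.
  intros Hp H H1. assert (HL := LI_lim _ _ _ Hp). assert (Hc := proj1 (proj2 Hp)).
  apply Rlt_le_trans with (RInt p 0 1).
  - apply RInt_gt_0; auto; lra.
  - assert (HLe := is_lim_seq_le (fun _ => RInt p 0 1) (fun n => RInt p (- INR (S n)) (INR (S n))) (RInt p 0 1) (LI p)).
    apply HLe; [|apply is_lim_seq_const|now apply -> (is_lim_seq_incr_1 (fun N => RInt p (- INR N) (INR N)))].
    intros n. pose proof (INR_S_ge_1 n).
    assert (E1 := RInt_Chasles (V := R_CompleteNormedModule) p (- INR (S n)) 0 (INR (S n))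
      (ex_RInt_cont _ _ _ Hc) (ex_RInt_cont _ _ _ Hc)).
    assert (E2 := RInt_Chasles (V := R_CompleteNormedModule) p 0 1 (INR (S n))
      (ex_RInt_cont _ _ _ Hc) (ex_RInt_cont _ _ _ Hc)).
    unfold plus in E1, E2; simpl plus in E1, E2.
    assert (0 <= RInt p (- INR (S n)) 0) by (apply RInt_ge_0; auto; [lra|now apply ex_RInt_cont]).
    assert (0 <= RInt p 1 (INR (S n))) by (apply RInt_ge_0; auto; now apply ex_RInt_cont).
    change (RInt p (- INR (S n)) 0 + RInt p 0 (INR (S n)) = RInt p (- INR (S n)) (INR (S n))) in E1.
    change (RInt p 0 1 + RInt p 1 (INR (S n)) = RInt p 0 (INR (S n))) in E2. lra.
Qed.

Lemma lap_sum_n (p : nat -> R -> R) (v : nat -> R) (A : R) (N : nat) :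
  (forall n, lap (p n) (v n) A) ->
  lap (fun u => sum_n (fun n => p n u) N) (sum_n v N) A /\
  LI (fun u => sum_n (fun n => p n u) N) = sum_n (fun n => LI (p n)) N.
Proof.
  intros H. assert (HS : forall n (g : nat -> R), sum_n g (S n) = sum_n g n + g (S n)) by (intros n g; exact (sum_Sn g n)).
  assert (HO : forall (g : nat -> R), sum_n g 0 = g 0%nat) by (intros g; exact (sum_O g)).
  induction N as [|N [IH1 IH2]].
  - split.
    + rewrite HO. destruct (H 0%nat) as (HA & Hc & HB). split; [auto|split].
      * intros u. exact (continuous_ext (p 0%nat) _ u (fun x => eq_sym (HO (fun n => p n x))) (Hc u)).
      * intros u. rewrite HO. apply HB.
    + rewrite HO. apply LI_ext. intros; apply HO.
  - assert (HP := lap_plus _ _ _ _ _ IH1 (H (S N))). split.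
    + rewrite HS. destruct HP as (HA & Hc & HB). split; [auto|split].
      * intros u. exact (continuous_ext _ _ u (fun x => eq_sym (HS N (fun n => p n x))) (Hc u)).
      * intros u. rewrite HS. apply HB.
    + rewrite HS, <- IH2, <- (LI_plus _ _ _ _ _ IH1 (H (S N))). apply LI_ext. intros; apply HS.
Qed.

(** The remainder after [N] terms again satisfies [lap], with a tail of [v] as its constant, so
    [LI_bound] controls its integral. *)
Lemma LI_series (p : nat -> R -> R) (q : R -> R) (v : nat -> R) (A : R) :
  (forall n, lap (p n) (v n) A) -> ex_series v -> (forall u, continuous q u) ->
  (forall u, is_series (fun n => p n u) (q u)) ->
  lap q (Series v) A /\ is_series (fun n => LI (p n)) (LI q).
Proof.
  intros Hp Hv Hc Hq. assert (HA : 0 < A) by apply (Hp 0%nat).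
  assert (Hb : forall n u, Rabs (p n u) <= v n * exp (- (A * Rabs u))) by (intros; apply Hp).
  assert (HqB : lap q (Series v) A).
  { split; [auto|split; auto]. intros u. rewrite <- (is_series_unique _ _ (Hq u)).
    rewrite Rmult_comm, <- Series_scal_l. apply Series_dom.
    - intros n. rewrite Rmult_comm. apply Hb.
    - now apply ex_series_Rscal. }
  split; auto.
  apply (is_lim_seq_of_bound _ (fun N => Series (fun k => v (S N + k)%nat)) _ (4 / A)); [|now apply Series_tail].
  intros N. destruct (lap_sum_n p v A N Hp) as [HS1 HS2].
  match goal with |- Rabs (?x - _) <= _ => replace x with (LI (fun u => sum_n (fun n => p n u) N)) by exact HS2 end.
  rewrite <- Rabs_Ropp.
  replace (- (LI (fun u => sum_n (fun n => p n u) N) - LI q)) with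
    (LI q + -1 * LI (fun u => sum_n (fun n => p n u) N)) by ring.
  rewrite <- (LI_scal (-1) _ _ _ HS1), <- (LI_plus _ _ _ _ _ HqB (lap_scal (-1) _ _ _ HS1)).
  replace (4 / A * Series (fun k => v (S N + k)%nat)) with (4 * (Series (fun k => v (S N + k)%nat) / A)) by (field; lra).
  apply LI_bound. destruct (lap_plus _ _ _ _ _ HqB (lap_scal (-1) _ _ _ HS1)) as (_ & HC & _).
  split; [auto|split; auto]. intros u.
  assert (Hex : ex_series (fun n => p n u)) by (eexists; apply Hq).
  rewrite <- (is_series_unique _ _ (Hq u)), (Series_split _ N Hex).
  match goal with |- Rabs ?x <= _ => replace x with (Series (fun k => p (S N + k)%nat u)) by ring end.
  rewrite Rmult_comm, <- Series_scal_l. apply Series_dom.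
  - intros n. rewrite Rmult_comm. apply Hb.
  - apply ex_series_Rscal. now apply (ex_series_incr_n v (S N)).
Qed.

Lemma exp_series_term (x : R) (n : nat) : 0 <= x -> x ^ n / INR (fact n) <= exp x.
Proof.
  intros Hx. assert (H := is_exp_Reals x). unfold is_pseries in H.
  assert (H2 : is_series (fun n => x ^ n / INR (fact n)) (exp x)).
  { eapply is_series_ext; [|exact H]. intros k. rewrite pow_n_pow. reflexivity. }
  assert (Hp : forall k, 0 <= x ^ k / INR (fact k)).
  { intros k. apply Rmult_le_pos; [now apply pow_le|left; apply Rinv_0_lt_compat, INR_fact_lt_0]. }
  rewrite <- (is_series_unique _ _ H2), (Series_split _ n (ex_intro _ _ H2)).
  assert (0 <= Series (fun k => x ^ (S n + k) / INR (fact (S n + k)))).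
  { apply Series_nonneg; auto. apply -> (ex_series_incr_n (fun k => x ^ k / INR (fact k)) (S n)). eexists; exact H2. }
  enough (x ^ n / INR (fact n) <= sum_n (fun k => x ^ k / INR (fact k)) n) by lra.
  rewrite <- psum_sum_n. simpl.
  enough (0 <= psum (fun k => x ^ k / INR (fact k)) n) by lra.
  clear - Hp. induction n as [|n IH]; simpl; [lra|]. specialize (Hp n). lra.
Qed.

Lemma lap_moment (p : R -> R) (K A : R) (n : nat) : lap p K A -> exists L, lap (fun u => p u * u ^ n) L (A / 2).
Proof.
  intros Hp. assert (HK := lap_K_nonneg _ _ _ Hp). destruct Hp as (HA & Hc & HB).
  destruct (pow_exp_bound n (A / 2)) as [L [HL HLb]]; [lra|].
  exists (K * L). split; [lra|split].
  - intros u. apply (continuous_mult (K := R_AbsRing) p (fun u => u ^ n)); auto.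
    smooth.
  - intros u. rewrite Rabs_mult, <- RPow_abs. pose proof (Rabs_pos u) as Hu.
    specialize (HLb (Rabs u) Hu). specialize (HB u).
    pose proof (exp_pos (- (A / 2 * Rabs u))). assert (0 <= Rabs u ^ n) by (now apply pow_le).
    apply Rle_trans with (K * exp (- (A * Rabs u)) * Rabs u ^ n); [now apply Rmult_le_compat_r|].
    replace (- (A * Rabs u)) with (- (A / 2 * Rabs u) + - (A / 2 * Rabs u)) by field. rewrite exp_plus.
    replace (K * (exp (- (A / 2 * Rabs u)) * exp (- (A / 2 * Rabs u))) * Rabs u ^ n) with
      (K * (Rabs u ^ n * exp (- (A / 2 * Rabs u))) * exp (- (A / 2 * Rabs u))) by ring.
    apply Rmult_le_compat_r; [lra|]. apply Rmult_le_compat_l; auto.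
Qed.

Lemma laplace_expansion (p : R -> R) (K A x : R) : lap p K A -> Rabs x < A ->
  is_series (fun n => LI (fun u => p u * u ^ n) / INR (fact n) * x ^ n) (LI (fun u => p u * exp (x * u))).
Proof.
  intros Hp Hx. assert (HK := lap_K_nonneg _ _ _ Hp).
  (* An intermediate rate: [(rho |u|) ^ n / n! <= exp (rho |u|)] leaves the geometric factor
     [(|x| / rho) ^ n] for the sum and the decay [A - rho] for the integral. *)
  set (rho := (Rabs x + A) / 2). pose proof (Rabs_pos x) as Hx0.
  assert (Hrho : Rabs x < rho < A) by (unfold rho; lra).
  set (pn := fun n u => x ^ n / INR (fact n) * (p u * u ^ n)).
  assert (Hpn : forall n, lap (pn n) (K * (Rabs x / rho) ^ n) (A - rho)).
  { intros n. destruct Hp as (HA & Hc & HB). split; [lra|split].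
    - intros u. apply (continuous_scal_r (V := R_NormedModule) (x ^ n / INR (fact n)) (fun u => p u * u ^ n)).
      apply (continuous_mult (K := R_AbsRing) p (fun u => u ^ n)); auto.
      smooth.
    - intros u. unfold pn. specialize (HB u). pose proof (Rabs_pos u) as Hu.
      assert (Hf := INR_fact_lt_0 n).
      assert (HE := exp_series_term (rho * Rabs u) n ltac:(apply Rmult_le_pos; lra)).
      unfold Rdiv. rewrite !Rabs_mult, <- !RPow_abs, (Rabs_pos_eq (/ _)) by (left; now apply Rinv_0_lt_compat).
      replace (Rabs x ^ n * / INR (fact n) * (Rabs (p u) * Rabs u ^ n)) with
        (Rabs (p u) * ((Rabs x * / rho) ^ n * ((rho * Rabs u) ^ n / INR (fact n)))).
      2:{ rewrite !Rpow_mult_distr, pow_inv. field. split; [lra|apply pow_nonzero; lra]. }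
      replace (K * (Rabs x * / rho) ^ n * exp (- ((A - rho) * Rabs u))) with
        (K * exp (- (A * Rabs u)) * ((Rabs x * / rho) ^ n * exp (rho * Rabs u))).
      2:{ replace (- ((A - rho) * Rabs u)) with (- (A * Rabs u) + rho * Rabs u) by ring. rewrite exp_plus. ring. }
      assert (0 <= (Rabs x * / rho) ^ n).
      { apply pow_le, Rmult_le_pos; [lra|left; apply Rinv_0_lt_compat; lra]. }
      apply Rmult_le_compat; auto using Rabs_pos.
      + apply Rmult_le_pos; auto. apply Rmult_le_pos; [apply pow_le, Rmult_le_pos; lra|left; now apply Rinv_0_lt_compat].
      + apply Rmult_le_compat_l; auto. }
  assert (Hv : ex_series (fun n => K * (Rabs x / rho) ^ n)).
  { apply ex_series_Rscal, ex_series_geom, ratio_bounds. lra. }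
  destruct (LI_series pn (fun u => p u * exp (x * u)) _ _ Hpn Hv) as [_ HS].
  - intros u. apply (continuous_mult (K := R_AbsRing) p (fun u => exp (x * u))); [apply Hp|].
    smooth.
  - intros u. assert (H := is_exp_Reals (x * u)). unfold is_pseries in H.
    apply (is_series_Rscal (p u)) in H. eapply is_series_ext; [|exact H].
    intros n. cbv beta. rewrite pow_n_pow. unfold pn.
    change (p u * ((x * u) ^ n * / INR (fact n)) = x ^ n / INR (fact n) * (p u * u ^ n)).
    rewrite Rpow_mult_distr. unfold Rdiv. ring.
  - eapply is_series_ext; [|exact HS]. intros n. unfold pn.
    destruct (lap_moment p K A n Hp) as [L HL]. rewrite (LI_scal _ _ _ _ HL).
    match goal with |- ?a = ?b => change (@eq R a b) end. unfold Rdiv. ring.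
Qed.

(* [(2 pi) ^ (- w) Gamma w] as a Laplace integral. *)
Definition gamma_kernel (w u : R) : R := exp (w * u - 2 * PI * exp u).

Definition gam (w : R) : R := LI (gamma_kernel w).

Lemma exp_dominates (a : R) : 0 < a -> exists L, 0 < L /\ forall v, exp (a * v - 2 * PI * exp v) <= L.
Proof.
  (* The exponent is concave in [v] and maximal at [exp v = M]; bounding [exp] from below by its
     tangent at [ln M] gives the maximum. *)
  intros Ha. pose proof PI_RGT_0. set (M := a / (2 * PI)). assert (HM : 0 < M) by (apply Rdiv_lt_0_compat; lra).
  exists (exp (a * (ln M - 1))). split; [apply exp_pos|]. intros v. apply exp_le.
  assert (H1 : M * (1 + (v - ln M)) <= exp v).
  { replace v with (ln M + (v - ln M)) at 2 by ring. rewrite exp_plus, exp_ln by auto.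
    apply Rmult_le_compat_l; [lra|].
    destruct (Req_dec (v - ln M) 0) as [->|Hn]; [rewrite exp_0; lra|left; now apply exp_ineq1]. }
  assert (H2 : 2 * PI * (M * (1 + (v - ln M))) <= 2 * PI * exp v) by (apply Rmult_le_compat_l; lra).
  replace (2 * PI * (M * (1 + (v - ln M)))) with (a * (1 + (v - ln M))) in H2 by (unfold M; field; lra). nra.
Qed.

Lemma continuous_gamma_kernel (w u : R) : continuous (gamma_kernel w) u.
Proof. unfold gamma_kernel. smooth. Qed.

(** On the right, dominating the exponent [w + w] leaves a factor [exp (- w u)]; on the left
    [exp (w u)] is itself the decay. *)
Lemma lap_gamma (w : R) : 0 < w -> exists L, lap (gamma_kernel w) L w.
Proof.
  intros Hw. pose proof PI_RGT_0. destruct (exp_dominates (w + w)) as [L [HL HLb]]; [lra|].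
  exists (L + 1). split; [auto|split; [apply continuous_gamma_kernel|]].
  intros u. unfold gamma_kernel. rewrite Rabs_pos_eq by (left; apply exp_pos).
  destruct (Rle_dec 0 u) as [Hu|Hu].
  - rewrite Rabs_pos_eq by auto. specialize (HLb u).
    replace (w * u - 2 * PI * exp u) with (((w + w) * u - 2 * PI * exp u) + - (w * u)) by ring.
    rewrite exp_plus. apply Rmult_le_compat_r; [left; apply exp_pos|lra].
  - rewrite Rabs_left by lra. replace (- (w * - u)) with (w * u) by ring.
    apply Rle_trans with (1 * exp (w * u)).
    + rewrite Rmult_1_l. apply exp_le. pose proof (exp_pos u). nra.
    + apply Rmult_le_compat_r; [left; apply exp_pos|lra].
Qed.

Lemma gam_pos (w : R) : 0 < w -> 0 < gam w.
Proof.
  intros Hw. destruct (lap_gamma w Hw) as [L HL]. apply (LI_pos _ _ _ HL); intros; [left|]; apply exp_pos.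
Qed.

Lemma gam_expansion (w x : R) : 0 < w -> Rabs x < w ->
  is_series (fun n => LI (fun u => gamma_kernel w u * u ^ n) / INR (fact n) * x ^ n) (gam (w + x)).
Proof.
  intros Hw Hx. destruct (lap_gamma w Hw) as [L HL].
  assert (H := laplace_expansion _ _ _ x HL Hx).
  replace (gam (w + x)) with (LI (fun u => gamma_kernel w u * exp (x * u))); auto.
  apply LI_ext. intros u. unfold gamma_kernel. rewrite <- exp_plus. f_equal. ring.
Qed.

(** * Mellin transforms of exponential series *)

(** The integral of [F y * y ^ w] against [dy / y], in the variable [y = exp u]. *)
Definition mellin (F : R -> R) (w : R) : R := LI (fun u => F (exp u) * exp (w * u)).

(** A translation of [u] by [ln n] turns the [n]-th term into [n ^ (- w)] times the Gamma kernel.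
    Bounding the translated kernel uniformly costs one factor [n], so the majorant is
    [n ^ (a - w + 1)], which is at most [n ^ (-2)] for [w >= a + 3]. *)
Lemma mellin_dirichlet (t : nat -> R) (F : R -> R) (B a w : R) :
  0 <= B -> (forall n, Rabs (t n) <= B * Rpower (INR (S n)) a) ->
  (forall y, 0 < y -> is_series (fun n => t n * exp (- (2 * PI * y * INR (S n)))) (F y)) ->
  (forall y, 0 < y -> continuous F y) ->
  1 < w -> a + 3 <= w ->
  is_series (fun n => t n * Rpower (INR (S n)) (- w) * gam w) (mellin F w).
Proof.
  intros HB Ht HF Hc Hw1 Haw. pose proof PI_RGT_0.
  destruct (exp_dominates (w - 1)) as [K1 [HK1 HK1b]]; [lra|].
  destruct (exp_dominates (w + 1)) as [K2 [HK2 HK2b]]; [lra|].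
  set (pn := fun n u => t n * exp (- (2 * PI * exp u * INR (S n))) * exp (w * u)).
  assert (Epn : forall n u, pn n u = t n * Rpower (INR (S n)) (- w) * gamma_kernel w (u + ln (INR (S n)))).
  { intros n u. pose proof (INR_S_ge_1 n). unfold pn, gamma_kernel, Rpower.
    rewrite (exp_plus u), exp_ln by lra. rewrite !Rmult_assoc, <- !exp_plus. do 2 f_equal. ring. }
  set (K := K1 + K2).
  assert (Hpn : forall n, lap (pn n) (B * K * / INR (S n) ^ 2) 1).
  { intros n. split; [lra|split].
    - intros u. unfold pn. smooth.
    - intros u. rewrite Epn. pose proof (INR_S_ge_1 n). set (m := INR (S n)) in *.
      assert (Hln : 0 <= ln m) by (rewrite <- ln_1; apply ln_le; lra).
      rewrite !Rabs_mult, (Rabs_pos_eq (Rpower _ _)), (Rabs_pos_eq (gamma_kernel _ _)) by (left; apply exp_pos).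
      assert (HR : Rabs (t n) * Rpower m (- w) <= B * Rpower m (a - w)).
      { replace (a - w) with (a + - w) by ring. rewrite Rpower_plus, <- Rmult_assoc.
        apply Rmult_le_compat_r; [left; apply exp_pos|apply Ht]. }
      assert (HG : gamma_kernel w (u + ln m) <= K * m * exp (- (1 * Rabs u))).
      { unfold gamma_kernel, K. destruct (Rle_dec 0 u) as [Hu|Hu].
        - rewrite (Rabs_pos_eq u) by auto. specialize (HK2b (u + ln m)).
          replace (w * (u + ln m) - 2 * PI * exp (u + ln m)) with
            (((w + 1) * (u + ln m) - 2 * PI * exp (u + ln m)) + (- u + - ln m)) by ring.
          rewrite exp_plus, (exp_plus (- u)).
          replace (- (1 * u)) with (- u) by ring.
          replace ((K1 + K2) * m * exp (- u)) with ((K1 + K2) * (exp (- u) * m)) by ring.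
          pose proof (exp_pos (- u)).
          apply Rmult_le_compat; [left; apply exp_pos|left; apply Rmult_lt_0_compat; apply exp_pos|lra|].
          apply Rmult_le_compat_l; [lra|]. apply Rle_trans with (exp 0); [apply exp_le; lra|rewrite exp_0; lra].
        - rewrite (Rabs_left u) by lra. specialize (HK1b (u + ln m)).
          replace (w * (u + ln m) - 2 * PI * exp (u + ln m)) with
            (((w - 1) * (u + ln m) - 2 * PI * exp (u + ln m)) + (u + ln m)) by ring.
          rewrite exp_plus. set (e1 := exp ((w - 1) * (u + ln m) - 2 * PI * exp (u + ln m))) in *.
          rewrite (exp_plus u), (exp_ln m) by lra.
          replace (- (1 * - u)) with u by ring.
          replace ((K1 + K2) * m * exp u) with ((K1 + K2) * (exp u * m)) by ring.
          pose proof (exp_pos u). apply Rmult_le_compat_r; [apply Rmult_le_pos; lra|lra]. }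
      apply Rle_trans with (B * Rpower m (a - w) * (K * m * exp (- (1 * Rabs u)))).
      + apply Rmult_le_compat; auto; [|left; apply exp_pos]. apply Rmult_le_pos; [apply Rabs_pos|left; apply exp_pos].
      + replace (B * Rpower m (a - w) * (K * m * exp (- (1 * Rabs u)))) with
          (B * K * (Rpower m (a - w) * m) * exp (- (1 * Rabs u))) by ring.
        apply Rmult_le_compat_r; [left; apply exp_pos|]. apply Rmult_le_compat_l; [apply Rmult_le_pos; [auto|unfold K; lra]|].
        replace (/ m ^ 2) with (Rpower m (-2)).
        2:{ rewrite <- (Rpower_pow 2) by lra. rewrite <- Rpower_Ropp. reflexivity. }
        rewrite <- (Rpower_1 m) at 2 by lra. rewrite <- Rpower_plus. apply Rle_Rpower; lra. }
  assert (Hv : ex_series (fun n => B * K * / INR (S n) ^ 2)) by apply ex_series_Rscal, ex_series_inv_sqr.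
  destruct (LI_series pn (fun u => F (exp u) * exp (w * u)) _ _ Hpn Hv) as [_ HS].
  - intros u. apply (continuous_mult (K := R_AbsRing) (fun u => F (exp u)) (fun u => exp (w * u))).
    + apply (continuous_comp exp F); [|apply Hc, exp_pos].
      smooth.
    + smooth.
  - intros u. assert (HFu := is_series_Rscal (exp (w * u)) _ _ (HF (exp u) (exp_pos u))).
    rewrite (Rmult_comm (F (exp u))). eapply is_series_ext; [|exact HFu].
    intros n. unfold pn. apply Rmult_comm.
  - eapply is_series_ext; [|exact HS]. intros n.
    destruct (lap_gamma w) as [L HL]; [lra|].
    assert (Hsh : exists L', lap (fun u => gamma_kernel w (u + ln (INR (S n)))) L' w).
    { destruct HL as (HA & HcL & HBL). exists (L * exp (w * Rabs (ln (INR (S n))))). split; [auto|split].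
      - intros u. apply (continuous_comp (fun u => u + ln (INR (S n))) (gamma_kernel w)); [|apply HcL].
        smooth.
      - intros u. eapply Rle_trans; [apply HBL|]. rewrite Rmult_assoc, <- exp_plus.
        apply Rmult_le_compat_l; [apply (lap_K_nonneg (gamma_kernel w) L w); repeat split; auto|].
        apply exp_le. assert (Rabs u <= Rabs (u + ln (INR (S n))) + Rabs (ln (INR (S n)))); [|nra].
        replace u with ((u + ln (INR (S n))) + - ln (INR (S n))) at 1 by ring.
        eapply Rle_trans; [apply Rabs_triang|]. rewrite Rabs_Ropp. lra. }
    destruct Hsh as [L' HL'].
    rewrite (LI_ext (pn n) _ (Epn n)), (LI_scal _ _ _ _ HL').
    f_equal. apply (LI_shift _ _ _ _ HL).
Qed.

(** * Analytic continuation along the real line *)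

Definition expands (f : R -> R) (b r : R) (a : nat -> R) : Prop :=
  0 < r /\ forall x, Rabs x < r -> is_series (fun n => a n * x ^ n) (f (b + x)).

Lemma pseries_abs (a : nat -> R) (l r x : R) : Rabs x < r -> is_series (fun n => a n * r ^ n) l ->
  exists M, 0 < M /\ forall n, Rabs (a n * x ^ n) <= M * (Rabs x / r) ^ n.
Proof.
  intros Hx H. destruct (is_series_terms_bounded _ _ H) as [M [HM HB]]. exists M. split; auto.
  intros n. pose proof (Rabs_pos x). specialize (HB n).
  rewrite Rabs_mult, (Rabs_pos_eq (r ^ n)) in HB by (apply pow_le; lra).
  rewrite Rabs_mult, <- RPow_abs. assert (Hr : 0 < r ^ n) by (apply pow_lt; lra).
  replace (Rabs x ^ n) with (r ^ n * (Rabs x / r) ^ n).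
  - rewrite <- Rmult_assoc. apply Rmult_le_compat_r; auto.
    apply pow_le, Rmult_le_pos; [lra|left; apply Rinv_0_lt_compat; lra].
  - unfold Rdiv. rewrite Rpow_mult_distr, pow_inv. field. lra.
Qed.

Lemma expands_abs (f : R -> R) (b r : R) (a : nat -> R) (x : R) : expands f b r a -> Rabs x < r ->
  ex_series (fun n => Rabs (a n * x ^ n)).
Proof.
  intros [Hr H] Hx. pose proof (Rabs_pos x).
  set (s := (Rabs x + r) / 2). assert (Hs : Rabs x < s < r) by (unfold s; lra).
  destruct (pseries_abs a _ s x ltac:(lra) (H s ltac:(rewrite Rabs_pos_eq; lra))) as [M [HM HB]].
  apply (ex_series_dom _ (fun n => M * (Rabs x / s) ^ n)).
  - intros n. rewrite Rabs_Rabsolu. apply HB.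
  - apply ex_series_Rscal, ex_series_geom, ratio_bounds. lra.
Qed.

(** Both expansions have the same centre and radius, so agreement just to the right of the centre
    identifies the coefficients and carries over to the whole interval at once. *)
Lemma expands_unique (f g : R -> R) (b r d : R) (a c : nat -> R) : expands f b r a -> expands g b r c ->
  0 < d -> (forall x, 0 < x < d -> f (b + x) = g (b + x)) ->
  forall x, Rabs x < r -> f (b + x) = g (b + x).
Proof.
  intros [Hr Hf] [_ Hg] Hd H x Hx.
  assert (Hac : forall n, a n = c n).
  { intros n. apply Rminus_diag_uniq. revert n. apply (power_series_zero _ (Rmin d r)); [now apply Rmin_pos|].
    intros y Hy. assert (Hyd : y < d) by (eapply Rlt_le_trans; [apply Hy|apply Rmin_l]).
    assert (Hyr : y < r) by (eapply Rlt_le_trans; [apply Hy|apply Rmin_r]).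
    assert (H1 := Hf y ltac:(rewrite Rabs_pos_eq; lra)). assert (H2 := Hg y ltac:(rewrite Rabs_pos_eq; lra)).
    rewrite <- (H y) in H2 by lra. assert (H3 := is_series_minus _ _ _ _ H1 H2).
    match type of H3 with is_series _ ?l => replace l with 0 in H3 by (unfold minus, plus, opp; simpl; ring) end.
    eapply is_series_ext; [|exact H3]. intros n. unfold minus, plus, opp; simpl. ring. }
  rewrite <- (is_series_unique _ _ (Hf x Hx)), <- (is_series_unique _ _ (Hg x Hx)).
  apply Series_ext. intros n. now rewrite Hac.
Qed.

Lemma expands_mult (f g : R -> R) (b r : R) (a c : nat -> R) : expands f b r a -> expands g b r c ->
  exists e, expands (fun x => f x * g x) b r e.
Proof.
  intros Hf Hg. exists (fun n => sum_f_R0 (fun k => a k * c (n - k)%nat) n). split; [apply Hf|].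
  intros x Hx.
  assert (H := is_series_mult _ _ _ _ (proj2 Hf x Hx) (proj2 Hg x Hx) (expands_abs _ _ _ _ x Hf Hx)
    (expands_abs _ _ _ _ x Hg Hx)).
  eapply is_series_ext; [|exact H]. intros n. cbv beta.
  rewrite (Rmult_comm (sum_f_R0 _ _)), scal_sum. apply sum_eq. intros k Hk.
  assert (E : x ^ n = x ^ k * x ^ (n - k)) by (rewrite <- pow_add; f_equal; lia). rewrite E. ring.
Qed.

Lemma expands_zero (b r : R) : 0 < r -> expands (fun _ => 0) b r (fun _ => 0).
Proof.
  intros Hr. split; auto. intros x _. assert (H := is_series_finite (fun n => 0 * x ^ n) 0).
  simpl in H. apply H. intros; ring.
Qed.

Lemma expands_derive (f : R -> R) (b r : R) (a : nat -> R) : expands f b r a -> is_derive f b (a 1%nat).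
Proof.
  intros [Hr H]. set (s := r / 2). assert (Hs : 0 < s < r) by (unfold s; lra).
  destruct (is_series_terms_bounded _ _ (H s ltac:(rewrite Rabs_pos_eq; lra))) as [M [HM HB]].
  assert (H0 : f b = a 0%nat).
  { assert (E := H 0 ltac:(rewrite Rabs_R0; lra)). rewrite Rplus_0_r in E.
    rewrite <- (is_series_unique _ _ E), (Series_head _ (ex_intro _ _ E)).
    rewrite (Series_ext _ (fun n => 0 * 0)) by (intros; simpl; ring). rewrite Series_scal_l. simpl. ring. }
  assert (HQ : forall x, Rabs x < s / 2 -> Rabs (f (b + x) - f b - a 1%nat * x) <= 2 * M / s ^ 2 * x ^ 2).
  { intros x Hx. pose proof (Rabs_pos x). assert (E := H x ltac:(lra)). assert (Hex := ex_intro _ _ E : ex_series _).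
    rewrite <- (is_series_unique _ _ E), (Series_split _ 1 Hex), H0.
    replace (sum_n (fun n => a n * x ^ n) 1) with (a 0%nat + a 1%nat * x)
      by (rewrite <- psum_sum_n; simpl; ring).
    match goal with |- Rabs ?y <= _ => replace y with (Series (fun k => a (2 + k)%nat * x ^ (2 + k))) by (simpl; ring) end.
    replace (2 * M / s ^ 2 * x ^ 2) with (Series (fun k => M / s ^ 2 * x ^ 2 * (/ 2) ^ k)).
    2:{ rewrite Series_scal_l, Series_geom by (rewrite Rabs_pos_eq; lra). field. lra. }
    apply Series_dom.
    - intros k. specialize (HB (2 + k)%nat). rewrite pow_add in HB. rewrite pow_add.
      assert (Hsk : 0 < s ^ k) by (apply pow_lt; lra). assert (Hs2 : 0 < s ^ 2) by nra.
      rewrite !Rabs_mult, (Rabs_pos_eq (s ^ 2)), (Rabs_pos_eq (s ^ k)) in HB by lra.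
      rewrite !Rabs_mult, (Rabs_pos_eq (x ^ 2)) by nra. rewrite <- (RPow_abs x k).
      assert (Hxk : Rabs x ^ k <= (s * / 2) ^ k) by (apply pow_incr; lra).
      rewrite Rpow_mult_distr in Hxk.
      assert (0 <= x ^ 2) by nra. pose proof (Rabs_pos (a (2 + k)%nat)).
      apply Rle_trans with (Rabs (a (2 + k)%nat) * (x ^ 2 * (s ^ k * (/ 2) ^ k))).
      + apply Rmult_le_compat_l; auto. apply Rmult_le_compat_l; auto.
      + replace (Rabs (a (2 + k)%nat) * (x ^ 2 * (s ^ k * (/ 2) ^ k))) with
          (Rabs (a (2 + k)%nat) * (s ^ 2 * s ^ k) * (/ s ^ 2 * x ^ 2 * (/ 2) ^ k)) by (field; lra).
        replace (M / s ^ 2 * x ^ 2 * (/ 2) ^ k) with (M * (/ s ^ 2 * x ^ 2 * (/ 2) ^ k)) by (unfold Rdiv; ring).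
        apply Rmult_le_compat_r; auto. apply Rmult_le_pos; [|apply pow_le; lra].
        apply Rmult_le_pos; auto. left; now apply Rinv_0_lt_compat.
    - apply ex_series_Rscal, ex_series_geom. lra. }
  apply is_derive_Reals. intros e He.
  set (K := 2 * M / s ^ 2) in *. assert (HK : 0 < K) by (unfold K; apply Rdiv_lt_0_compat; nra).
  assert (Hd : 0 < Rmin (s / 2) (e / (2 * K))) by (apply Rmin_pos; [lra|apply Rdiv_lt_0_compat; lra]).
  exists (mkposreal _ Hd). intros h Hh Hhd. simpl in Hhd.
  assert (H1 : Rabs h < s / 2) by (eapply Rlt_le_trans; [exact Hhd|apply Rmin_l]).
  assert (H2 : Rabs h < e / (2 * K)) by (eapply Rlt_le_trans; [exact Hhd|apply Rmin_r]).
  specialize (HQ h H1). assert (Hhp : 0 < Rabs h) by now apply Rabs_pos_lt.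
  replace ((f (b + h) - f b) / h - a 1%nat) with ((f (b + h) - f b - a 1%nat * h) * / h) by (field; auto).
  rewrite Rabs_mult, Rabs_inv. apply Rmult_lt_reg_r with (Rabs h); auto.
  rewrite Rmult_assoc, Rinv_l, Rmult_1_r by lra.
  eapply Rle_lt_trans; [exact HQ|]. rewrite <- (pow2_abs h).
  assert (K * Rabs h < K * (e / (2 * K))) by (apply Rmult_lt_compat_l; auto).
  replace (K * (e / (2 * K))) with (e / 2) in * by (field; lra). nra.
Qed.

Lemma csum_real (a : nat -> C) (x : R) (n : nat) :
  Re (csum a x (S n)) = sum_n (fun k => Re (a k) * x ^ k) n /\
  Im (csum a x (S n)) = sum_n (fun k => Im (a k) * x ^ k) n.
Proof.
  assert (Hm : forall z m, Re (z * RtoC x ^ m)%C = Re z * x ^ m /\ Im (z * RtoC x ^ m)%C = Im z * x ^ m).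
  { intros z m. rewrite <- RtoC_pow. unfold Re, Im, Cmult, RtoC; simpl. split; ring. }
  rewrite <- !psum_sum_n. generalize (S n) as m. induction m as [|m [IH1 IH2]]; [split; reflexivity|].
  cbn [csum psum]. destruct (Hm (a m) m) as [E1 E2]. split.
  - rewrite <- IH1, <- E1. reflexivity.
  - rewrite <- IH2, <- E2. reflexivity.
Qed.

Lemma centire_shift (f : C -> C) (b : C) : centire f -> centire (fun z => f (b + z)%C).
Proof.
  intros H z. destruct (H (b + z)%C) as [l Hl]. exists l.
  apply (cder_intro _ (fun w => slope f (b + z) l (b + w))%C z l 1 Rlt_0_1).
  - intros w _. rewrite (slope_eq f (b + z)%C l (b + w)%C) at 1.
    replace (b + w - (b + z))%C with (w - z)%C by ring. reflexivity.
  - apply slope_self.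
  - apply ccont_eps. intros e He. destruct (proj1 (ccont_eps _ _) Hl e He) as [d [Hd Hw]].
    exists d. split; auto. intros w Hwd. apply Hw. replace (b + w - (b + z))%C with (w - z)%C by ring. auto.
Qed.

(** On the real line the Taylor polynomials split into real and imaginary parts, so both components
    of an entire function have real expansions of any radius. *)
Lemma entire_expands (f : C -> C) (b r : R) : centire f -> 0 < r ->
  (exists a, expands (fun x => Re (f (RtoC x))) b r a) /\ (exists a, expands (fun x => Im (f (RtoC x))) b r a).
Proof.
  intros Hf Hr. destruct (taylor r Hr _ (centire_shift f b Hf)) as [a [K [HK H]]].
  assert (HL : forall x, Rabs x < r -> is_lim_seq (fun n => K * (Cmod (RtoC x) / r) ^ S n / (r - Cmod (RtoC x))) 0).
  { intros x Hx. rewrite Cmod_R. pose proof (Rabs_pos x).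
    apply (is_lim_seq_ext (fun n => K / (r - Rabs x) * (Rabs x / r) ^ S n)); [intros; unfold Rdiv; ring|].
    replace (Finite 0) with (Rbar_mult (K / (r - Rabs x)) 0) by (simpl; f_equal; ring).
    apply is_lim_seq_scal_l. apply -> (is_lim_seq_incr_1 (fun n => (Rabs x / r) ^ n)).
    apply is_lim_seq_geom. pose proof (ratio_bounds (Rabs x) r ltac:(lra)). rewrite Rabs_pos_eq; lra. }
  split.
  - exists (fun n => Re (a n)). split; auto. intros x Hx.
    apply (is_lim_seq_of_bound _ (fun n => K * (Cmod (RtoC x) / r) ^ S n / (r - Cmod (RtoC x))) _ 1); [|exact (HL x Hx)]. intros n.
    match goal with |- Rabs (?s - _) <= _ => replace s with (Re (csum a x (S n))) by exact (proj1 (csum_real a x n)) end.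
    rewrite Rmult_1_l, RtoC_plus.
    eapply Rle_trans; [|apply H; rewrite Cmod_R; auto].
    eapply Rle_trans; [|apply Re_le_Cmod]. rewrite Rabs_minus_sym. right. reflexivity.
  - exists (fun n => Im (a n)). split; auto. intros x Hx.
    apply (is_lim_seq_of_bound _ (fun n => K * (Cmod (RtoC x) / r) ^ S n / (r - Cmod (RtoC x))) _ 1); [|exact (HL x Hx)]. intros n.
    match goal with |- Rabs (?s - _) <= _ => replace s with (Im (csum a x (S n))) by exact (proj2 (csum_real a x n)) end.
    rewrite Rmult_1_l, RtoC_plus.
    eapply Rle_trans; [|apply H; rewrite Cmod_R; auto].
    eapply Rle_trans; [|apply Im_le_Cmod]. rewrite Rabs_minus_sym. right. reflexivity.
Qed.

(** Only the point [z] is in question. There [f] is known up to a cubic error; dividing by [w - z]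
    twice exhibits the second Taylor coefficient as the derivative, once the first is identified
    with [l]. *)
Lemma slope_entire (f : C -> C) (z l : C) : centire f -> cder f z l -> centire (slope f z l).
Proof.
  intros Hf Hl w. destruct (excluded_middle_informative (w = z)) as [->|Hn]; [|now apply slope_cder].
  destruct (taylor 1 Rlt_0_1 _ (centire_shift f z Hf)) as [a [K [HK H]]].
  assert (H3 := H 3%nat). assert (H1 := H 1%nat).
  assert (E0 : a 0%nat = f z).
  { specialize (H1 (RtoC 0)). rewrite Cmod_0 in H1. specialize (H1 ltac:(lra)).
    replace (z + 0)%C with z in H1 by ring. simpl csum in H1.
    symmetry. apply Cminus_eq_0, Cmod_eq_0, Rle_antisym; [|apply Cmod_ge_0].
    replace (f z - a 0%nat)%C with (f z - (0 + a 0%nat * 1))%C by ring.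
    eapply Rle_trans; [exact H1|]. right. field. }
  assert (HQ : forall x, 0 < Cmod (x - z) < / 2 ->
     Cmod (slope f z l x - a 1%nat - a 2%nat * (x - z)) <= 2 * K * Cmod (x - z) ^ 2).
  { intros x Hx. assert (Hxz : (x - z)%C <> 0) by (apply Cmod_gt_0; lra).
    unfold slope. destruct (excluded_middle_informative (x = z)) as [->|_]; [exfalso; apply Hxz; ring|].
    specialize (H3 (x - z)%C ltac:(lra)). simpl csum in H3. replace (z + (x - z))%C with x in H3 by ring.
    rewrite E0 in H3. set (c := Cmod (x - z)) in *.
    apply Rmult_le_reg_r with c; [lra|]. unfold c at 1. rewrite <- Cmod_mult.
    replace (((f x - f z) / (x - z) - a 1%nat - a 2%nat * (x - z)) * (x - z))%C with
      (f x - (0 + f z * 1 + a 1%nat * ((x - z) * 1) + a 2%nat * ((x - z) * ((x - z) * 1))))%C by (field; auto).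
    eapply Rle_trans; [exact H3|]. unfold Rdiv. rewrite Rinv_1, Rmult_1_r.
    replace (2 * K * c ^ 2 * c) with (K * c ^ 3 * 2) by ring.
    apply Rmult_le_compat_l; [apply Rmult_le_pos; [auto|apply pow_le; lra]|].
    replace 2 with (/ / 2) by field. apply Rinv_le_contravar; lra. }
  assert (E1 : a 1%nat = l).
  { apply Cminus_eq_0, Cmod_eq_0, Rle_antisym; [|apply Cmod_ge_0]. apply Rnot_lt_le. intros Hpos.
    set (D := Cmod (a 1%nat - l)) in *.
    destruct (proj1 (ccont_eps _ _) Hl (D / 2) ltac:(lra)) as [d [Hd Hs]]. rewrite slope_self in Hs.
    set (A2 := Cmod (a 2%nat)). assert (HA2 : 0 <= A2) by apply Cmod_ge_0.
    set (h := Rmin (Rmin (d / 2) (/ 4)) (D / (4 * (A2 + 2 * K + 1)))).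
    assert (Hh4 : 0 < D / (4 * (A2 + 2 * K + 1))) by (apply Rdiv_lt_0_compat; lra).
    assert (Hh : 0 < h) by (unfold h; repeat apply Rmin_pos; lra).
    assert (Hh1 : h <= d / 2) by (eapply Rle_trans; [apply Rmin_l|apply Rmin_l]).
    assert (Hh2 : h <= / 4) by (eapply Rle_trans; [apply Rmin_l|apply Rmin_r]).
    assert (Hh3 : h <= D / (4 * (A2 + 2 * K + 1))) by apply Rmin_r.
    assert (Ex : (z + RtoC h - z)%C = RtoC h) by ring.
    assert (EC : Cmod (z + RtoC h - z) = h) by (rewrite Ex, Cmod_R, Rabs_pos_eq; lra).
    specialize (Hs (z + RtoC h)%C). specialize (HQ (z + RtoC h)%C). rewrite EC in *.
    specialize (Hs ltac:(lra)). specialize (HQ ltac:(lra)). rewrite Ex in HQ.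
    set (s := slope f z l (z + RtoC h)%C) in *.
    assert (T1 : D <= Cmod (s - l) + Cmod (s - a 1%nat - a 2%nat * RtoC h) + Cmod (a 2%nat * RtoC h)).
    { unfold D. replace (a 1%nat - l)%C with ((s - l) + - (s - a 1%nat - a 2%nat * RtoC h) + - (a 2%nat * RtoC h))%C by ring.
      eapply Rle_trans; [apply Cmod_triangle|]. rewrite Cmod_opp. apply Rplus_le_compat_r.
      eapply Rle_trans; [apply Cmod_triangle|]. rewrite Cmod_opp. lra. }
    rewrite Cmod_mult, Cmod_R, (Rabs_pos_eq h) in T1 by lra. fold A2 in T1.
    assert ((A2 + 2 * K + 1) * h <= D / 4).
    { replace (D / 4) with ((A2 + 2 * K + 1) * (D / (4 * (A2 + 2 * K + 1)))) by (field; lra).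
      apply Rmult_le_compat_l; lra. }
    assert (2 * K * h ^ 2 <= 2 * K * h) by (apply Rmult_le_compat_l; nra). nra. }
  exists (a 2%nat). apply ccont_eps. intros e He.
  set (d := Rmin (/ 2) (e / (2 * K + 1))). exists d.
  assert (Hd : 0 < e / (2 * K + 1)) by (apply Rdiv_lt_0_compat; lra).
  split; [apply Rmin_pos; lra|]. intros x Hx. rewrite slope_self. unfold slope at 1.
  destruct (excluded_middle_informative (x = z)) as [->|Hxn].
  { replace (a 2%nat - a 2%nat)%C with (RtoC 0) by ring. rewrite Cmod_0; auto. }
  assert (Hxz : (x - z)%C <> 0) by (intros E; apply Hxn; now apply Cminus_eq_0).
  assert (Hp := proj1 (Cmod_gt_0 _) Hxz).
  assert (Hx1 : Cmod (x - z) < / 2) by (eapply Rlt_le_trans; [exact Hx|apply Rmin_l]).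
  assert (Hx2 : Cmod (x - z) < e / (2 * K + 1)) by (eapply Rlt_le_trans; [exact Hx|apply Rmin_r]).
  specialize (HQ x (conj Hp Hx1)). rewrite slope_self. rewrite E1 in HQ.
  apply Rmult_lt_reg_r with (Cmod (x - z)); auto. rewrite <- Cmod_mult.
  replace (((slope f z l x - l) / (x - z) - a 2%nat) * (x - z))%C with (slope f z l x - l - a 2%nat * (x - z))%C by (field; auto).
  eapply Rle_lt_trans; [exact HQ|].
  replace (2 * K * Cmod (x - z) ^ 2) with (2 * K * Cmod (x - z) * Cmod (x - z)) by ring.
  apply Rmult_lt_compat_r; auto.
  assert ((2 * K + 1) * Cmod (x - z) < (2 * K + 1) * (e / (2 * K + 1))) by (apply Rmult_lt_compat_l; lra).
  replace ((2 * K + 1) * (e / (2 * K + 1))) with e in * by (field; lra). nra.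
Qed.

(** * The completed L-function as a Laplace integral *)

(* [lapl p m x] is the [m]-th derivative of [lapl p 0] at [x]. *)
Definition lapl (p : R -> R) (m : nat) (x : R) : R := LI (fun u => p u * exp (x * u) * u ^ m).

(** Decay beyond every exponential makes the Laplace integral expand around any real point with any
    radius. *)
Definition rapid (p : R -> R) : Prop := forall A, 0 < A -> exists K, lap p K A.

Lemma rapid_moment (p : R -> R) (m : nat) : rapid p -> rapid (fun u => p u * u ^ m).
Proof.
  intros Hp A HA. destruct (Hp (2 * A) ltac:(lra)) as [K HK]. destruct (lap_moment p K _ m HK) as [L HL].
  exists L. replace A with (2 * A / 2) by field. exact HL.
Qed.

Lemma rapid_exp (p : R -> R) (x : R) : rapid p -> rapid (fun u => p u * exp (x * u)).
Proof.
  intros Hp A HA. pose proof (Rabs_pos x). destruct (Hp (A + Rabs x) ltac:(lra)) as [K HK].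
  assert (HK0 := lap_K_nonneg _ _ _ HK). destruct HK as (_ & Hc & HB).
  exists K. split; [auto|split].
  - intros u. apply (continuous_mult (K := R_AbsRing) p (fun u => exp (x * u))); auto.
    smooth.
  - intros u. rewrite Rabs_mult, (Rabs_pos_eq (exp _)) by (left; apply exp_pos).
    apply Rle_trans with (K * exp (- ((A + Rabs x) * Rabs u)) * exp (x * u)).
    + apply Rmult_le_compat_r; [left; apply exp_pos|apply HB].
    + rewrite Rmult_assoc, <- exp_plus. apply Rmult_le_compat_l; auto. apply exp_le.
      pose proof (Rle_abs (x * u)) as H1. rewrite Rabs_mult in H1. lra.
Qed.

Lemma lapl_expands (p : R -> R) (m : nat) (b r : R) : rapid p -> 0 < r ->
  expands (lapl p m) b r (fun n => lapl p (m + n) b / INR (fact n)).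
Proof.
  intros Hp Hr. split; auto. intros x Hx.
  destruct (rapid_moment _ m (rapid_exp p b Hp) r Hr) as [K HK].
  assert (H := laplace_expansion _ _ _ x HK Hx).
  replace (lapl p m (b + x)) with (LI (fun u => p u * exp (b * u) * u ^ m * exp (x * u))).
  - eapply is_series_ext; [|exact H]. intros n. cbv beta. do 2 f_equal. apply LI_ext. intros u. rewrite pow_add. ring.
  - apply LI_ext. intros u. rewrite Rmult_plus_distr_r, exp_plus. ring.
Qed.

Lemma is_derive_lapl (p : R -> R) (m : nat) (x : R) : rapid p -> is_derive (lapl p m) x (lapl p (S m) x).
Proof.
  intros Hp. assert (H := expands_derive _ _ _ _ (lapl_expands p m x 1 Hp Rlt_0_1)). cbv beta in H.
  replace (lapl p (S m) x) with (lapl p (m + 1) x / INR (fact 1)); auto.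
  rewrite Nat.add_1_r. simpl. field.
Qed.

(** [C_lim] approaches a point along the horizontal line through it. At real points [C_derive]
    therefore sees only the restriction to the real axis, and iterated derivatives there are real
    derivatives. *)
Lemma C_derive_real (f : C -> C) (h : R -> R) (x l : R) :
  (forall y, f (RtoC y) = RtoC (h y)) -> is_derive h x l -> C_derive f (RtoC x) = RtoC l.
Proof.
  intros Hf Hd.
  assert (E : forall y, ((f (y, 0) - f (RtoC x)) / ((y, 0) - RtoC x))%C =
     ((h y - h x) / (y - x), 0)).
  { intros y. change (y, 0) with (RtoC y). rewrite !Hf. rewrite <- !RtoC_minus.
    set (a := h y - h x). set (b := y - x). unfold RtoC, Cdiv, Cinv, Cmult; simpl.
    apply injective_projections; simpl; [|unfold Rdiv; ring].
    (* The identity must also hold at [y = x], where both sides are 0 because the inverse of 0 is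
       0. *)
    unfold Rdiv. destruct (Req_dec b 0) as [->|Hb]; [|field; auto].
    replace (0 * (0 * 1) + 0 * (0 * 1)) with 0 by ring.
    rewrite Rinv_0. ring. }
  assert (L1 : is_lim (fun y => fst ((f (y, 0) - f (RtoC x)) / ((y, 0) - RtoC x))%C) x l).
  { apply is_lim_ext with (fun y => (h y - h x) / (y - x)); [intros y; now rewrite E|].
    apply is_lim_spec. intros e. apply is_derive_Reals in Hd.
    destruct (Hd e (cond_pos e)) as [d Hdd]. exists d. intros y Hy Hyx.
    change (Rabs (y - x) < d) in Hy. specialize (Hdd (y - x) ltac:(lra) Hy).
    assert (Ey : forall a b : R, a + (b - a) = b) by (intros; ring). rewrite (Ey x y) in Hdd. exact Hdd. }
  assert (L2 : is_lim (fun y => snd ((f (y, 0) - f (RtoC x)) / ((y, 0) - RtoC x))%C) x 0).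
  { apply is_lim_ext with (fun _ => 0); [intros y; now rewrite E|apply is_lim_const]. }
  unfold C_derive, C_lim. change (fst (RtoC x)) with x. change (snd (RtoC x)) with 0.
  rewrite (is_lim_unique _ _ _ L1), (is_lim_unique _ _ _ L2). reflexivity.
Qed.

Lemma C_derive_n_real (f : C -> C) (p : R -> R) (c : R) : rapid p ->
  (forall y, f (RtoC y) = RtoC (lapl p 0 (y - c))) ->
  forall m x, C_derive_n f m (RtoC x) = RtoC (lapl p m (x - c)).
Proof.
  intros Hp Hf m. induction m as [|m IH]; intros x; [apply Hf|].
  change (C_derive_n f (S m)) with (C_derive (C_derive_n f m)).
  apply (C_derive_real _ (fun x => lapl p m (x - c))); [exact IH|].
  evar_last.
  - apply (is_derive_comp (lapl p m) (fun x => x - c)); [now apply is_derive_lapl|].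
    apply (is_derive_minus (V := R_NormedModule)); [apply is_derive_id|apply is_derive_const].
  - unfold scal, minus, plus, opp, zero, one; simpl. unfold mult; simpl. ring.
Qed.

Section Parity.
Variables (p : R -> R) (j : nat).
Hypothesis Hp : rapid p.
Hypothesis Hpar : forall u, p (- u) = (-1) ^ j * p u.
Hypothesis Hpos : forall u, 0 < u -> 0 < p u.

Lemma p_0_nonneg : 0 <= p 0.
Proof.
  destruct (Hp 1 Rlt_0_1) as (K & _ & Hc & _).
  assert (HL : is_lim_seq (fun n => p (/ INR (S n))) (p 0)).
  { apply (is_lim_seq_continuous p); [apply continuity_pt_filterlim, Hc|apply is_lim_seq_inv_INR_S]. }
  assert (Hn : forall n, 0 <= p (/ INR (S n))).
  { intros n. left. apply Hpos, Rinv_0_lt_compat. pose proof (INR_S_ge_1 n). lra. }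
  exact (is_lim_seq_le _ _ _ _ Hn (is_lim_seq_const 0) HL).
Qed.

Lemma lapl_0 (m : nat) : lapl p m 0 = LI (fun u => p u * u ^ m).
Proof. apply LI_ext. intros u. rewrite Rmult_0_l, exp_0. ring. Qed.

Lemma moment_sign (m : nat) (u : R) : p (- u) * (- u) ^ m = (-1) ^ (j + m) * (p u * u ^ m).
Proof.
  rewrite Hpar. replace (- u) with (-1 * u) by ring. rewrite Rpow_mult_distr, pow_add. ring.
Qed.

Lemma lapl_odd (m : nat) : (-1) ^ (j + m) = -1 -> lapl p m 0 = 0.
Proof.
  intros Hs. rewrite lapl_0. destruct (rapid_moment p m Hp 1 Rlt_0_1) as [K HK].
  assert (H1 := LI_reflect _ _ _ HK). cbv beta in H1.
  rewrite (LI_ext _ (fun u => -1 * (p u * u ^ m))), (LI_scal _ _ _ _ HK) in H1; [lra|].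
  intros u. now rewrite moment_sign, Hs.
Qed.

Lemma moment_nonneg (m : nat) (u : R) : (-1) ^ (j + m) = 1 -> 0 <= p u * u ^ m.
Proof.
  intros Hs. assert (Hge : forall u, 0 <= u -> 0 <= p u * u ^ m).
  { intros v Hv. apply Rmult_le_pos; [|now apply pow_le].
    destruct (Req_dec v 0) as [->|Hn]; [apply p_0_nonneg|left; apply Hpos; lra]. }
  destruct (Rle_dec 0 u) as [Hu|Hu]; [now apply Hge|].
  specialize (Hge (- u) ltac:(lra)). rewrite moment_sign, Hs in Hge. lra.
Qed.

Lemma lapl_nonneg (m : nat) : 0 <= lapl p m 0.
Proof.
  assert (Hs : (-1) ^ (j + m) = 1 \/ (-1) ^ (j + m) = -1).
  { generalize (j + m)%nat as n. induction n as [|n IH]; [left; reflexivity|]. simpl. destruct IH as [->|E]; [right; ring|rewrite E; left; ring]. }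
  destruct Hs as [Hs|Hs]; [|rewrite lapl_odd; auto; lra].
  rewrite lapl_0. destruct (rapid_moment p m Hp 1 Rlt_0_1) as [K HK].
  apply (LI_nonneg _ _ _ HK). intros u. now apply moment_nonneg.
Qed.

Lemma lapl_pos (m : nat) : (-1) ^ (j + m) = 1 -> 0 < lapl p m 0.
Proof.
  intros Hs. rewrite lapl_0. destruct (rapid_moment p m Hp 1 Rlt_0_1) as [K HK].
  apply (LI_pos _ _ _ HK).
  - intros u. now apply moment_nonneg.
  - intros u Hu. apply Rmult_lt_0_compat; [apply Hpos; lra|apply pow_lt; lra].
Qed.

End Parity.

(* [f (i y)] for [f = Delta_k], [k = 12 + 2 j]. *)
Definition form (j : nat) (y : R) : R := disc y * eis j y.

Definition kern (j : nat) (u : R) : R := form j (exp u) * exp (INR (6 + j) * u).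

Lemma kern_parity (j : nat) (u : R) : In j [0; 2; 3; 4; 5; 7]%nat -> kern j (- u) = (-1) ^ j * kern j u.
Proof.
  intros Hj. unfold kern, form. pose proof (exp_pos u) as Hu.
  rewrite exp_Ropp, disc_inv, eis_inv by auto.
  replace (exp (INR (6 + j) * - u)) with (/ (exp u ^ (6 + j))).
  2:{ rewrite exp_pow, <- exp_Ropp. f_equal. ring. }
  replace (exp (INR (6 + j) * u)) with (exp u ^ (6 + j)) by (rewrite exp_pow; f_equal; ring).
  assert (exp u ^ (6 + j) <> 0) by (apply pow_nonzero; lra).
  assert (E : exp u ^ 12 * exp u ^ (2 * j) = exp u ^ (6 + j) * exp u ^ (6 + j))
    by (rewrite <- !pow_add; f_equal; lia).
  apply Rmult_eq_reg_r with (exp u ^ (6 + j)); auto. rewrite Rmult_assoc, Rinv_l, Rmult_1_r by auto.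
  replace (exp u ^ 12 * disc (exp u) * ((-1) ^ j * exp u ^ (2 * j) * eis j (exp u))) with
    ((-1) ^ j * disc (exp u) * eis j (exp u) * (exp u ^ 12 * exp u ^ (2 * j))) by ring.
  rewrite E. ring.
Qed.

Lemma kern_pos (j : nat) (u : R) : In j [0; 2; 3; 4; 5; 7]%nat -> 0 < u -> 0 < kern j u.
Proof.
  intros Hj Hu. apply Rmult_lt_0_compat; [|apply exp_pos]. apply Rmult_lt_0_compat; [apply disc_pos|].
  apply eis_pos; auto. rewrite <- exp_0. now apply exp_increasing.
Qed.

Lemma continuous_form (j : nat) (y : R) : 0 < y -> continuous (form j) y.
Proof.
  intros Hy. apply (continuous_mult (K := R_AbsRing) disc (eis j)); [now apply continuous_disc|now apply continuous_eis].
Qed.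

(** For [u >= 0] the discriminant decays like [exp (- 2 PI exp u)] and the Eisenstein factor is
    bounded; parity transfers the bound to [u < 0]. *)
Lemma kern_rapid (j : nat) : In j [0; 2; 3; 4; 5; 7]%nat -> rapid (kern j).
Proof.
  intros Hj A HA. pose proof PI_RGT_0. pose proof (pos_INR (6 + j)) as Hk.
  destruct (exp_dominates (A + INR (6 + j))) as [L [HL HLb]]; [lra|].
  set (E := 1 + Rabs (eis_factor j) * eis_sum (2 * j - 1) 1).
  assert (HE : 0 <= E) by (assert (H1 := eis_bounded j 1 (Rle_refl 1)); pose proof (Rabs_pos (eis j 1)); fold E in H1; lra).
  assert (Hge : forall u, 0 <= u -> Rabs (kern j u) <= E * L * exp (- (A * u))).
  { intros u Hu. assert (Hy : 1 <= exp u) by (rewrite <- exp_0; now apply exp_le).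
    unfold kern, form. rewrite !Rabs_mult, (Rabs_pos_eq (disc _)), (Rabs_pos_eq (exp _)) by (left; try apply exp_pos; apply disc_pos).
    assert (H1 := disc_bound (exp u) ltac:(lra)). assert (H2 := eis_bounded j (exp u) Hy). fold E in H2.
    apply Rle_trans with (exp (- (2 * PI * exp u)) * E * exp (INR (6 + j) * u)).
    - apply Rmult_le_compat_r; [left; apply exp_pos|]. apply Rmult_le_compat; auto using Rabs_pos. left; apply disc_pos.
    - specialize (HLb u).
      replace (exp (- (2 * PI * exp u)) * E * exp (INR (6 + j) * u)) with
        (E * (exp (- (2 * PI * exp u)) * exp (INR (6 + j) * u))) by ring.
      rewrite (Rmult_assoc E L). apply Rmult_le_compat_l; auto. rewrite <- exp_plus.
      replace (- (2 * PI * exp u) + INR (6 + j) * u) with (((A + INR (6 + j)) * u - 2 * PI * exp u) + - (A * u)) by ring.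
      rewrite exp_plus. apply Rmult_le_compat_r; [left; apply exp_pos|auto]. }
  exists (E * L). split; [auto|split].
  - intros u. apply (continuous_mult (K := R_AbsRing) (fun u => form j (exp u)) (fun u => exp (INR (6 + j) * u))).
    + apply (continuous_comp exp (form j)); [|apply continuous_form, exp_pos].
      smooth.
    + set (k := INR (6 + j)). smooth.
  - intros u. destruct (Rle_dec 0 u) as [Hu|Hu]; [rewrite (Rabs_pos_eq u) by auto; now apply Hge|].
    rewrite (Rabs_left u) by lra. specialize (Hge (- u) ltac:(lra)).
    rewrite kern_parity, Rabs_mult, pow_1_abs, Rmult_1_l in Hge by auto. exact Hge.
Qed.

Lemma mellin_form (j : nat) (s : R) :
  mellin (form j) (s + (INR (12 + 2 * j) - 1) / 2) = lapl (kern j) 0 (s - 1 / 2).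
Proof.
  apply LI_ext. intros u. unfold kern. rewrite pow_O, Rmult_1_r, Rmult_assoc, <- exp_plus. do 2 f_equal.
  rewrite !plus_INR, mult_INR, !INR_IZR_INZ. simpl Z.of_nat. field.
Qed.

(** * The Gamma factor *)

Lemma Cexp_RtoC (x : R) : Cexp (RtoC x) = RtoC (exp x).
Proof. unfold Cexp, RtoC; simpl. rewrite cos_0, sin_0. f_equal; ring. Qed.

Lemma Rcpow_RtoC (t x : R) : Rcpow t (RtoC x) = RtoC (exp (x * ln t)).
Proof. unfold Rcpow. now rewrite <- RtoC_mult, Cexp_RtoC. Qed.

(** The substitution is [t = 2 * PI * exp u]; including [2 * PI] produces the factor [(2 pi) ^ w],
    later cancelled by the one in the completed L-function. *)
Lemma gamma_integral_subst (w a b : R) : 0 < a <= b ->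
  is_RInt (fun t => exp ((w - 1) * ln t) * exp (- t)) a b
    (exp (w * ln (2 * PI)) * RInt (gamma_kernel w) (ln (a / (2 * PI))) (ln (b / (2 * PI)))).
Proof.
  intros Hab. pose proof PI_RGT_0. set (f := fun t => exp ((w - 1) * ln t) * exp (- t)).
  set (g := fun u => 2 * PI * exp u).
  assert (Hg : forall c, 0 < c -> g (ln (c / (2 * PI))) = c).
  { intros c Hc. unfold g. rewrite exp_ln by (apply Rdiv_lt_0_compat; lra). field. lra. }
  assert (Hgp : forall u, 0 < g u) by (intros u; unfold g; pose proof (exp_pos u); nra).
  assert (Hcf : forall t, 0 < t -> continuous f t).
  { intros t Ht. unfold f. smooth. }
  assert (HS := RInt_comp (V := R_CompleteNormedModule) f g g (ln (a / (2 * PI))) (ln (b / (2 * PI)))).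
  rewrite !Hg in HS by lra.
  replace (exp (w * ln (2 * PI)) * RInt (gamma_kernel w) (ln (a / (2 * PI))) (ln (b / (2 * PI)))) with (RInt f a b).
  - apply (RInt_correct (V := R_CompleteNormedModule)). apply (ex_RInt_continuous (V := R_CompleteNormedModule)).
    intros t Ht. rewrite Rmin_left in Ht by lra. apply Hcf. lra.
  - rewrite <- HS.
    + rewrite <- (RInt_scal (V := R_CompleteNormedModule)) by (apply ex_RInt_cont, continuous_gamma_kernel).
      apply RInt_ext. intros u _. unfold scal; simpl; unfold mult; simpl. unfold f, gamma_kernel.
      unfold g at 2. rewrite ln_mult, ln_exp by (try apply exp_pos; lra).
      replace (g u) with (exp (ln (2 * PI) + u)) at 1 by (unfold g; rewrite exp_plus, exp_ln by lra; reflexivity).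
      rewrite <- !exp_plus. f_equal. unfold g. ring.
    + intros u _. apply Hcf, Hgp.
    + intros u _. split.
      * unfold g. auto_derive; auto; ring.
      * unfold g. smooth.
Qed.

Lemma Euler_Gamma_real (w : R) : 0 < w -> Euler_Gamma (RtoC w) = RtoC (exp (w * ln (2 * PI)) * gam w).
Proof.
  intros Hw. pose proof PI_RGT_0. destruct (lap_gamma w Hw) as [K HK].
  assert (HK0 := lap_K_nonneg _ _ _ HK).
  unfold Euler_Gamma. apply (@is_RInt_gen_unique C_R_CompleteNormedModule (at_right 0) (Rbar_locally p_infty) _ _).
  intros P [e HP]. set (c := exp (w * ln (2 * PI))) in *. assert (Hc : 0 < c) by apply exp_pos.
  assert (HL := exp_neg_INR_lim w Hw). apply (is_lim_seq_scal_l _ (c * (4 * (K / w)))) in HL.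
  apply is_lim_seq_spec in HL. simpl Rbar_mult in HL. rewrite Rmult_0_r in HL.
  destruct (HL e) as [N HN]. specialize (HN N (le_n _)). rewrite Rminus_0_r in HN. apply Rabs_def2 in HN.
  set (x := INR N) in *. assert (Hx : 0 <= x) by apply pos_INR.
  (* Limits of integration below [2 * PI * exp (- x)] and above [2 * PI * exp x] correspond, in the
     variable [u], to windows containing the interval from [- x] to [x], where [LI_approx]
     applies. *)
  assert (Ha0 : 0 < 2 * PI * exp (- x)) by (pose proof (exp_pos (- x)); nra).
  apply (Filter_prod _ _ _ (fun a => 0 < a < 2 * PI * exp (- x)) (fun b => 2 * PI * exp x < b)).
  - exists (mkposreal _ Ha0). intros y Hy Hy0. apply Rabs_def2 in Hy. simpl in Hy.
    unfold minus, plus, opp in Hy; simpl in Hy. lra.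
  - exists (2 * PI * exp x). auto.
  - intros a b Ha Hb. simpl.
    assert (Hex : exp (- x) <= exp x) by (apply exp_le; lra). assert (Hab : 0 < a <= b) by nra.
    exists (RtoC (c * RInt (gamma_kernel w) (ln (a / (2 * PI))) (ln (b / (2 * PI))))). split.
    + apply (is_RInt_fct_extend_pair (U := R_NormedModule) (V := R_NormedModule)).
      * apply (is_RInt_ext (fun t => exp ((w - 1) * ln t) * exp (- t))); [|now apply gamma_integral_subst].
        intros t _. rewrite <- RtoC_minus, Rcpow_RtoC. unfold RtoC, Cmult; simpl. ring.
      * apply (is_RInt_ext (fun t => 0)).
        -- intros t _. rewrite <- RtoC_minus, Rcpow_RtoC. unfold RtoC, Cmult; simpl. ring.
        -- assert (H0 := is_RInt_const (V := R_NormedModule) a b 0). unfold scal in H0; simpl in H0.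
           unfold mult in H0; simpl in H0. rewrite Rmult_0_r in H0. exact H0.
    + apply HP. split; [|apply ball_center].
      assert (La : ln (a / (2 * PI)) <= - x).
      { rewrite <- (ln_exp (- x)). apply ln_le; [apply Rdiv_lt_0_compat; lra|].
        apply Rmult_le_reg_r with (2 * PI); [lra|]. unfold Rdiv. rewrite Rmult_assoc, Rinv_l by lra. lra. }
      assert (Lb : x <= ln (b / (2 * PI))).
      { rewrite <- (ln_exp x) at 1. apply ln_le; [apply exp_pos|].
        apply Rmult_le_reg_r with (2 * PI); [lra|]. unfold Rdiv. rewrite Rmult_assoc, Rinv_l by lra. lra. }
      assert (HA := LI_approx (gamma_kernel w) K w _ _ x HK Hx La Lb). fold (gam w) in HA.
      change (Rabs (c * RInt (gamma_kernel w) (ln (a / (2 * PI))) (ln (b / (2 * PI))) - c * gam w) < e).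
      rewrite <- Rmult_minus_distr_l, Rabs_mult, (Rabs_pos_eq c) by lra.
      eapply Rle_lt_trans; [apply Rmult_le_compat_l; [lra|exact HA]|]. lra.
Qed.

Lemma Gamma_real (w : R) : 0 < w -> Gamma (RtoC w) = RtoC (exp (w * ln (2 * PI)) * gam w).
Proof.
  intros Hw. unfold Gamma.
  (* For [w > 0] the integer [up (- w)] is at most 0, so no step of the continuation is taken. *)
  assert (HN : Z.to_nat (up (- Re (RtoC w))) = 0%nat).
  { destruct (archimed (- Re (RtoC w))) as [_ HU]. simpl in *.
    assert (up (- w) < 1)%Z by (apply lt_IZR; lra). lia. }
  rewrite HN. simpl C_prod. simpl INR. replace (RtoC w + 0)%C with (RtoC w) by ring.
  rewrite Euler_Gamma_real by auto. field.
Qed.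

Lemma completed_real (k : nat) (L Lam : C -> C) (s : R) : is_completed_L_function k L Lam ->
  0 < s + (INR k - 1) / 2 ->
  Lam (RtoC s) = (RtoC (gam (s + (INR k - 1) / 2)) * L (RtoC s))%C.
Proof.
  intros [_ H] Hs. set (h := (INR k - 1) / 2) in *. pose proof PI_RGT_0.
  rewrite H.
  - rewrite <- RtoC_plus, Gamma_real by auto. rewrite <- RtoC_opp, <- RtoC_minus, Rcpow_RtoC, <- !RtoC_mult.
    f_equal. f_equal. rewrite <- Rmult_assoc, <- exp_plus.
    replace ((- s - h) * ln (2 * PI) + (s + h) * ln (2 * PI)) with 0 by ring. rewrite exp_0. ring.
  - intros [n Hn]. fold h in Hn. rewrite <- RtoC_plus, <- RtoC_opp in Hn. apply RtoC_inj in Hn.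
    pose proof (pos_INR n). lra.
Qed.

(** * L-functions *)

Lemma is_series_Re_Im (a : nat -> C) (l : C) : is_series (K := C_AbsRing) (V := C_NormedModule) a l ->
  is_series (fun n => Re (a n)) (Re l) /\ is_series (fun n => Im (a n)) (Im l).
Proof.
  intros H. split; intros P [e HP].
  - destruct (H (fun z => P (Re z))) as [N HN].
    + exists e. intros z Hz. apply HP. apply Hz.
    + exists N. intros n Hn. specialize (HN n Hn). cbv beta in HN. rewrite Re_sum_n in HN. exact HN.
  - destruct (H (fun z => P (Im z))) as [N HN].
    + exists e. intros z Hz. apply HP. apply Hz.
    + exists N. intros n Hn. specialize (HN n Hn). cbv beta in HN. rewrite Im_sum_n in HN. exact HN.
Qed.

Lemma entire_centire (f : C -> C) : entire f -> centire f.
Proof. intros H z. destruct (H z) as [l Hl]. exists l. now apply is_derive_cder. Qed.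

Section LFunction.
Variables (j : nat) (tau : nat -> C) (L : C -> C).
Let k : nat := (12 + 2 * j)%nat.
Let h : R := (INR k - 1) / 2.
Hypothesis Hj : In j [0; 2; 3; 4; 5; 7]%nat.
Hypothesis Hq : is_q_expansion (Delta_form k) tau.
Hypothesis HL : is_L_function k tau L.

Lemma h_ge : 11 / 2 <= h.
Proof.
  unfold h, k. rewrite plus_INR, mult_INR, !INR_IZR_INZ. simpl (IZR (Z.of_nat 12)). simpl (IZR (Z.of_nat 2)).
  rewrite <- INR_IZR_INZ. pose proof (pos_INR j). lra.
Qed.

Lemma dirichlet_components (s : R) : 1 < s ->
  is_series (fun n => Re (tau (S n)) * Rpower (INR (S n)) (- (s + h))) (Re (L (RtoC s))) /\
  is_series (fun n => Im (tau (S n)) * Rpower (INR (S n)) (- (s + h))) (Im (L (RtoC s))).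
Proof.
  intros Hs. destruct HL as [_ H]. specialize (H (RtoC s) Hs). apply is_series_Re_Im in H. fold h in H.
  assert (E : forall n, (tau (S n) * Rcpow (INR (S n)) (- h)%R * Rcpow (INR (S n)) (- s))%C =
     (tau (S n) * RtoC (Rpower (INR (S n)) (- (s + h))))%C).
  { intros n. rewrite <- RtoC_opp, !Rcpow_RtoC, <- Cmult_assoc, <- RtoC_mult, <- exp_plus. unfold Rpower.
    do 3 f_equal. ring. }
  destruct H as [H1 H2]. split.
  - eapply is_series_ext; [|exact H1]. intros n. cbv beta. rewrite E. unfold Re, Cmult, RtoC; simpl. ring.
  - eapply is_series_ext; [|exact H2]. intros n. cbv beta. rewrite E. unfold Im, Cmult, RtoC; simpl. ring.
Qed.

Lemma q_components (y : R) : 0 < y ->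
  is_series (fun n => Re (tau (S n)) * exp (- (2 * PI * y * INR (S n)))) (form j y) /\
  is_series (fun n => Im (tau (S n)) * exp (- (2 * PI * y * INR (S n)))) 0.
Proof.
  intros Hy. assert (H := Hq (0, y) Hy). apply is_series_Re_Im in H.
  unfold k in H. rewrite Delta_form_imaginary in H by auto.
  replace (Nat.div2 (12 + 2 * j - 12)) with j in H.
  2:{ replace (12 + 2 * j - 12)%nat with (2 * j)%nat by lia. symmetry. apply Nat.div2_double. }
  assert (E : forall n, (tau (S n) * q (0, y) ^ S n)%C = (tau (S n) * RtoC (exp (- (2 * PI * y * INR (S n)))))%C).
  { intros n. rewrite q_imaginary, <- RtoC_pow, exp_pow. do 3 f_equal. ring. }
  destruct H as [H1 H2]. split.
  - eapply is_series_ext; [|exact H1]. intros n. cbv beta. rewrite E. unfold Re, Cmult, RtoC; simpl. ring.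
  - eapply is_series_ext; [|exact H2]. intros n. cbv beta. rewrite E. unfold Im, Cmult, RtoC; simpl. ring.
Qed.

(* Convergence of the Dirichlet series at [s = 2] bounds the coefficients polynomially. *)
Lemma dirichlet_mellin (t : nat -> R) (F : R -> R) (l : R -> R) (s : R) :
  (forall s, 1 < s -> is_series (fun n => t n * Rpower (INR (S n)) (- (s + h))) (l s)) ->
  (forall y, 0 < y -> is_series (fun n => t n * exp (- (2 * PI * y * INR (S n)))) (F y)) ->
  (forall y, 0 < y -> continuous F y) -> 5 <= s ->
  l s * gam (s + h) = mellin F (s + h).
Proof.
  intros Hl HF Hc Hs. pose proof h_ge.
  destruct (is_series_terms_bounded _ _ (Hl 2 ltac:(lra))) as [M [HM HB]].
  assert (Hb : forall n, Rabs (t n) <= M * Rpower (INR (S n)) (2 + h)).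
  { intros n. specialize (HB n). rewrite Rabs_mult, (Rabs_pos_eq (Rpower _ _)) in HB by (left; apply exp_pos).
    assert (HP : 0 < Rpower (INR (S n)) (2 + h)) by apply exp_pos.
    rewrite Rpower_Ropp in HB.
    apply Rmult_le_reg_r with (/ Rpower (INR (S n)) (2 + h)); [now apply Rinv_0_lt_compat|].
    rewrite (Rmult_assoc M), Rinv_r by lra. lra. }
  assert (HD := mellin_dirichlet t F M (2 + h) (s + h) ltac:(lra) Hb HF Hc ltac:(lra) ltac:(lra)).
  rewrite <- (is_series_unique _ _ HD), <- (is_series_unique _ _ (Hl s ltac:(lra))), Rmult_comm, <- Series_scal_l.
  apply Series_ext. intros n. ring.
Qed.

Let Hrap := kern_rapid j Hj.

(** The imaginary parts of [tau] form a Dirichlet series attached to the zero function, whose Mellin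
    transform is 0; dividing by [gam > 0] gives [Im L = 0]. The bound 5 is 2 + 3: convergence at 2
    bounds the coefficients with exponent [2 + h], and [mellin_dirichlet] asks for 3 more. *)
Lemma L_large (s : R) : 5 <= s ->
  Re (L (RtoC s)) * gam (s + h) = lapl (kern j) 0 (s - 1 / 2) /\ Im (L (RtoC s)) = 0.
Proof.
  intros Hs. pose proof h_ge. split.
  - rewrite <- mellin_form. fold k h.
    apply (dirichlet_mellin (fun n => Re (tau (S n))) (form j) (fun s => Re (L (RtoC s)))); auto.
    + intros; now apply dirichlet_components.
    + intros; now apply q_components.
    + intros; now apply continuous_form.
  - assert (H0 := dirichlet_mellin (fun n => Im (tau (S n))) (fun _ => 0) (fun s => Im (L (RtoC s))) s
      (fun s Hs => proj2 (dirichlet_components s Hs)) (fun y Hy => proj2 (q_components y Hy))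
      (fun y _ => continuous_const _ _) Hs). cbv beta in H0.
    assert (Hm : mellin (fun _ => 0) (s + h) = 0).
    { unfold mellin. destruct (lap_gamma 1 Rlt_0_1) as [K HK].
      rewrite (LI_ext _ (fun u => 0 * gamma_kernel 1 u)) by (intros; ring). rewrite (LI_scal _ _ _ _ HK). ring. }
    rewrite Hm in H0. pose proof (gam_pos (s + h) ltac:(lra)) as Hg.
    apply Rmult_integral in H0. destruct H0; [auto|lra].
Qed.

Lemma lapl_shift_expands (r : R) : 0 < r ->
  exists a, expands (fun s => lapl (kern j) 0 (s - 1 / 2)) 6 r a.
Proof.
  intros Hr. destruct (lapl_expands (kern j) 0 (6 - 1 / 2) r Hrap Hr) as [_ H]. eexists. split; auto.
  intros x Hx. replace (6 + x - 1 / 2) with (6 - 1 / 2 + x) by ring. exact (H x Hx).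
Qed.

(** Around 6 the expansion of [gam (s + h)] has radius [6 + h], reaching down to the edge [s = - h].
    One disc thus leads from the range of [L_large] to a neighbourhood of 1/2, and it involves [L]
    alone. *)
Lemma L_real (s : R) : Rabs (s - 6) < 6 + h ->
  Re (L (RtoC s)) * gam (s + h) = lapl (kern j) 0 (s - 1 / 2) /\ Im (L (RtoC s)) = 0.
Proof.
  intros Hs. pose proof h_ge. assert (Hr : 0 < 6 + h) by lra.
  destruct (entire_expands L 6 (6 + h) (entire_centire L (proj1 HL)) Hr) as [[a Ha] [c Hc]].
  destruct (lapl_shift_expands (6 + h) Hr) as [e He].
  assert (Hg : expands (fun s => gam (s + h)) 6 (6 + h)
     (fun n => LI (fun u => gamma_kernel (6 + h) u * u ^ n) / INR (fact n))).
  { split; auto. intros x Hx. replace (6 + x + h) with (6 + h + x) by ring. now apply gam_expansion. }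
  destruct (expands_mult _ _ _ _ _ _ Ha Hg) as [d Hd].
  replace s with (6 + (s - 6)) by ring. split.
  - apply (expands_unique _ _ 6 (6 + h) 1 _ _ Hd He); auto; [lra|].
    intros x Hx. apply L_large. lra.
  - apply (expands_unique _ _ 6 (6 + h) 1 _ _ Hc (expands_zero 6 (6 + h) Hr)); auto; [lra|].
    intros x Hx. apply L_large. lra.
Qed.

(** Here both sides expand around 6 with every radius, so the radius is chosen after [s], and
    agreement between 6 and 7 is enough. *)
Lemma completed_lapl (Lam : C -> C) : is_completed_L_function k L Lam ->
  forall s, Lam (RtoC s) = RtoC (lapl (kern j) 0 (s - 1 / 2)).
Proof.
  intros HLam s. pose proof h_ge. pose proof (Rabs_pos (s - 6)).
  set (r := Rabs (s - 6) + 1). assert (Hr : 0 < r) by (unfold r; lra).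
  destruct (entire_expands Lam 6 r (entire_centire Lam (proj1 HLam)) Hr) as [[a Ha] [c Hc]].
  destruct (lapl_shift_expands r Hr) as [e He].
  assert (HX : forall x, 0 < x < 1 -> Lam (RtoC (6 + x)) = RtoC (lapl (kern j) 0 (6 + x - 1 / 2))).
  { intros x Hx. destruct (L_large (6 + x) ltac:(lra)) as [E1 E2].
    rewrite (completed_real k L Lam (6 + x) HLam) by (fold h; lra). fold h.
    assert (EL : L (RtoC (6 + x)) = RtoC (Re (L (RtoC (6 + x)))))
      by (apply injective_projections; [reflexivity|exact E2]).
    rewrite EL, <- RtoC_mult, <- E1. f_equal. apply Rmult_comm. }
  assert (Hsr : Rabs (s - 6) < r) by (unfold r; lra).
  replace s with (6 + (s - 6)) by ring.
  apply injective_projections.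
  - apply (expands_unique _ _ 6 r 1 _ _ Ha He); auto; [lra|]. intros x Hx. now rewrite (HX x Hx).
  - apply (expands_unique _ _ 6 r 1 _ _ Hc (expands_zero 6 r Hr)); auto; [lra|]. intros x Hx. now rewrite (HX x Hx).
Qed.

Lemma half_near (s : R) : Rabs (s - 1 / 2) < 1 -> Rabs (s - 6) < 6 + h.
Proof.
  intros Hs. pose proof h_ge. apply Rabs_def2 in Hs. apply Rabs_def1; lra.
Qed.

Lemma half_eq : (1 / 2)%C = RtoC (1 / 2).
Proof. rewrite RtoC_div by lra. reflexivity. Qed.

Lemma half_self : Rabs (1 / 2 - 1 / 2) < 1.
Proof. rewrite Rminus_diag, Rabs_R0. lra. Qed.

Lemma super_positivity (Lam : C -> C) : is_completed_L_function k L Lam -> super_positive Lam.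
Proof.
  intros HLam m. rewrite half_eq.
  rewrite (C_derive_n_real Lam (kern j) (1 / 2) Hrap (completed_lapl Lam HLam)), Rminus_diag.
  split; [reflexivity|]. simpl.
  apply (lapl_nonneg (kern j) j Hrap).
  - intros u. now apply kern_parity.
  - intros u Hu. now apply kern_pos.
Qed.

Lemma entire_locally (f : C -> C) (z : C) : centire f -> holomorphic_at f z.
Proof. intros H. destruct (H z) as [l Hl]. exists l. now apply is_derive_cder. Qed.

Lemma order_zero : (-1) ^ j = 1 -> is_ord L (1 / 2) 0.
Proof.
  intros Hs. exists L. split.
  - intros E0. rewrite half_eq in E0. destruct (L_real (1 / 2) (half_near _ half_self)) as [E _].
    rewrite E0, Rminus_diag in E. simpl Re in E. rewrite Rmult_0_l in E.
    assert (H := lapl_pos (kern j) j Hrap (fun u => kern_parity j u Hj) (fun u Hu => kern_pos j u Hj Hu) 0).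
    rewrite Nat.add_0_r in H. specialize (H Hs). lra.
  - apply filter_forall. intros s. split; [apply (proj1 HL)|]. simpl. ring.
Qed.

(** The value at 1/2 vanishes by oddness of the kernel. If the derivative vanished too, the product
    rule would make the derivative of [Re L * gam] at 1/2 zero, whereas it is the first moment of
    the kernel, which is positive. The cofactor in the order of vanishing is the slope. *)
Lemma order_one : (-1) ^ j = -1 -> is_ord L (1 / 2) 1.
Proof.
  intros Hs. pose proof h_ge.
  assert (HLe := entire_centire L (proj1 HL)). rewrite half_eq.
  destruct (L_real (1 / 2) (half_near _ half_self)) as [E EI]. rewrite Rminus_diag in E.
  assert (Hg : 0 < gam (1 / 2 + h)) by (apply gam_pos; lra).
  rewrite (lapl_odd (kern j) j Hrap (fun u => kern_parity j u Hj)) in E by (now rewrite Nat.add_0_r).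
  assert (ER : Re (L (RtoC (1 / 2))) = 0) by (apply Rmult_integral in E; destruct E; [auto|lra]).
  assert (E0 : L (RtoC (1 / 2)) = 0) by (apply injective_projections; [exact ER|exact EI]).
  destruct (HLe (RtoC (1 / 2))) as [l Hl].
  assert (Hl0 : l <> 0).
  { intros El. rewrite El in Hl. destruct (cder_hline L (1 / 2) 0 0 Hl) as [D1 _].
    assert (Hge : expands gam (1 / 2 + h) (1 / 2 + h)
       (fun n => LI (fun u => gamma_kernel (1 / 2 + h) u * u ^ n) / INR (fact n))).
    { split; [lra|]. intros x Hx. apply gam_expansion; lra. }
    assert (D2 := expands_derive _ _ _ _ Hge).
    cbv beta in D2.
    assert (D3 : is_derive (fun s => gam (s + h)) (1 / 2) (LI (fun u => gamma_kernel (1 / 2 + h) u * u ^ 1) / INR (fact 1))).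
    { evar_last; [apply (is_derive_comp gam (fun s => s + h)); [exact D2|]|].
      - apply (is_derive_plus (V := R_NormedModule)); [apply is_derive_id|apply is_derive_const].
      - unfold scal, plus, zero, one; simpl. unfold mult; simpl. ring. }
    assert (D4 := is_derive_mult _ _ _ _ _ D1 D3 Rmult_comm).
    assert (D5 : is_derive (fun s => lapl (kern j) 0 (s - 1 / 2)) (1 / 2) (lapl (kern j) 1 0)).
    { rewrite <- (Rminus_diag (1 / 2)). evar_last.
      - apply (is_derive_comp (lapl (kern j) 0) (fun x => x - 1 / 2)); [now apply is_derive_lapl|].
        apply (is_derive_minus (V := R_NormedModule)); [apply is_derive_id|apply is_derive_const].
      - unfold scal, minus, plus, opp, zero, one; simpl. unfold mult; simpl. ring. }
    assert (D6 : is_derive (fun s => lapl (kern j) 0 (s - 1 / 2)) (1 / 2) 0).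
    { eapply is_derive_ext_loc; [|evar_last; [exact D4|]].
      - exists (mkposreal 1 Rlt_0_1). intros s Hsn. apply (L_real s). apply half_near. exact Hsn.
      - change (Re (RtoC 0) * gam (1 / 2 + h) + Re (L (RtoC (1 / 2))) * (LI (fun u => gamma_kernel (1 / 2 + h) u * u ^ 1) / INR (fact 1)) = 0).
        rewrite ER. simpl Re. ring. }
    assert (HP := lapl_pos (kern j) j Hrap (fun u => kern_parity j u Hj) (fun u Hu => kern_pos j u Hj Hu) 1).
    rewrite pow_add, Hs, pow_1 in HP. specialize (HP ltac:(lra)).
    assert (EE := eq_trans (eq_sym (is_derive_unique _ _ _ D5)) (is_derive_unique _ _ _ D6)). lra. }
  exists (slope L (RtoC (1 / 2)) l). split; [now rewrite slope_self|].
  apply filter_forall. intros s. split.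
  - apply entire_locally. now apply slope_entire.
  - rewrite (slope_eq L (RtoC (1 / 2)) l s) at 1. rewrite E0. simpl. ring.
Qed.

End LFunction.

Open Scope C_scope.

Theorem theorem3p9 :
  (forall (k : nat) (tau : nat -> C) (L Lam : C -> C),
     In k [12; 16; 18; 20; 22; 26]%nat ->
     is_q_expansion (Delta_form k) tau ->
     is_L_function k tau L ->
     is_completed_L_function k L Lam ->
     super_positive Lam) /\
  (forall (k : nat) (tau : nat -> C) (L : C -> C),
     In k [12; 16; 20]%nat ->
     is_q_expansion (Delta_form k) tau ->
     is_L_function k tau L ->
     is_ord L (1 / 2) 0) /\
  (forall (k : nat) (tau : nat -> C) (L : C -> C),
     In k [18; 22; 26]%nat ->
     is_q_expansion (Delta_form k) tau ->
     is_L_function k tau L ->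
     is_ord L (1 / 2) 1).
Proof.
  split; [|split].
  - intros k tau L Lam Hk Hq HL HLam.
    assert (Hj : exists j, In j [0; 2; 3; 4; 5; 7]%nat /\ k = (12 + 2 * j)%nat).
    { simpl in Hk. destruct Hk as [<-|[<-|[<-|[<-|[<-|[<-|[]]]]]]];
        [exists 0%nat|exists 2%nat|exists 3%nat|exists 4%nat|exists 5%nat|exists 7%nat]; simpl; tauto. }
    destruct Hj as [j [Hj ->]]. exact (super_positivity j tau L Hj Hq HL Lam HLam).
  - intros k tau L Hk Hq HL.
    assert (Hj : exists j, In j [0; 2; 3; 4; 5; 7]%nat /\ k = (12 + 2 * j)%nat /\ ((-1) ^ j = 1)%R).
    { simpl in Hk. destruct Hk as [<-|[<-|[<-|[]]]]; [exists 0%nat|exists 2%nat|exists 4%nat];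
        (split; [simpl; tauto|split; [reflexivity|simpl; ring]]). }
    destruct Hj as [j [Hj [-> Hs]]]. exact (order_zero j tau L Hj Hq HL Hs).
  - intros k tau L Hk Hq HL.
    assert (Hj : exists j, In j [0; 2; 3; 4; 5; 7]%nat /\ k = (12 + 2 * j)%nat /\ ((-1) ^ j = -1)%R).
    { simpl in Hk. destruct Hk as [<-|[<-|[<-|[]]]]; [exists 3%nat|exists 5%nat|exists 7%nat];
        (split; [simpl; tauto|split; [reflexivity|simpl; ring]]). }
    destruct Hj as [j [Hj [-> Hs]]]. exact (order_one j tau L Hj Hq HL Hs).
Qed.
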